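(* Let $d\in\{2,3\}$, $p>1$, $a_0\in\mathcal{S}(\mathbb{R}^d)$ (complex-valued), and let $\alpha\in\mathcal{S}(\mathbb{R}^d)$ be nonnegative and compactly supported. Fix $T>0$ large enough that the support of $\alpha$ is contained in $\{|x|<T\}$. For $\xi\in\mathbb{R}^d$ with $|\xi|=1$ and $\varepsilon>0$, define $$u_0(x)=\varepsilon^{p}a_0(\varepsilon[x+T\xi])\exp\{i[x\cdot\xi+\tfrac12T]\}$$ and $$v(t,x)=\varepsilon^{p}a_0(\varepsilon(x-t\xi))\exp\{i[x\cdot\xi-\tfrac12t]\}\,\exp\Bigl\{-i|\varepsilon^pa_0(\varepsilon(x-t\xi))|^2\int_{-T}^t\alpha(x-(t-s)\xi)\,ds\Bigr\}.$$ Then, with $d$ and $a_0$ regarded as fixed, there exists $\varepsilon_0=\varepsilon_0(T,p,\|\hat\alpha\|_{L^1})>0$ such that for all $0<\varepsilon<\varepsilon_0$ and all $\xi$ with $|\xi|=1$, the solution $u$ to $$(i\partial_t+\tfrac12\Delta)u=\alpha|u|^2u,\qquad u|_{t=-T}=u_0,$$ exists on the time interval $[-T,T]$, and for all sufficiently small $\sigma>0$ there is a constant $C_\sigma$ (which may depend on $\sigma,d,p,T,a_0,\alpha$ but not on $\varepsilon$ or $\xi$) such that $$\|u-v\|_{L^\infty_{t,x}([-T,T]\times\mathbb{R}^d)}\le C_\sigma\max\{\varepsilon^{p+2},\varepsilon^{3p-2-\sigma}\}.$$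
   Context: The Fourier transform is $\hat u(y)=\mathcal{F}u(y)=\int_{\mathbb{R}^d}e^{-ix\cdot y}u(x)\,dx$. The Wiener algebra $\mathcal{F}L^1(\mathbb{R}^d)$ consists of $u$ with $\hat u\in L^1(\mathbb{R}^d)$, with norm $\|u\|_{\mathcal{F}L^1}=\|\hat u\|_{L^1}$. $\mathcal{S}(\mathbb{R}^d)$ is the Schwartz space. The free Schrödinger propagator is $e^{it\Delta/2}=\mathcal{F}^{-1}e^{-it|y|^2/2}\mathcal{F}$. A solution on $[-T,T]$ to the initial value problem means a function $u\in L^\infty_t([-T,T];\mathcal{F}L^1(\mathbb{R}^d))$ satisfying the Duhamel formula $u(t)=e^{i(t+T)\Delta/2}u_0-i\int_{-T}^te^{i(t-s)\Delta/2}[\alpha|u|^2u](s)\,ds$ for $t\in[-T,T]$. *)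

(* Defs.v *)
From HB Require Import structures.
From mathcomp Require Import all_boot all_order all_algebra.
From mathcomp Require Import all_classical all_reals all_analysis.
From mathcomp Require Import ess_sup_inf complex.
Set Implicit Arguments.
Unset Strict Implicit.
Unset Printing Implicit Defensive.
Import Order.TTheory GRing.Theory Num.Theory.
Import numFieldNormedType.Exports.

Local Open Scope classical_set_scope.
Local Open Scope complex_scope.
Local Open Scope ring_scope.

(* R^d is 'rV[R]_d (the library's normed module, with its sup norm), equipped
   here with the sigma-algebra generated by the coordinates, i.e. the Borel
   sigma-algebra, as the library does for d.-tuple R. *)
Definition measure_rV_display : measure_display -> measure_display.
Proof. exact. Qed.

Section measurable_rV.
Context {dR : measure_display} {T : measurableType dR}.
Variable n : nat.

Let coords : 'I_n -> 'rV[T]_n -> T := fun i x => x ord0 i.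

Let rV_set0 : g_sigma_preimage coords set0.
Proof. exact: sigma_algebra0. Qed.

Let rV_setC A : g_sigma_preimage coords A -> g_sigma_preimage coords (~` A).
Proof. exact: sigma_algebraC. Qed.

Let rV_bigcup (F : (set _)^nat) : (forall i, g_sigma_preimage coords (F i)) ->
  g_sigma_preimage coords (\bigcup_i (F i)).
Proof. exact: sigma_algebra_bigcup. Qed.

HB.instance Definition _ := @isMeasurable.Build (measure_rV_display dR)
  'rV[T]_n (g_sigma_preimage coords) rV_set0 rV_setC rV_bigcup.

End measurable_rV.

Lemma measurable_coord_rV dR (T : measurableType dR) n (i : 'I_n) :
  measurable_fun [set: 'rV[T]_n] (fun x => x ord0 i).
Proof.
move=> _ Y mY; rewrite setTI; apply: sub_sigma_algebra => /=.
rewrite -bigcup_seq/=; exists i => /=; first by rewrite mem_index_enum.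
by exists Y => //; rewrite setTI.
Qed.

Lemma measurable_fun_rVP dR dT (T : measurableType dR) (X : measurableType dT)
    n (f : X -> 'rV[T]_n) :
  (forall i, measurable_fun [set: X] (fun x => f x ord0 i)) ->
  measurable_fun [set: X] f.
Proof.
move=> mf; suff : g_sigma_preimage (fun i x => f x ord0 i) `<=` measurable.
  rewrite (_ : (fun i x => _) = (fun i => (fun y : 'rV[T]_n => y ord0 i) \o f))//.
  by rewrite g_sigma_preimage_comp => h _ A mA; apply: h; exists A.
apply: smallest_sub; first exact: sigma_algebra_measurable.
case: n f mf => [f mf|n f mf]; first by rewrite big_ord0.
rewrite -bigcup_mkord_ord; apply: bigcup_sub => i Ii.
by move=> A [B mB <-]; exact: mf.
Qed.

Section lebesgue_rV.
Context {R : realType}.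

Definition rV_cons n (p : R * 'rV[R]_n) : 'rV[R]_n.+1 := row_mx p.1%:M p.2.

Lemma rV_consE n p i :
  @rV_cons n p ord0 i = if unlift ord0 i is Some j then p.2 ord0 j else p.1.
Proof.
rewrite /rV_cons; case: unliftP => [j|] ->.
  have -> : lift ord0 j = rshift 1 j by exact: ord_inj.
  exact: row_mxEr.
have -> : (ord0 : 'I_n.+1) = lshift n (ord0 : 'I_1) by exact: ord_inj.
by apply: etrans (row_mxEl _ _ _ _) _; rewrite mxE.
Qed.

Lemma measurable_rV_cons n : measurable_fun [set: R * 'rV[R]_n] (@rV_cons n).
Proof.
apply: measurable_fun_rVP => i.
under eq_fun do rewrite rV_consE.
case: unliftP => [j _|_]; last exact: measurable_fst.
by apply: (measurableT_comp (measurable_coord_rV j)).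
Qed.

Definition rV_uncons n (v : 'rV[R]_n.+1) : R * 'rV[R]_n :=
  (v ord0 ord0, \row_j v ord0 (lift ord0 j)).

Lemma measurable_rV_uncons n : measurable_fun [set: 'rV[R]_n.+1] (@rV_uncons n).
Proof.
apply: measurable_fun_pair; first exact: measurable_coord_rV.
apply: measurable_fun_rVP => i.
by under eq_fun do rewrite mxE; exact: measurable_coord_rV.
Qed.

Lemma rV_unconsK n : cancel (@rV_uncons n) (@rV_cons n).
Proof.
move=> v; apply/rowP => i; rewrite rV_consE.
by case: unliftP => [j|] -> //=; rewrite mxE.
Qed.

Lemma rV_consK n : cancel (@rV_cons n) (@rV_uncons n).
Proof.
move=> [x v]; rewrite /rV_uncons rV_consE unlift_none/=; congr pair.
by apply/rowP => j; rewrite mxE rV_consE liftK.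
Qed.

Section step.
Variables (n : nat) (m : {sigma_finite_measure set 'rV[R]_n -> \bar R}).

Definition lebesgue_rVS : set 'rV[R]_n.+1 -> \bar R :=
  pushforward (@lebesgue_measure R \x m)%E (@rV_cons n).

Let mcons : measurable_fun setT (@rV_cons n).
Proof. exact: measurable_rV_cons. Qed.

Let lebS0 : lebesgue_rVS set0 = 0%E.
Proof. by rewrite /lebesgue_rVS /pushforward preimage_set0 measure0. Qed.

Let lebS_ge0 A : (0 <= lebesgue_rVS A)%E.
Proof. exact: measure_ge0. Qed.

Let lebS_sigma_additive : semi_sigma_additive lebesgue_rVS.
Proof.
exact: measure_semi_sigma_additive.
Qed.

HB.instance Definition _ := isMeasure.Build _ _ _ lebesgue_rVS
  lebS0 lebS_ge0 lebS_sigma_additive.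

Let lebS_sigma_finite : sigma_finite setT lebesgue_rVS.
Proof.
have /sigma_finiteP[F [TF ndF Foo]] := sigma_finiteT (@lebesgue_measure R).
have /sigma_finiteP[G [TG ndG Goo]] := sigma_finiteT m.
exists (fun k => @rV_uncons n @^-1` (F k `*` G k)).
  rewrite -preimage_bigcup (_ : \bigcup_k _ = setT) ?preimage_setT//.
  rewrite -setXTT TF TG; apply/seteqP; split => [[x v] [k _ [Fx Gv]]|[x v] /=].
    by split; exists k.
  move=> [[i _ Fx] [j _ Gv]]; exists (maxn i j) => //; split.
  - by move: x Fx; exact/subsetPset/ndF/leq_maxl.
  - by move: v Gv; exact/subsetPset/ndG/leq_maxr.
move=> k; have [mF Fk] := Foo k; have [mG Gk] := Goo k; split.
  rewrite -[X in measurable X]setTI; apply: measurable_rV_uncons => //.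
  exact: measurableX.
rewrite /lebesgue_rVS /pushforward -comp_preimage.
rewrite (_ : _ \o _ = id); last by apply/funext => p; exact: rV_consK.
by rewrite preimage_id product_measure1E// lte_mul_pinfty// ge0_fin_numE.
Qed.

HB.instance Definition _ := Measure_isSigmaFinite.Build _ _ _ lebesgue_rVS
  lebS_sigma_finite.

End step.

(* Lebesgue measure on R^d, by iterated products: lebesgue_rV_box below. *)
Fixpoint lebesgue_rV n : {sigma_finite_measure set 'rV[R]_n -> \bar R} :=
  match n with
  | 0 => \d_ (0 : 'rV[R]_0)
  | k.+1 => lebesgue_rVS (lebesgue_rV k)
  end.

Lemma lebesgue_rV_box n (A : 'I_n -> set R) :
  (forall i, measurable (A i)) ->
  lebesgue_rV n [set x | forall i, A i (x ord0 i)] =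
  (\prod_(i < n) @lebesgue_measure R (A i))%E.
Proof.
elim: n A => [|n IH] A mA.
  rewrite big_ord0 -(@diracT _ _ R (0 : 'rV[R]_0)).
  by congr (\d__ _); apply/seteqP; split => // x _ [].
pose B : set 'rV[R]_n := [set x | forall i, A (lift ord0 i) (x ord0 i)].
have mB : measurable B.
  have -> : B = \bigcap_(i in [set: 'I_n])
     ((fun x : 'rV[R]_n => x ord0 i) @^-1` A (lift ord0 i)).
    by apply/seteqP; split => x /= h i; [move=> _; exact: h|exact: h].
  apply: fin_bigcap_measurable => // i _.
  by rewrite -[X in measurable X]setTI; exact: measurable_coord_rV.
rewrite big_ord_recl -IH// -/B -product_measure1E//; last exact: mA.
rewrite /= /lebesgue_rVS /pushforward.
congr (product_measure1 _ _ _); apply/seteqP; split => [[x v] /= h|[x v] /= [h0 h] i].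
  split => [|i]; first by have := h ord0; rewrite rV_consE unlift_none.
  by have := h (lift ord0 i); rewrite rV_consE liftK.
by rewrite rV_consE; case: unliftP => [j|] ->.
Qed.
End lebesgue_rV.

(* The library's norm on 'rV[R]_d is the max norm, not the Euclidean one. *)
Definition dotrV {R : realType} {d : nat} (x y : 'rV[R]_d) : R :=
  \sum_(i < d) x ord0 i * y ord0 i.

Definition enorm {R : realType} {d : nat} (x : 'rV[R]_d) : R :=
  Num.sqrt (dotrV x x).

Section complex_valued.
Context {R : realType}.

Definition cabs (z : R[i]) : R := Normc.normc z.

(* e^{i theta} *)
Definition cis (theta : R) : R[i] := cos theta +i* sin theta.

Context {dX : measure_display} {X : measurableType dX}.

Definition cmeasurable (D : set X) (f : X -> R[i]) : Prop :=
  measurable_fun D (fun x => complex.Re (f x)) /\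
  measurable_fun D (fun x => complex.Im (f x)).

Variable mu : {measure set X -> \bar R}.

Definition cintegrable (D : set X) (f : X -> R[i]) : Prop :=
  mu.-integrable D (fun x => (complex.Re (f x))%:E) /\
  mu.-integrable D (fun x => (complex.Im (f x))%:E).

Definition cintegral (D : set X) (f : X -> R[i]) : R[i] :=
  (\int[mu]_(x in D) complex.Re (f x)) +i* (\int[mu]_(x in D) complex.Im (f x)).

Definition L1norm (f : X -> R[i]) : \bar R := (\int[mu]_x (cabs (f x))%:E)%E.

(* L^oo(D) norm of a nonnegative function (f is extended by 0 outside D) *)
Definition Linfty_norm (D : set X) (f : X -> \bar R) : \bar R :=
  ess_sup mu (f \_ D).

End complex_valued.

Section wiener.
Context {R : realType} {d : nat}.
Local Notation Rd := 'rV[R]_d.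
Local Notation leb := (@lebesgue_rV R d).

Definition partial (i : 'I_d) (f : Rd -> R) : Rd -> R :=
  fun x => 'D_(delta_mx ord0 i) f x.

(* d_{i_1} ... d_{i_k} f for s = [:: i_1; ...; i_k] *)
Definition partials (s : seq 'I_d) (f : Rd -> R) : Rd -> R :=
  foldr partial f s.

Definition schwartz (f : Rd -> R) : Prop :=
  forall s : seq 'I_d,
    (forall x, differentiable (partials s f) x) /\
    forall k : nat, exists C : R,
      forall x, enorm x ^+ k * `|partials s f x| <= C.

Definition cschwartz (f : Rd -> R[i]) : Prop :=
  schwartz (fun x => complex.Re (f x)) /\ schwartz (fun x => complex.Im (f x)).

Definition closed_support (f : Rd -> R) : set Rd := closure [set x | f x != 0].

Definition fourier (u : Rd -> R[i]) : Rd -> R[i] := fun y =>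
  cintegral leb setT (fun x => cis (- dotrV x y) * u x).

Definition inv_fourier (g : Rd -> R[i]) : Rd -> R[i] := fun x =>
  (((2 * pi) ^+ d)^-1)%:C * cintegral leb setT (fun y => cis (dotrV x y) * g y).

(* functions that define a tempered distribution *)
Definition tempered (u : Rd -> R[i]) : Prop :=
  cmeasurable setT u /\
  forall phi, cschwartz phi -> cintegrable leb setT (fun x => u x * phi x).

(* hat u = g as tempered distributions: an element of the Wiener algebra need
   not be integrable, so that the integral [fourier u] may be undefined. *)
Definition is_fourier (u g : Rd -> R[i]) : Prop :=
  [/\ tempered u, tempered g &
   forall phi, cschwartz phi ->
     cintegral leb setT (fun y => g y * phi y) =
     cintegral leb setT (fun x => u x * fourier phi x)].

(* u \in L^oo([-T, T]; F L^1). The joint measurability of (t, y) |-> hat u(t)(y)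
   is the strong measurability of t |-> hat u(t) \in L^1. *)
Definition Linfty_wiener (T : R) (u : R -> Rd -> R[i]) : Prop :=
  exists uhat : R -> Rd -> R[i],
    [/\ cmeasurable (`[- T, T] `*` [set: Rd]) (fun z => uhat z.1 z.2),
     {ae lebesgue_measure, forall t, t \in `[- T, T] ->
        is_fourier (u t) (uhat t)} &
     (Linfty_norm lebesgue_measure `[(- T)%R, T] (fun t => L1norm leb (uhat t))
        < +oo)%E].

(* e^{i t Delta / 2} f. In [solution] it is applied to integrable functions
   only, namely to u_0 and to alpha |u|^2 u with alpha bounded of compact
   support, so that [fourier] is the right Fourier transform. *)
Definition propagator (t : R) (f : Rd -> R[i]) : Rd -> R[i] :=
  inv_fourier (fun y => cis (- (t * enorm y ^+ 2 / 2)) * fourier f y).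

Definition nonlinearity (alpha : Rd -> R) (w : Rd -> R[i]) : Rd -> R[i] :=
  fun x => (alpha x)%:C * (cabs (w x) ^+ 2)%:C * w x.

Definition solution (T : R) (alpha : Rd -> R) (u0 : Rd -> R[i])
    (u : R -> Rd -> R[i]) : Prop :=
  Linfty_wiener T u /\
  forall t x, t \in `[- T, T] ->
    u t x = propagator (t + T) u0 x
      - 'i%C * cintegral lebesgue_measure `[- T, t]
               (fun s => propagator (t - s) (nonlinearity alpha (u s)) x).

Definition initial_datum (T p eps : R) (a0 : Rd -> R[i]) (xi : Rd) :
    Rd -> R[i] := fun x =>
  (eps `^ p)%:C * a0 (eps *: (x + T *: xi)) * cis (dotrV x xi + T / 2).

Definition approx_solution (T p eps : R) (a0 : Rd -> R[i]) (alpha : Rd -> R)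
    (xi : Rd) : R -> Rd -> R[i] := fun t x =>
  let a := (eps `^ p)%:C * a0 (eps *: (x - t *: xi)) in
  a * cis (dotrV x xi - t / 2) *
  cis (- (cabs a ^+ 2 *
          \int[lebesgue_measure]_(s in `[- T, t]) alpha (x - (t - s) *: xi))).

Definition Linfty_tx_norm (T : R) (w : R -> Rd -> R[i]) : \bar R :=
  Linfty_norm (@lebesgue_measure R \x leb)%E (`[- T, T] `*` [set: Rd])
    (fun z => (cabs (w z.1 z.2))%:E).

End wiener.

(* Main.v *)
Require Import Defs.
From mathcomp Require Import all_boot all_order all_algebra.
From mathcomp Require Import all_classical all_reals all_analysis.
From mathcomp Require Import ess_sup_inf complex measurable_realfun ring lra.

(** The datum has amplitude [eps `^ p] in the Wiener algebra [F L^1], which is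
    invariant under the free evolution and stable under products. Hence the
    cubic term contributes [O(eps^(3p))] to the solution on a fixed time interval,
    and so does the nonlinear phase of the approximate solution, because
    [alpha] is bounded and the phase is quadratic in the amplitude. Since
    [3 p > 3 p - 2 - sigma] and [eps < 1], both are within the allowed error, and
    what has to be compared is the free evolution of the datum with the wave
    packet [eps^p a0(eps(x - t xi)) e^(i(x.xi - t/2))]. After the substitution
    [y = xi + eps eta] in frequency these two differ by the factor
    [e^(-i(t + T) eps^2 |eta|^2 / 2)], which is [1 + O(eps^2 |eta|^2)]; as
    [fourier a0] has a second moment, the difference is [O(eps^(p + 2))], uniformly
    in [x], [t] and [xi] ([linear_error], [nonlinear_phase_error],
    [pointwise_error]).

    Existence and uniqueness are obtained on the Fourier side, for paths
    [U : R -> L^1] in frequency. There the free evolution is multiplication by a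
    unimodular function, and the Duhamel formula is the map [picard]. The
    trilinear estimate [cubic_wiener] makes it a contraction for small [eps]
    ([small_data], [picard_fixpoint]), and with a Gronwall argument it gives
    uniqueness without any smallness ([picard_unique]).

    The link with functions on space is the statement that an element of the
    Wiener algebra, whose Fourier transform is given as a tempered distribution,
    agrees almost everywhere with the inverse Fourier integral of that transform
    ([wiener_is_fourier], [is_fourier_ae]). It rests on Fourier inversion for
    Schwartz functions ([schwartz_inversion]), proved by Gaussian regularisation,
    and on the fact that a function orthogonal to all Gaussian bumps vanishes
    almost everywhere ([gauss_tests_ae0]). Through it every solution is
    represented, at every time and every point, by a fixed point of [picard]
    ([fixpoint_of_solution]), and every fixed point represents a solution
    ([solution_of_fixpoint]). *)

Set Implicit Arguments.
Unset Strict Implicit.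
Unset Printing Implicit Defensive.
Import Order.TTheory GRing.Theory Num.Theory.
Import numFieldNormedType.Exports.

Local Open Scope classical_set_scope.
Local Open Scope complex_scope.
Local Open Scope ring_scope.

(** * Complex modulus and unit phases *)

Section ComplexBasics.
Context {R : realType}.
Implicit Types (z w : R[i]) (a b : R).
Local Notation Re := complex.Re.
Local Notation Im := complex.Im.

Lemma cabs_ge0 z : 0 <= cabs z.
Proof. by case: z => a b /=; rewrite sqrtr_ge0. Qed.

Lemma cabs0 : cabs (0 : R[i]) = 0.
Proof. exact: Normc.normc0. Qed.

Lemma cabsM z w : cabs (z * w) = cabs z * cabs w.
Proof. exact: Normc.normcM. Qed.

Lemma cabsN z : cabs (- z) = cabs z.
Proof. exact: normcN. Qed.

Lemma cabs_eq0 z : cabs z = 0 -> z = 0.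
Proof. exact: Normc.eq0_normc. Qed.

Lemma le_cabsD z w : cabs (z + w) <= cabs z + cabs w.
Proof. exact: le_normcD. Qed.

Lemma le_cabsB z w : cabs (z - w) <= cabs z + cabs w.
Proof. by rewrite -(cabsN w); exact: le_cabsD. Qed.

Lemma cabs_distC z w : cabs (z - w) = cabs (w - z).
Proof. by rewrite -cabsN opprB. Qed.

Lemma cabs_real a : cabs a%:C = `|a|.
Proof. by rewrite /cabs /= expr0n/= addr0 sqrtr_sqr. Qed.

Lemma cabs_conj z : cabs z^* = cabs z.
Proof. by case: z => a b /=; rewrite sqrrN. Qed.

Lemma cabs_i : cabs ('i : R[i]) = 1.
Proof. by rewrite /cabs /= expr0n/= add0r expr1n sqrtr1. Qed.

Lemma sqr_cabs z : cabs z ^+ 2 = Re z ^+ 2 + Im z ^+ 2.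
Proof. by case: z => a b /=; rewrite sqr_sqrtr// addr_ge0 ?sqr_ge0. Qed.

Lemma sqr_cabsC z : (cabs z ^+ 2)%:C = z * z^*.
Proof.
by rewrite sqr_cabs; case: z => a b /=; simpc; congr Complex; ring.
Qed.

Lemma le_Re_cabs z : `|Re z| <= cabs z.
Proof.
by case: z => a b /=; rewrite -sqrtr_sqr ler_sqrt ?addr_ge0 ?sqr_ge0// lerDl sqr_ge0.
Qed.

Lemma le_Im_cabs z : `|Im z| <= cabs z.
Proof.
by case: z => a b /=; rewrite -sqrtr_sqr ler_sqrt ?addr_ge0 ?sqr_ge0// lerDr sqr_ge0.
Qed.

Lemma cabs_le_ReIm z : cabs z <= `|Re z| + `|Im z|.
Proof.
rewrite {1}[z]complexE (le_trans (le_cabsD _ _))// cabsM cabs_i mul1r !cabs_real//.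
Qed.

Lemma ReB z w : Re (z - w) = Re z - Re w.
Proof. by case: z w => [a b] [c e]. Qed.
Lemma ImB z w : Im (z - w) = Im z - Im w.
Proof. by case: z w => [a b] [c e]. Qed.
Lemma ReD z w : Re (z + w) = Re z + Re w.
Proof. by case: z w => [a b] [c e]. Qed.
Lemma ImD z w : Im (z + w) = Im z + Im w.
Proof. by case: z w => [a b] [c e]. Qed.
Lemma ReM z w : Re (z * w) = Re z * Re w - Im z * Im w.
Proof. by case: z w => [a b] [c e]. Qed.
Lemma ImM z w : Im (z * w) = Re z * Im w + Im z * Re w.
Proof. by case: z w => [a b] [c e]. Qed.
Lemma Re_conj z : Re z^* = Re z. Proof. by case: z. Qed.
Lemma Im_conj z : Im z^* = - Im z. Proof. by case: z. Qed.

Lemma cabs_cis a : cabs (cis a) = 1.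
Proof. by rewrite /cabs /= cos2Dsin2 sqrtr1. Qed.

Lemma cisD a b : cis (a + b) = cis a * cis b.
Proof. by rewrite /cis cosD sinD; simpc; congr Complex; ring. Qed.

Lemma cis0 : cis 0 = 1 :> R[i].
Proof. by rewrite /cis cos0 sin0. Qed.

Lemma conj_cis a : (cis a)^* = cis (- a).
Proof. by rewrite /cis cosN sinN. Qed.

Lemma cabs_cisM a z : cabs (cis a * z) = cabs z.
Proof. by rewrite cabsM cabs_cis mul1r. Qed.

End ComplexBasics.

(** * Measurability and integration of complex functions *)

Section ComplexMeasurable.
Context {R : realType} {dX : measure_display} {X : measurableType dX}.
Implicit Types (D : set X) (f g : X -> R[i]) (h : X -> R).
Local Notation Re := complex.Re.
Local Notation Im := complex.Im.

Lemma cmeasurable_cst D (c : R[i]) : cmeasurable D (fun=> c).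
Proof. by split; exact: measurable_cst. Qed.

Lemma cmeasurable_real D h : measurable_fun D h -> cmeasurable D (fun x => (h x)%:C).
Proof. by move=> mh; split => //=; exact: measurable_cst. Qed.

Lemma cmeasurable_cis D h : measurable_fun D h -> cmeasurable D (fun x => cis (h x)).
Proof.
move=> mh; split => /=; apply: measurableT_comp => //.
  by apply: continuous_measurable_fun; exact: continuous_cos.
by apply: continuous_measurable_fun; exact: continuous_sin.
Qed.

Lemma cmeasurableD D f g : cmeasurable D f -> cmeasurable D g ->
  cmeasurable D (fun x => f x + g x).
Proof.
move=> [f1 f2] [g1 g2]; split; [under eq_fun do rewrite ReD | under eq_fun do rewrite ImD].
  exact: measurable_funD.
exact: measurable_funD.
Qed.

Lemma cmeasurableB D f g : cmeasurable D f -> cmeasurable D g ->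
  cmeasurable D (fun x => f x - g x).
Proof.
move=> [f1 f2] [g1 g2]; split; [under eq_fun do rewrite ReB | under eq_fun do rewrite ImB].
  exact: measurable_funB.
exact: measurable_funB.
Qed.

Lemma cmeasurableM D f g : cmeasurable D f -> cmeasurable D g ->
  cmeasurable D (fun x => f x * g x).
Proof.
move=> [f1 f2] [g1 g2]; split; [under eq_fun do rewrite ReM | under eq_fun do rewrite ImM].
  by apply: measurable_funB; exact: measurable_funM.
by apply: measurable_funD; exact: measurable_funM.
Qed.

Lemma cmeasurable_conj D f : cmeasurable D f -> cmeasurable D (fun x => (f x)^*).
Proof.
move=> [f1 f2]; split; [under eq_fun do rewrite Re_conj | under eq_fun do rewrite Im_conj] => //.
exact: measurableT_comp.
Qed.

Lemma measurable_cabs D f : cmeasurable D f -> measurable_fun D (fun x => cabs (f x)).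
Proof.
move=> [f1 f2].
have -> : (fun x => cabs (f x)) = (fun x => Num.sqrt (Re (f x) ^+ 2 + Im (f x) ^+ 2)).
  by apply/funext => x; rewrite -sqr_cabs sqrtr_sqr ger0_norm ?cabs_ge0.
apply: (measurableT_comp (f := @Num.sqrt R)).
  by apply: continuous_measurable_fun; exact: sqrt_continuous.
by apply: measurable_funD; exact: measurable_funX.
Qed.

Lemma measurable_cabs_EFin D f : cmeasurable D f ->
  measurable_fun D (fun x => (cabs (f x))%:E).
Proof. by move=> mf; apply/measurable_EFinP; exact: measurable_cabs. Qed.

Lemma cmeasurable_funS D E f : measurable E -> D `<=` E -> cmeasurable E f ->
  cmeasurable D f.
Proof. by move=> mE DE [f1 f2]; split; exact: (measurable_funS mE DE). Qed.

Lemma cmeasurable_comp {dY : measure_display} {Y : measurableType dY}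
    (D : set Y) (p : Y -> X) f : measurable_fun D p ->
  cmeasurable setT f -> cmeasurable D (fun y => f (p y)).
Proof. by move=> mp [f1 f2]; split; [exact: (measurableT_comp f1 mp)|exact: (measurableT_comp f2 mp)]. Qed.

Lemma cmeasurable_if D (A : set X) f : measurable D -> measurable A ->
  cmeasurable (D `&` A) f -> cmeasurable D (fun x => if x \in A then f x else 0).
Proof.
move=> mD mA [f1 f2]; split.
  have -> : (fun x => Re (if x \in A then f x else 0)) = ((fun x => Re (f x)) \_ A).
    by apply/funext => x; rewrite patchE; case: ifP.
  by apply/measurable_restrict.
have -> : (fun x => Im (if x \in A then f x else 0)) = ((fun x => Im (f x)) \_ A).
  by apply/funext => x; rewrite patchE; case: ifP.
by apply/measurable_restrict.
Qed.

End ComplexMeasurable.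

Section ComplexIntegral.
Context {R : realType} {dX : measure_display} {X : measurableType dX}.
Variable mu : {measure set X -> \bar R}.
Implicit Types (D : set X) (f g : X -> R[i]) (h : X -> R).
Local Notation Re := complex.Re.
Local Notation Im := complex.Im.

Lemma cintegrable_cmeasurable D f : cintegrable mu D f -> cmeasurable D f.
Proof.
by move=> [/integrableP[/measurable_EFinP f1 _] /integrableP[/measurable_EFinP f2 _]].
Qed.

Lemma cintegrable_cabs D f : measurable D -> cintegrable mu D f ->
  mu.-integrable D (fun x => (cabs (f x))%:E).
Proof.
move=> mD fi; have [f1 f2] := fi.
apply: (@le_integrable _ _ _ mu D mD _
  (fun x => (`|(Re (f x))%:E| + `|(Im (f x))%:E|)%E)).
- exact/measurable_cabs_EFin/cintegrable_cmeasurable.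
- move=> x _ /=; rewrite lee_fin ger0_norm ?cabs_ge0//.
  by rewrite ger0_norm ?addr_ge0// cabs_le_ReIm.
- by apply: integrableD => //; exact: integrable_abse.
Qed.

Lemma cintegrableP D f : measurable D ->
  cintegrable mu D f <->
  cmeasurable D f /\ (\int[mu]_(x in D) (cabs (f x))%:E < +oo)%E.
Proof.
move=> mD; split => [fi|[mf fi]].
  split; first exact: cintegrable_cmeasurable fi.
  have /integrableP[_] := cintegrable_cabs mD fi.
  by under eq_integral do rewrite gee0_abs ?lee_fin ?cabs_ge0//.
have i : mu.-integrable D (fun x => (cabs (f x))%:E).
  apply/integrableP; split; first exact: measurable_cabs_EFin.
  by under eq_integral do rewrite gee0_abs ?lee_fin ?cabs_ge0//.
have [f1 f2] := mf; split.
- apply: le_integrable i => //; first exact/measurable_EFinP.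
  by move=> x _ /=; rewrite lee_fin [in leRHS]ger0_norm ?cabs_ge0// le_Re_cabs.
- apply: le_integrable i => //; first exact/measurable_EFinP.
  by move=> x _ /=; rewrite lee_fin [in leRHS]ger0_norm ?cabs_ge0// le_Im_cabs.
Qed.

Lemma le_cintegrable D f h : measurable D -> cmeasurable D f ->
  mu.-integrable D (EFin \o h) -> (forall x, D x -> cabs (f x) <= h x) ->
  cintegrable mu D f.
Proof.
move=> mD mf hi fh; apply/cintegrableP => //; split => //.
have /integrableP[mh] := hi; apply: le_lt_trans; apply: ge0_le_integral => //.
- by move=> x _; rewrite lee_fin cabs_ge0.
- exact: measurable_cabs_EFin.
- exact: measurableT_comp.
- by move=> x Dx /=; rewrite lee_fin (le_trans (fh _ Dx))// ler_norm.
Qed.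

Lemma cintegrableD D f g : measurable D -> cintegrable mu D f -> cintegrable mu D g ->
  cintegrable mu D (fun x => f x + g x).
Proof.
move=> mD [f1 f2] [g1 g2]; split.
- by under eq_fun do rewrite ReD EFinD; exact: integrableD.
- by under eq_fun do rewrite ImD EFinD; exact: integrableD.
Qed.

Lemma cintegrableB D f g : measurable D -> cintegrable mu D f -> cintegrable mu D g ->
  cintegrable mu D (fun x => f x - g x).
Proof.
move=> mD [f1 f2] [g1 g2]; split.
- by under eq_fun do rewrite ReB EFinB; exact: integrableB.
- by under eq_fun do rewrite ImB EFinB; exact: integrableB.
Qed.

Lemma cintegrableMb D f g (C : R) : measurable D -> cintegrable mu D f -> cmeasurable D g ->
  (forall x, D x -> cabs (g x) <= C) -> cintegrable mu D (fun x => f x * g x).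
Proof.
move=> mD fi mg gC.
apply: (@le_cintegrable _ _ (fun x => C * cabs (f x))) => //.
- by apply: cmeasurableM => //; exact: cintegrable_cmeasurable fi.
- apply: (eq_integrable mD (fun x => (C%:E * (cabs (f x))%:E)%E)) => //.
  by apply: integrableZl => //; exact: cintegrable_cabs.
- by move=> x Dx; rewrite cabsM mulrC ler_wpM2r ?cabs_ge0 ?gC.
Qed.

Lemma cintegrableZl D f (c : R[i]) : measurable D -> cintegrable mu D f ->
  cintegrable mu D (fun x => c * f x).
Proof.
move=> mD fi; under eq_fun do rewrite mulrC.
by apply: (cintegrableMb (C := cabs c)) => //; exact: cmeasurable_cst.
Qed.

Lemma cintegrable_cisM D f h : measurable D -> measurable_fun D h ->
  cintegrable mu D f -> cintegrable mu D (fun x => cis (h x) * f x).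
Proof.
move=> mD mh fi; under eq_fun do rewrite mulrC.
apply: (cintegrableMb (C := 1)) => //; first exact: cmeasurable_cis.
by move=> x _; rewrite cabs_cis.
Qed.

Lemma eq_cintegral D f g : {in D, f =1 g} -> cintegral mu D f = cintegral mu D g.
Proof.
by move=> fg; congr Complex; apply: eq_Rintegral => x Dx; rewrite fg.
Qed.

Lemma cintegralD D f g : measurable D -> cintegrable mu D f -> cintegrable mu D g ->
  cintegral mu D (fun x => f x + g x) = cintegral mu D f + cintegral mu D g.
Proof.
move=> mD [f1 f2] [g1 g2]; rewrite /cintegral; simpc; congr Complex.
  by under eq_Rintegral do rewrite ReD; rewrite RintegralD.
by under eq_Rintegral do rewrite ImD; rewrite RintegralD.
Qed.

Lemma cintegralB D f g : measurable D -> cintegrable mu D f -> cintegrable mu D g ->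
  cintegral mu D (fun x => f x - g x) = cintegral mu D f - cintegral mu D g.
Proof.
move=> mD [f1 f2] [g1 g2]; rewrite /cintegral; simpc; congr Complex.
  by under eq_Rintegral do rewrite ReB; rewrite RintegralB.
by under eq_Rintegral do rewrite ImB; rewrite RintegralB.
Qed.

Lemma cintegralZl D f (c : R[i]) : measurable D -> cintegrable mu D f ->
  cintegral mu D (fun x => c * f x) = c * cintegral mu D f.
Proof.
move=> mD [f1 f2]; case: c => a b; rewrite /cintegral; simpc; congr Complex.
  under eq_Rintegral do rewrite ReM /=.
  rewrite RintegralB// ?RintegralZl//.
    by apply: (eq_integrable mD (fun x => (a%:E * (Re (f x))%:E)%E)) => //; exact: integrableZl.
  by apply: (eq_integrable mD (fun x => (b%:E * (Im (f x))%:E)%E)) => //; exact: integrableZl.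
under eq_Rintegral do rewrite ImM /=.
rewrite RintegralD// ?RintegralZl//.
  by apply: (eq_integrable mD (fun x => (a%:E * (Im (f x))%:E)%E)) => //; exact: integrableZl.
by apply: (eq_integrable mD (fun x => (b%:E * (Re (f x))%:E)%E)) => //; exact: integrableZl.
Qed.

Lemma cintegral_conj D f : measurable D -> cintegrable mu D f ->
  cintegral mu D (fun x => (f x)^*) = (cintegral mu D f)^*.
Proof.
move=> mD [f1 f2]; rewrite /cintegral /=; congr Complex.
  by under eq_Rintegral do rewrite Re_conj.
under eq_Rintegral do rewrite Im_conj -mulN1r.
by rewrite RintegralZl// mulN1r.
Qed.

Lemma cintegral0 D : cintegral mu D (fun=> 0) = 0.
Proof. by rewrite /cintegral /= /Rintegral integral0. Qed.

(** Rotating the integral onto the positive real axis reduces the triangle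
    inequality to the one for real parts. *)
Lemma cabs_cintegral_le D f : measurable D -> cintegrable mu D f ->
  ((cabs (cintegral mu D f))%:E <= \int[mu]_(x in D) (cabs (f x))%:E)%E.
Proof.
move=> mD fi; set z := cintegral mu D f.
have [->|z0] := eqVneq z 0.
  by rewrite cabs0; apply: integral_ge0 => x _; rewrite lee_fin cabs_ge0.
have cz : 0 < cabs z.
  by rewrite lt_neqAle cabs_ge0 andbT eq_sym; apply: contra z0 => /eqP/cabs_eq0->.
pose c := (cabs z)^-1%:C * z^*.
have c1 : cabs c = 1.
  by rewrite cabsM cabs_real cabs_conj ger0_norm ?invr_ge0 ?cabs_ge0// mulVf ?gt_eqF.
have cE : cintegral mu D (fun x => c * f x) = (cabs z)%:C.
  rewrite cintegralZl// -/z /c -mulrA [_ * z]mulrC -sqr_cabsC -rmorphM/=.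
  by rewrite expr2 mulKf ?gt_eqF.
have ci := cintegrableZl c mD fi.
have -> : cabs z = \int[mu]_(x in D) Re (c * f x).
  by have /(congr1 (@complex.Re R)) := cE.
rewrite /Rintegral fineK; last by apply: integrable_fin_num => //; case: ci.
apply: le_trans (_ : \int[mu]_(x in D) `|(Re (c * f x))%:E| <= _)%E.
  apply: le_trans (lee_abs _) _; apply: le_abse_integral => //.
  by case: ci => /integrableP[].
apply: ge0_le_integral => //.
- by have [/integrableP[mc _] _] := ci; exact: (measurableT_comp _ mc).
- by apply: measurable_cabs_EFin; exact: cintegrable_cmeasurable fi.
- by move=> x _; rewrite lee_fin (le_trans (le_Re_cabs _))// cabsM c1 mul1r.
Qed.

Lemma cabs_cintegral_leR D f (C : R) : measurable D -> cintegrable mu D f ->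
  (\int[mu]_(x in D) (cabs (f x))%:E <= C%:E)%E -> cabs (cintegral mu D f) <= C.
Proof.
by move=> mD fi fC; rewrite -lee_fin (le_trans (cabs_cintegral_le mD fi)).
Qed.

(** Dominated convergence; convergence is that of the modulus of the difference,
    in the real numbers. *)
Lemma cdominated_cvg D (F : nat -> X -> R[i]) f h : measurable D ->
  (forall n, cmeasurable D (F n)) -> cmeasurable D f ->
  mu.-integrable D (EFin \o h) ->
  (forall n x, D x -> cabs (F n x) <= h x) ->
  (forall x, D x -> cabs (F n x - f x) @[n --> \oo] --> (0 : R)) ->
  cabs (cintegral mu D (F n) - cintegral mu D f) @[n --> \oo] --> (0 : R).
Proof.
move=> mD mF mf hi Fh Ff.
have fh x : D x -> cabs (f x) <= h x.
  move=> Dx; apply/ler_addgt0Pr => e e0.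
  have /cvgrPdist_lt/(_ _ e0)[n _ /(_ n (leqnn n))] := Ff _ Dx.
  rewrite sub0r normrN ger0_norm ?cabs_ge0// => /ltW Fe.
  rewrite -[f x](addrNK (F n x)) (le_trans (le_cabsD _ _))// addrC.
  by rewrite lerD ?Fh// cabs_distC.
have Fi n : cintegrable mu D (F n) by apply: (le_cintegrable mD _ hi) => // x; exact: Fh.
have fi : cintegrable mu D f by apply: (le_cintegrable mD _ hi).
have part (p : R[i] -> R) : (forall z w, p (z - w) = p z - p w) ->
    (forall z, `|p z| <= cabs z) ->
    (forall n, mu.-integrable D (fun x => (p (F n x))%:E)) ->
    mu.-integrable D (fun x => (p (f x))%:E) ->
    \int[mu]_(x in D) p (F n x) @[n --> \oo] --> \int[mu]_(x in D) p (f x).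
  move=> pB pc pF pf; apply: fine_cvg; rewrite fineK ?integrable_fin_num//.
  apply: (@dominated_cvg _ _ _ _ _ mD (fun n x => (p (F n x))%:E) (fun x => (p (f x))%:E) (EFin \o h)) => //.
  - by move=> n; case/integrableP: (pF n).
  - move=> x Dx; apply/fine_cvgP; split; first exact: nearW.
    apply/cvgrPdist_le => /= e e0.
    move/cvgrPdist_le: (Ff _ Dx) => /(_ _ e0); apply: filterS => n.
    rewrite sub0r normrN (ger0_norm (cabs_ge0 _)) -pB => /(le_trans _); apply.
    by rewrite cabs_distC pc.
  - by move=> n x Dx /=; rewrite lee_fin (le_trans (pc _))// Fh.
have cRe := part _ ReB le_Re_cabs (fun n => (Fi n).1) fi.1.
have cIm := part _ ImB le_Im_cabs (fun n => (Fi n).2) fi.2.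
apply: (@squeeze_cvgr _ _ _ _ (cst 0) (fun n =>
  `|\int[mu]_(x in D) Re (F n x) - \int[mu]_(x in D) Re (f x)| +
  `|\int[mu]_(x in D) Im (F n x) - \int[mu]_(x in D) Im (f x)|)).
- apply: nearW => n; apply/andP; split; first exact: cabs_ge0.
  by rewrite (le_trans (cabs_le_ReIm _))// ReB ImB.
- exact: cvg_cst.
- rewrite -[X in _ --> X]addr0; apply: cvgD.
    by apply/norm_cvg0P/subr_cvg0.
  by apply/norm_cvg0P/subr_cvg0.
Qed.

End ComplexIntegral.

(** * Integrals, null sets and parameters *)

Section NonMeasurableAE.
Context {R : realType} {dX : measure_display} {X : measurableType dX}.
Variable mu : {measure set X -> \bar R}.
Local Open Scope ereal_scope.

Lemma ge0_le_integral_nm (f g : X -> \bar R) : (forall x, 0 <= f x) ->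
  (forall x, f x <= g x) -> \int[mu]_x f x <= \int[mu]_x g x.
Proof.
move=> f0 fg; rewrite ge0_integralTE// ge0_integralTE; last first.
  by move=> x; exact: le_trans (f0 x) (fg x).
apply: ereal_sup_le => _ [h /= hf <-]; exists h => //= x.
exact: le_trans (hf x) (fg x).
Qed.

(** The integral of an arbitrary nonnegative function is a supremum over the
    simple functions below it, so it does not see null sets even if the function
    fails to be measurable. *)
Lemma ge0_ae_eq_integral_nm (f g : X -> \bar R) : (forall x, 0 <= f x) ->
  (forall x, 0 <= g x) -> measurable_fun setT g ->
  {ae mu, forall x, f x = g x} -> \int[mu]_x f x = \int[mu]_x g x.
Proof.
move=> f0 g0 mg [N [mN N0 subN]].
have fgN x : ~ N x -> f x = g x.
  by move=> Nx; apply: contrapT => fg; apply: Nx; exact: subN.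
pose lo x := if x \in N then 0 else g x.
pose hi x := if x \in N then +oo else g x.
have mN' : measurable_fun setT (fun x => x \in N).
  by apply: (measurable_fun_bool true); rewrite setTI preimage_mem_true.
have mlo : measurable_fun setT lo.
  apply: measurable_fun_if => //; exact: measurable_funS mg.
have mhi : measurable_fun setT hi.
  apply: measurable_fun_if => //; exact: measurable_funS mg.
have lo0 x : 0 <= lo x by rewrite /lo; case: ifP.
have hi0 x : 0 <= hi x by rewrite /hi; case: ifP.
have e1 : \int[mu]_x lo x = \int[mu]_x g x.
  apply: ge0_ae_eq_integral => //; exists N; split => // x /= h; apply: contrapT => Nx.
  by apply: h => _; rewrite /lo memNset.
have e2 : \int[mu]_x hi x = \int[mu]_x g x.
  apply: ge0_ae_eq_integral => //; exists N; split => // x /= h; apply: contrapT => Nx.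
  by apply: h => _; rewrite /hi memNset.
apply/eqP; rewrite eq_le; apply/andP; split.
  rewrite -e2; apply: ge0_le_integral_nm => // x; rewrite /hi.
  by case: ifPn => [_|/negP xN]; [exact: leey|rewrite fgN// => Nx; apply: xN; exact: mem_set].
rewrite -e1; apply: ge0_le_integral_nm => // x; rewrite /lo.
by case: ifPn => [_|/negP xN] //; rewrite fgN// => Nx; apply: xN; exact: mem_set.
Qed.

Lemma ae_eq_integral_nm (D : set X) (f g : X -> \bar R) : measurable D ->
  measurable_fun D g -> {ae mu, forall x, D x -> f x = g x} ->
  \int[mu]_(x in D) f x = \int[mu]_(x in D) g x.
Proof.
move=> mD mg fg; rewrite integral_mkcond [RHS]integral_mkcond.
have mg' : measurable_fun setT (g \_ D) by apply/(measurable_restrictT _ mD).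
have fg' : {ae mu, forall x, (f \_ D) x = (g \_ D) x}.
  apply: filterS fg => x fg; rewrite !patchE; case: ifPn => // xD.
  by apply: fg; exact: set_mem.
rewrite integralE [RHS]integralE; congr (_ - _).
  apply: ge0_ae_eq_integral_nm => //; first exact: measurable_funepos.
  by apply: filterS fg' => x; rewrite !funeposE => ->.
apply: ge0_ae_eq_integral_nm => //; first exact: measurable_funeneg.
by apply: filterS fg' => x; rewrite !funenegE => ->.
Qed.

End NonMeasurableAE.

Section IntegralTransport.
Context {R : realType} {dX : measure_display} {X : measurableType dX}.
Variable mu : {measure set X -> \bar R}.

Lemma ae_eq_cintegral_nm (D : set X) (f g : X -> R[i]) : measurable D ->
  cmeasurable D g -> {ae mu, forall x, D x -> f x = g x} ->
  cintegral mu D f = cintegral mu D g.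
Proof.
move=> mD [g1 g2] fg; congr Complex; congr fine.
  apply: ae_eq_integral_nm => //; first exact/measurable_EFinP.
  by apply: filterS fg => x h Dx; rewrite h.
apply: ae_eq_integral_nm => //; first exact/measurable_EFinP.
by apply: filterS fg => x h Dx; rewrite h.
Qed.

Lemma cintegral_mkcond (D : set X) (f : X -> R[i]) :
  cintegral mu D f = cintegral mu setT (fun x => if x \in D then f x else 0).
Proof.
by congr Complex; rewrite Rintegral_mkcond; apply: eq_Rintegral => x _;
   rewrite patchE; case: ifP.
Qed.

(** The hypothesis on nonnegative functions passes to complex ones through
    positive and negative parts; it is applied to affine maps. *)
Lemma cintegral_comp (p : X -> X) (c : R) (f : X -> R[i]) :
  measurable_fun setT p -> 0 <= c ->
  (forall h : X -> \bar R, measurable_fun setT h -> (forall x, 0 <= h x)%E ->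
    (\int[mu]_x h (p x) = c%:E * \int[mu]_x h x)%E) ->
  cintegrable mu setT f ->
  cintegrable mu setT (f \o p) /\
  cintegral mu setT (f \o p) = c%:C * cintegral mu setT f.
Proof.
move=> mp c0 hp fi; have fm := cintegrable_cmeasurable fi.
have fpi : cintegrable mu setT (f \o p).
  apply/cintegrableP => //; split; first exact: cmeasurable_comp.
  rewrite (hp (fun x => (cabs (f x))%:E))//; last 2 first.
  - exact: measurable_cabs_EFin.
  - by move=> x; rewrite lee_fin cabs_ge0.
  by rewrite lte_mul_pinfty//; have /cintegrableP[] := fi.
split => //.
have part (g : X -> R) : mu.-integrable setT (EFin \o g) ->
    \int[mu]_x g (p x) = c * \int[mu]_x g x.
  move=> gi; rewrite /Rintegral.
  have gm := measurable_int _ gi.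
  have -> : (\int[mu]_x (g (p x))%:E = \int[mu]_x (funepos (EFin \o g) (p x)) -
      \int[mu]_x (funeneg (EFin \o g) (p x)))%E.
    rewrite integralE; congr (_ - _)%E; apply: eq_integral => x _.
      by rewrite !funeposE.
    by rewrite !funenegE.
  rewrite (hp (funepos (EFin \o g)))//; last exact: measurable_funepos.
  rewrite (hp (funeneg (EFin \o g)))//; last exact: measurable_funeneg.
  rewrite [X in _ = _ * fine X]integralE.
  have p1 : (\int[mu]_x (funepos (EFin \o g) x))%E \is a fin_num.
    by rewrite ge0_fin_numE ?integral_ge0//; exact: integral_funepos_lt_pinfty.
  have n1 : (\int[mu]_x (funeneg (EFin \o g) x))%E \is a fin_num.
    by rewrite ge0_fin_numE ?integral_ge0//; exact: integral_funeneg_lt_pinfty.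
  by rewrite -muleBr ?fin_num_adde_defr// fineM// fin_numB p1.
rewrite /cintegral; case: fi => f1 f2; simpc; congr Complex.
  exact: (part (fun x => complex.Re (f x))).
exact: (part (fun x => complex.Im (f x))).
Qed.

End IntegralTransport.

(** The integral is a difference of two Tonelli integrals, and [fine] sends its
    infinite values to 0. *)
Lemma measurable_Rintegral_param {R : realType} {d1 d2 : measure_display}
    {X : measurableType d1} {Y : measurableType d2}
    (m : {sigma_finite_measure set Y -> \bar R}) (g : X * Y -> R) :
  measurable_fun setT g -> measurable_fun setT (fun x => \int[m]_y g (x, y)).
Proof.
move=> mg; rewrite /Rintegral.
apply: (measurableT_comp (fine_measurable measurableT)).
have mgE : measurable_fun setT (EFin \o g) by exact/measurable_EFinP.
have -> : (fun x => \int[m]_y (g (x, y))%:E)%E =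
    (fun x => fubini_F m (funepos (EFin \o g)) x - fubini_F m (funeneg (EFin \o g)) x)%E.
  apply/funext => x; rewrite integralE; congr (_ - _)%E; apply: eq_integral => y _.
    by rewrite !funeposE.
  by rewrite !funenegE.
apply: emeasurable_funB; apply: measurable_fun_fubini_tonelli_F => //.
  exact: measurable_funepos.
exact: measurable_funeneg.
Qed.

Section ComplexFubini.
Context {R : realType} {d1 d2 : measure_display}.
Context {X : measurableType d1} {Y : measurableType d2}.
Variable m1 : {sigma_finite_measure set X -> \bar R}.
Variable m2 : {sigma_finite_measure set Y -> \bar R}.
Local Notation Re := complex.Re.
Local Notation Im := complex.Im.

Lemma cmeasurable_cintegral (f : X * Y -> R[i]) : cmeasurable setT f ->
  cmeasurable setT (fun x => cintegral m2 setT (fun y => f (x, y))).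
Proof.
move=> [f1 f2]; split => /=; first exact: (measurable_Rintegral_param m2 f1).
exact: (measurable_Rintegral_param m2 f2).
Qed.

Lemma measurable_L1_param (f : X * Y -> R[i]) : cmeasurable setT f ->
  measurable_fun setT (fun x => \int[m2]_y (cabs (f (x, y)))%:E)%E.
Proof.
move=> mf; apply: (measurable_fun_fubini_tonelli_F (m2 := m2) (fun z => (cabs (f z))%:E)).
  exact: measurable_cabs_EFin.
by move=> z; rewrite lee_fin cabs_ge0.
Qed.

Lemma Rfubini (g : X * Y -> R) : (m1 \x m2)%E.-integrable setT (EFin \o g) ->
  \int[m1]_x \int[m2]_y g (x, y) = \int[m2]_y \int[m1]_x g (x, y).
Proof.
move=> gi; have mg : measurable_fun setT g by apply/measurable_EFinP; exact: measurable_int gi.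
rewrite /Rintegral; congr fine.
transitivity (\int[m1]_x fubini_F m2 (EFin \o g) x)%E.
  apply: ae_eq_integral => //.
  - by apply/measurable_EFinP; exact: (measurable_Rintegral_param m2 mg).
  - exact: (measurable_fubini_F gi).
  - have := integrable_ae measurableT (integrable_fubini_F gi).
    by apply: filterS => x /(_ I) h _ /=; rewrite fineK.
rewrite integral12_prod_meas1// -integral21_prod_meas1//.
apply/esym; apply: ae_eq_integral => //.
- apply/measurable_EFinP.
  have mg' : measurable_fun setT (fun z : Y * X => g (z.2, z.1)).
    by apply: (measurableT_comp mg); exact: measurable_fun_pair.
  exact: (measurable_Rintegral_param m1 mg').
- exact: (measurable_fubini_G gi).
- have := ae_integrable2 gi.
  by apply: filterS => y h _ /=; rewrite fineK//; exact: integrable_fin_num.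
Qed.

Lemma cFubini (f : X * Y -> R[i]) : cmeasurable setT f ->
  (\int[m1]_x \int[m2]_y (cabs (f (x, y)))%:E < +oo)%E ->
  cintegral m1 setT (fun x => cintegral m2 setT (fun y => f (x, y))) =
  cintegral m2 setT (fun y => cintegral m1 setT (fun x => f (x, y))).
Proof.
move=> mf fi.
have ci : (m1 \x m2)%E.-integrable setT (fun z => (cabs (f z))%:E).
  apply/integrable12ltyP; first exact: measurable_cabs_EFin.
  by under eq_integral do under eq_integral do rewrite gee0_abs ?lee_fin ?cabs_ge0//.
have [f1 f2] : cintegrable (m1 \x m2)%E setT f by exact: le_cintegrable ci _.
congr Complex; first exact: (Rfubini f1).
exact: (Rfubini f2).
Qed.

(** Minkowski's inequality for integrals, in L^1. *)
Lemma L1norm_cintegral_le (f : X * Y -> R[i]) : cmeasurable setT f ->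
  (forall y, cintegrable m1 setT (fun x => f (x, y))) ->
  (\int[m2]_y (cabs (cintegral m1 setT (fun x => f (x, y))))%:E <=
   \int[m1]_x \int[m2]_y (cabs (f (x, y)))%:E)%E.
Proof.
move=> mf fi; have mc := measurable_cabs_EFin mf.
rewrite (_ : \int[m1]_x _ = \int[m2]_y \int[m1]_x (cabs (f (x, y)))%:E)%E; last first.
  by apply: (fubini_tonelli (fun z => (cabs (f z))%:E)) => // z; rewrite lee_fin cabs_ge0.
apply: ge0_le_integral_nm => y; first by rewrite lee_fin cabs_ge0.
exact: cabs_cintegral_le.
Qed.

End ComplexFubini.

(** * Borel sets and the dot product of the Euclidean space *)

Section MeasurableRV.
Context {R : realType} {d : nat}.
Local Notation Rd := 'rV[R]_d.

Lemma nbhs_rVP (x : Rd) (A : set Rd) : nbhs x A ->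
  exists2 e : R, 0 < e & forall y : Rd, (forall i, `|x ord0 i - y ord0 i| < e) -> A y.
Proof.
move=> /nbhs_ballP[e /= e0 h]; exists e => // y xy; apply: h.
by split => // i j; rewrite (ord1 i); exact: xy.
Qed.

(** The sigma-algebra is generated by the coordinates; an open set is the union
    of the countably many boxes with rational corners that it contains. *)
Lemma open_measurable_rV (A : set Rd) : open A -> measurable A.
Proof.
move=> oA.
pose box (u : {ffun 'I_d -> rat * rat}) : set Rd :=
  [set x | forall i, x ord0 i \in `]ratr (u i).1, ratr (u i).2[ ].
have mbox u : measurable (box u).
  have -> : box u = \bigcap_(i in [set: 'I_d])
      ((fun x : Rd => x ord0 i) @^-1` [set` `]ratr (u i).1, ratr (u i).2[ ]).
    by apply/seteqP; split => x /= h i; [move=> _; exact: h|exact: h].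
  apply: fin_bigcap_measurable => // i _.
  by rewrite -[X in measurable X]setTI; apply: measurable_coord_rV => //; exact: measurable_itv.
pose F u := if asbool (box u `<=` A) then box u else set0.
have -> : A = \bigcup_u F u.
  apply/seteqP; split => [x Ax|x [u _]]; last first.
    by rewrite /F; case: asboolP => // uA /uA.
  have /nbhs_rVP[e e0 he] := open_nbhs_nbhs (conj oA Ax).
  have lo i : exists q : rat, ratr q \in `]x ord0 i - e, x ord0 i[.
    by apply: rat_in_itvoo; rewrite ltrBlDr ltrDl.
  have hi i : exists q : rat, ratr q \in `]x ord0 i, x ord0 i + e[.
    by apply: rat_in_itvoo; rewrite ltrDl.
  have [l hl] := choice lo; have [h hh] := choice hi.
  exists [ffun i => (l i, h i)] => //; rewrite /F asboolT.
    move=> i; rewrite ffunE /= in_itv /=.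
    by have := hl i; have := hh i; rewrite !in_itv /= => /andP[-> _] /andP[_ ->].
  move=> y hy; apply: he => i; have := hy i; rewrite ffunE /= in_itv /= => /andP[y1 y2].
  have := hl i; have := hh i; rewrite !in_itv /= => /andP[h1 h2] /andP[l1 l2].
  by rewrite ltr_norml; apply/andP; split; lra.
apply: countable_bigcupT_measurable; first exact: countableP.
by move=> u; rewrite /F; case: asboolP.
Qed.

Lemma continuous_measurable_rV (f : Rd -> R) : continuous f -> measurable_fun setT f.
Proof.
move=> /continuousP cf; apply: (measurability _ (RGenOpens.measurableE R)).
move=> _ [_ [a [b ->] <-]]; rewrite setTI; apply: open_measurable_rV.
by apply: cf; exact: interval_open.
Qed.

Lemma measurable_add_rV {dX : measure_display} {X : measurableType dX} (f g : X -> Rd) :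
  measurable_fun setT f -> measurable_fun setT g ->
  measurable_fun setT (fun x => f x + g x).
Proof.
move=> mf mg; apply: measurable_fun_rVP => i; under eq_fun do rewrite mxE.
by apply: measurable_funD; exact: (measurableT_comp (measurable_coord_rV i)).
Qed.

Lemma measurable_scale_rV {dX : measure_display} {X : measurableType dX}
    (c : X -> R) (f : X -> Rd) :
  measurable_fun setT c -> measurable_fun setT f ->
  measurable_fun setT (fun x => c x *: f x).
Proof.
move=> mc mf; apply: measurable_fun_rVP => i; under eq_fun do rewrite mxE.
by apply: measurable_funM => //; exact: (measurableT_comp (measurable_coord_rV i)).
Qed.

Lemma measurable_opp_rV {dX : measure_display} {X : measurableType dX} (f : X -> Rd) :
  measurable_fun setT f -> measurable_fun setT (fun x => - f x).
Proof.
move=> mf; under eq_fun do rewrite -scaleN1r.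
by apply: measurable_scale_rV.
Qed.

Lemma measurable_sub_rV {dX : measure_display} {X : measurableType dX} (f g : X -> Rd) :
  measurable_fun setT f -> measurable_fun setT g ->
  measurable_fun setT (fun x => f x - g x).
Proof. by move=> mf mg; apply: measurable_add_rV => //; exact: measurable_opp_rV. Qed.

Lemma measurable_dotrV {dX : measure_display} {X : measurableType dX} (f g : X -> Rd) :
  measurable_fun setT f -> measurable_fun setT g ->
  measurable_fun setT (fun x => dotrV (f x) (g x)).
Proof.
move=> mf mg; apply: measurable_sum => i.
by apply: measurable_funM; exact: (measurableT_comp (measurable_coord_rV i)).
Qed.

Lemma measurable_enorm {dX : measure_display} {X : measurableType dX} (f : X -> Rd) :
  measurable_fun setT f -> measurable_fun setT (fun x => enorm (f x)).
Proof.
move=> mf; apply: (measurableT_comp (f := @Num.sqrt R)).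
  by apply: continuous_measurable_fun; exact: sqrt_continuous.
exact: measurable_dotrV.
Qed.

End MeasurableRV.

Section DotProduct.
Context {R : realType} {d : nat}.
Implicit Types x y z : 'rV[R]_d.

Lemma dotrVC x y : dotrV x y = dotrV y x.
Proof. by apply: eq_bigr => i _; rewrite mulrC. Qed.

Lemma dotrVDl x y z : dotrV (x + y) z = dotrV x z + dotrV y z.
Proof. by rewrite /dotrV -big_split /=; apply: eq_bigr => i _; rewrite mxE mulrDl. Qed.

Lemma dotrVDr x y z : dotrV x (y + z) = dotrV x y + dotrV x z.
Proof. by rewrite dotrVC dotrVDl !(dotrVC _ x). Qed.

Lemma dotrVZl (c : R) x y : dotrV (c *: x) y = c * dotrV x y.
Proof. by rewrite /dotrV big_distrr /=; apply: eq_bigr => i _; rewrite mxE mulrA. Qed.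

Lemma dotrVZr (c : R) x y : dotrV x (c *: y) = c * dotrV x y.
Proof. by rewrite dotrVC dotrVZl dotrVC. Qed.

Lemma dotrVNl x y : dotrV (- x) y = - dotrV x y.
Proof. by rewrite -scaleN1r dotrVZl mulN1r. Qed.

Lemma dotrVNr x y : dotrV x (- y) = - dotrV x y.
Proof. by rewrite dotrVC dotrVNl dotrVC. Qed.

Lemma dotrVv_ge0 x : 0 <= dotrV x x.
Proof. by apply: sumr_ge0 => i _; rewrite -expr2 sqr_ge0. Qed.

Lemma sqr_enorm x : enorm x ^+ 2 = dotrV x x.
Proof. by rewrite sqr_sqrtr ?dotrVv_ge0. Qed.

Lemma enorm_ge0 x : 0 <= enorm x.
Proof. exact: sqrtr_ge0. Qed.

Lemma dotrV_delta x i : dotrV x (delta_mx ord0 i) = x ord0 i.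
Proof.
rewrite /dotrV (bigD1 i)//= mxE !eqxx mulr1 big1 ?addr0// => j ji.
by rewrite mxE eqxx (negbTE ji) mulr0.
Qed.

Lemma sqr_coord_le x i : x ord0 i ^+ 2 <= dotrV x x.
Proof.
rewrite /dotrV (bigD1 i)//= -expr2 lerDl; apply: sumr_ge0 => j _.
by rewrite -expr2 sqr_ge0.
Qed.

End DotProduct.

(** * Lebesgue measure: Tonelli and affine changes of variables *)

Section LebesgueRV.
Context {R : realType}.
Local Notation leb d := (@lebesgue_rV R d).

(** Tonelli, peeling off the first coordinate. *)
Lemma ge0_integral_rVS n (f : 'rV[R]_n.+1 -> \bar R) : measurable_fun setT f ->
  (forall x, 0 <= f x)%E ->
  (\int[leb n.+1]_x f x =
   \int[@lebesgue_measure R]_a \int[leb n]_v f (rV_cons (a, v)))%E.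
Proof.
move=> mf f0.
transitivity (\int[(@lebesgue_measure R \x leb n)%E]_z f (rV_cons z))%E.
  have mc : measurable_fun [set: measurableTypeR R * 'rV[R]_n] (@rV_cons R n).
    exact: measurable_rV_cons.
  pose m : {measure set (measurableTypeR R * 'rV[R]_n) -> \bar R} :=
    (@lebesgue_measure R \x leb n)%E.
  have := ge0_integral_pushforward mc m measurableT mf (fun x _ => f0 x).
  rewrite preimage_setT /comp => <-.
  by rewrite /= /lebesgue_rVS.
apply: (@fubini_tonelli1 _ _ (measurableTypeR R) _ R (@lebesgue_measure R) (leb n) (fun z => f (rV_cons z))) => //.
by apply: measurableT_comp => //; exact: measurable_rV_cons.
Qed.

Lemma integral_rV0 (f : 'rV[R]_0 -> \bar R) : measurable_fun setT f ->
  (\int[leb 0]_x f x = f (0 : 'rV[R]_0)%R)%E.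
Proof. by move=> mf; rewrite /= integral_dirac// diracT mul1e. Qed.

(** Lebesgue measure is determined by its values on half-open intervals, and
    those scale by the modulus of [c]. *)
Lemma ge0_integral_affine1 (c a : R) (f : R -> \bar R) : c != 0 ->
  measurable_fun setT f -> (forall x, 0 <= f x)%E ->
  (\int[@lebesgue_measure R]_x f (c * x + a)%R =
   (`|c|^-1)%:E * \int[@lebesgue_measure R]_x f x)%E.
Proof.
move=> c0 mf f0.
have mp : measurable_fun setT (fun x : R => c * x + a).
  by apply: measurable_funD => //; exact: measurable_funM.
have nc0 : 0 < `|c| by rewrite normr_gt0.
have cge : (0 <= `|c|^-1) by rewrite invr_ge0.
pose P := (pushforward (@lebesgue_measure R) (fun x => (c * x + a) : measurableTypeR R)
  : {measure set (measurableTypeR R) -> \bar R}).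
pose mu1 : {measure set (measurableTypeR R) -> \bar R} :=
  mscale (NngNum (normr_ge0 c)) (P mp).
have E (A : set (measurableTypeR R)) : measurable A -> lebesgue_measure A = mu1 A.
  apply: lebesgue_measure_unique => _ [[u v]] /= _ <-.
  rewrite /mu1 /mscale /= /pushforward.
  have [cp|cn] := ltP 0 c.
    have -> : (fun x : R => c * x + a) @^-1` `]u, v] = `](u - a) / c, (v - a) / c]%classic.
      apply/seteqP; split => x /=; rewrite !in_itv /= ltr_pdivrMr// ler_pdivlMr//;
        by rewrite [x * c]mulrC ltrBlDr lerBrDr.
    rewrite !lebesgue_measure_itv /= !lte_fin ltr_pM2r ?invr_gt0// ltrD2r.
    case: ifP => uv; last by rewrite mule0.
    by rewrite -!EFinB -EFinM gtr0_norm//; congr EFin; field; rewrite gt_eqF.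
  have {}cn : c < 0 by rewrite lt_neqAle c0.
  have -> : (fun x : R => c * x + a) @^-1` `]u, v] = `[(v - a) / c, (u - a) / c[%classic.
    apply/seteqP; split => x /=; rewrite !in_itv /= ltr_ndivlMr// ler_ndivrMr//;
      by rewrite [x * c]mulrC ltrBlDr lerBrDr andbC.
  rewrite !lebesgue_measure_itv /= !lte_fin ltr_nM2r ?invr_lt0// ltrD2r.
  case: ifP => uv; last by rewrite mule0.
  by rewrite -!EFinB -EFinM ltr0_norm//; congr EFin; field; rewrite lt_eqF.
have -> : (\int[@lebesgue_measure R]_x f x = \int[mu1]_x f x)%E.
  by apply: eq_measure_integral => A mA _; exact: E.
rewrite ge0_integral_mscale// muleA -EFinM mulVf ?gt_eqF// mul1e.
by rewrite ge0_integral_pushforward.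
Qed.

(** Induction on the dimension, one coordinate at a time. *)
Lemma ge0_integral_affine n (c : R) (h : 'rV[R]_n) (f : 'rV[R]_n -> \bar R) : c != 0 ->
  measurable_fun setT f -> (forall x, 0 <= f x)%E ->
  (\int[leb n]_x f (c *: x + h)%R = ((`|c|^-1) ^+ n)%:E * \int[leb n]_x f x)%E.
Proof.
move=> c0; elim: n h f => [|n IH] h f mf f0.
  rewrite !integral_rV0//; last first.
    by apply: measurableT_comp => //; apply: measurable_add_rV => //; exact: measurable_scale_rV.
  by rewrite expr0 mul1e; congr f; apply/rowP => -[].
have maff : measurable_fun setT (fun x : 'rV[R]_n.+1 => f (c *: x + h)).
  by apply: measurableT_comp => //; apply: measurable_add_rV => //; exact: measurable_scale_rV.
rewrite !ge0_integral_rVS//.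
pose a := h ord0 ord0; pose k : 'rV[R]_n := \row_j h ord0 (lift ord0 j).
have E x v : c *: rV_cons (x, v) + h = rV_cons (c * x + a, c *: v + k).
  apply/rowP => i; rewrite mxE [X in X + _]mxE !rV_consE /=.
  by case: unliftP => [j ->|->] /=; rewrite ?mxE.
have mfc x : measurable_fun setT (fun v : 'rV[R]_n => f (rV_cons (x, v))).
  apply: measurableT_comp => //.
  by apply: (measurableT_comp (measurable_rV_cons (n := n))); exact: pair1_measurable.
pose G (x : R) := (\int[leb n]_v f (rV_cons (x, v)))%E.
have mG : measurable_fun setT G.
  apply: (measurable_fun_fubini_tonelli_F (m2 := leb n) (fun z => f (rV_cons z))) => //.
  by apply: measurableT_comp => //; exact: measurable_rV_cons.
have G0 x : (0 <= G x)%E by exact: integral_ge0.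
have cn0 : 0 <= (`|c|^-1) ^+ n by rewrite exprn_ge0// invr_ge0.
transitivity (\int[@lebesgue_measure R]_x (((`|c|^-1) ^+ n)%:E * G (c * x + a)%R))%E.
  apply: eq_integral => x _; rewrite /G -(IH k (fun v => f (rV_cons (c * x + a, v))))//.
  by apply: eq_integral => v _; rewrite E.
transitivity (((`|c|^-1) ^+ n)%:E * \int[@lebesgue_measure R]_x (G (c * x + a)%R))%E.
  apply: ge0_integralZl_EFin => //.
  apply: (measurableT_comp mG).
  by apply: measurable_funD => //; exact: measurable_funM.
rewrite (ge0_integral_affine1 a c0 mG G0).
by rewrite muleA -EFinM exprSr.
Qed.

(** Used for the weight and for the Gaussian, which are products over the
    coordinates. *)
Lemma ge0_integral_prod n (f : 'I_n -> R -> R) :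
  (forall i, measurable_fun setT (f i)) -> (forall i x, 0 <= f i x) ->
  (\int[leb n]_x (\prod_(i < n) f i (x ord0 i))%:E =
   \prod_(i < n) \int[@lebesgue_measure R]_x (f i x)%:E)%E.
Proof.
elim: n f => [|n IH] f mf f0.
  by under eq_integral do rewrite big_ord0; rewrite integral_rV0// big_ord0.
have mF m (g : 'I_m -> R -> R) : (forall i, measurable_fun setT (g i)) ->
    measurable_fun setT (fun x : 'rV[R]_m => (\prod_(i < m) g i (x ord0 i))%:E).
  move=> mg; apply/measurable_EFinP; apply: measurable_prod => i _.
  exact: (measurableT_comp (mg i) (measurable_coord_rV i)).
have F0 m (g : 'I_m -> R -> R) (x : 'rV[R]_m): (forall i x, 0 <= g i x) ->
    (0 <= (\prod_(i < m) g i (x ord0 i))%:E)%E.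
  by move=> g0; rewrite lee_fin; apply: prodr_ge0 => i _.
rewrite ge0_integral_rVS//; [|exact: mF|by move=> x; exact: F0].
rewrite big_ord_recl -(IH (fun i => f (lift ord0 i)))//.
set I := (\int[_]_x (\prod_(i < n) _)%:E)%E.
transitivity (\int[@lebesgue_measure R]_a ((f ord0 a)%:E * I))%E; last first.
  rewrite ge0_integralZr//.
  - by apply/measurable_EFinP; exact: mf.
  - by move=> x _; rewrite lee_fin.
  - by apply: integral_ge0 => x _; exact: (F0 _ (fun i => f (lift ord0 i))).
apply: eq_integral => a _; rewrite -ge0_integralZl//.
- apply: eq_integral => v _; rewrite big_ord_recl -EFinM rV_consE unlift_none /=.
  by congr ((_ * _)%:E); apply: eq_bigr => i _; rewrite rV_consE liftK.
- exact: (mF _ (fun i => f (lift ord0 i))).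
- by move=> x _; exact: (F0 _ (fun i => f (lift ord0 i))).
- by rewrite lee_fin.
Qed.

End LebesgueRV.

Section ChangeOfVariables.
Context {R : realType} {d : nat}.
Local Notation Rd := 'rV[R]_d.
Local Notation leb := (@lebesgue_rV R d).

Lemma measurable_affine (c : R) (h : Rd) : measurable_fun setT (fun x : Rd => c *: x + h).
Proof. by apply: measurable_add_rV => //; exact: measurable_scale_rV. Qed.

Lemma cintegral_affine (c : R) (h : Rd) (f : Rd -> R[i]) : c != 0 ->
  cintegrable leb setT f ->
  cintegrable leb setT (fun x => f (c *: x + h)) /\
  cintegral leb setT (fun x => f (c *: x + h)) =
    ((`|c|^-1) ^+ d)%:C * cintegral leb setT f.
Proof.
move=> c0 fi.
apply: (cintegral_comp (p := fun x : Rd => c *: x + h) (c := (`|c|^-1) ^+ d)) => //.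
- exact: measurable_affine.
- by move=> k mk k0; exact: ge0_integral_affine.
Qed.

Lemma L1norm_affine (c : R) (h : Rd) (f : Rd -> R[i]) : c != 0 ->
  cmeasurable setT f ->
  (L1norm leb (fun x => f (c *: x + h)%R) = ((`|c|^-1) ^+ d)%:E * L1norm leb f)%E.
Proof.
move=> c0 mf; apply: (ge0_integral_affine h (f := fun x => (cabs (f x))%:E)) => //.
  exact: measurable_cabs_EFin.
by move=> x; rewrite lee_fin cabs_ge0.
Qed.

Lemma cintegral_translate (h : Rd) (f : Rd -> R[i]) : cintegrable leb setT f ->
  cintegrable leb setT (fun x => f (x + h)) /\
  cintegral leb setT (fun x => f (x + h)) = cintegral leb setT f.
Proof.
move=> fi; have := cintegral_affine h (oner_neq0 R) fi.
have -> : (fun x => f (1 *: x + h)) = (fun x => f (x + h)).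
  by apply/funext => x; rewrite scale1r.
by rewrite normr1 invr1 expr1n mul1r.
Qed.

End ChangeOfVariables.

(** * An integrable weight dominating rapid decay *)

Section Weight.
Context {R : realType} {d : nat}.
Local Notation Rd := 'rV[R]_d.
Local Notation leb := (@lebesgue_rV R d).

(** Unlike a power of [1 + dotrV x x], this is a product of one-variable
    functions, so that its integral is a product of integrals. *)
Definition weight (x : Rd) : R := \prod_(i < d) (1 + x ord0 i ^+ 2)^-1.

Lemma weight_gt0 x : 0 < weight x.
Proof.
by apply: prodr_gt0 => i _; rewrite invr_gt0 ltr_pwDl// sqr_ge0.
Qed.

Lemma weight_ge0 x : 0 <= weight x.
Proof. exact/ltW/weight_gt0. Qed.

Lemma integral_inv1Dsqr : (\int[@lebesgue_measure R]_x ((1 + x ^+ 2)^-1)%:E < +oo)%E.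
Proof.
have c : continuous (fun x : R => (1 + x ^+ 2)^-1) by exact: continuous_oneDsqrV.
rewrite ge0_symfun_integralT//.
- rewrite (_ : [set x | _] = `[0, +oo[%classic); last first.
    by apply/seteqP; split => x/=; rewrite in_itv/= andbT.
  have := @integral0y_oneDsqr R; rewrite /oneDsqr => ->.
  by rewrite -EFinM ltry.
- by move=> x; rewrite invr_ge0 addr_ge0// sqr_ge0.
- by move=> x /=; rewrite sqrrN.
Qed.

Lemma measurable_weight : measurable_fun setT weight.
Proof.
apply: measurable_prod => i _.
apply: (measurableT_comp (f := fun x : R => (1 + x ^+ 2)^-1) _ (measurable_coord_rV i)).
by apply: continuous_measurable_fun; exact: continuous_oneDsqrV.
Qed.

Lemma integrable_weight : leb.-integrable setT (EFin \o weight).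
Proof.
apply/integrableP; split; first by apply/measurable_EFinP; exact: measurable_weight.
under eq_integral do rewrite /= ger0_norm ?weight_ge0//.
rewrite (ge0_integral_prod (f := fun _ x => (1 + x ^+ 2)^-1)).
- suff /andP[] : (0 <= \prod_(i < d) \int[@lebesgue_measure R]_x ((1 + x ^+ 2)^-1)%:E < +oo)%E by [].
  apply: (big_ind (fun x : \bar R => 0 <= x < +oo)%E) => [|x y /andP[x0 xy] /andP[y0 yy]|i _].
  + by rewrite lee01 ltry.
  + by rewrite mule_ge0// lte_mul_pinfty// ge0_fin_numE.
  + rewrite integral_inv1Dsqr andbT; apply: integral_ge0 => x _.
    by rewrite lee_fin invr_ge0 addr_ge0// sqr_ge0.
- by move=> _; apply: continuous_measurable_fun; exact: continuous_oneDsqrV.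
- by move=> _ x; rewrite invr_ge0 addr_ge0// sqr_ge0.
Qed.

(** Controls difference quotients by the weight at the base point. *)
Lemma weight_shift (x : Rd) i (t : R) : `|t| <= 1 ->
  weight (x + t *: delta_mx ord0 i) <= 4 * weight x.
Proof.
move=> t1; rewrite /weight (bigD1 i)//= [in leRHS](bigD1 i)//= mulrA.
have -> : \prod_(j < d | j != i) (1 + (x + t *: delta_mx ord0 i) ord0 j ^+ 2)^-1
    = \prod_(j < d | j != i) (1 + x ord0 j ^+ 2)^-1.
  by apply: eq_bigr => j ji; rewrite !mxE eqxx (negbTE ji) mulr0 addr0.
apply: ler_wpM2r.
  by apply: prodr_ge0 => j _; rewrite invr_ge0 addr_ge0// sqr_ge0.
rewrite !mxE !eqxx mulr1; set a := x ord0 i.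
have h1 : 0 < 1 + (a + t) ^+ 2 by rewrite ltr_pwDl// sqr_ge0.
have h2 : 0 < 1 + a ^+ 2 by rewrite ltr_pwDl// sqr_ge0.
rewrite -[leLHS]mul1r ler_pdivrMr// mulrAC ler_pdivlMr// mul1r.
have t2 : t ^+ 2 <= 1 by rewrite -[t ^+ 2]ger0_norm ?sqr_ge0// normrX expr_le1.
(* Completing the square in [a]. *)
have := sqr_ge0 (3 * a + 4 * t); rewrite !expr2 in t2 *; lra.
Qed.

Lemma weight_inv_le (x : Rd) : 1 <= (1 + dotrV x x) ^+ d * weight x.
Proof.
have -> : (1 + dotrV x x) ^+ d = \prod_(i < d) (1 + dotrV x x).
  by rewrite prodr_const card_ord.
rewrite /weight -big_split /=.
apply: (big_ind (fun z : R => 1 <= z)) => // [u v u1 v1|i _].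
  by rewrite -[1]mulr1 ler_pM.
rewrite ler_pdivlMr ?mul1r; last by rewrite ltr_pwDl// sqr_ge0.
by rewrite lerD2l sqr_coord_le.
Qed.

Definition rapid_decay (f : Rd -> R) := forall k, exists C, forall x, enorm x ^+ k * f x <= C.

(** Rapid decay beats any power of [1 + |x|^2] times the reciprocal of the
    integrable weight. *)
Lemma rapid_decay_weight (f : Rd -> R) m : (forall x, 0 <= f x) -> rapid_decay f ->
  exists2 C, 0 <= C & forall x, (1 + dotrV x x) ^+ m * f x <= C * weight x.
Proof.
move=> f0 fd; have [C0 h0] := fd 0; have [C1 h1] := fd (2 * (m + d))%N.
exists (2 ^+ (m + d) * (`|C0| + `|C1|)); first by rewrite mulr_ge0// ?exprn_ge0// addr_ge0.
move=> x; have xx := dotrVv_ge0 x; have w0 := weight_gt0 x.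
have key : (1 + dotrV x x) ^+ (m + d) * f x <= 2 ^+ (m + d) * (`|C0| + `|C1|).
  have b : (1 + dotrV x x) ^+ (m + d) <= 2 ^+ (m + d) * (1 + dotrV x x ^+ (m + d)).
    have [le1|ge1] := leP (dotrV x x) 1.
      rewrite -[leLHS]mulr1 ler_pM ?exprn_ge0 ?addr_ge0//.
        by apply: lerXn2r; rewrite ?nnegrE; lra.
      by rewrite lerDl exprn_ge0.
    apply: (@le_trans _ _ ((2 * dotrV x x) ^+ (m + d))).
      by apply: lerXn2r; rewrite ?nnegrE; lra.
    by rewrite exprMn ler_wpM2l ?exprn_ge0// lerDr.
  apply: le_trans (ler_wpM2r (f0 x) b) _; rewrite -mulrA ler_wpM2l ?exprn_ge0//.
  rewrite mulrDl mul1r lerD//.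
    by rewrite (le_trans _ (ler_norm C0))//; have := h0 x; rewrite expr0 mul1r.
  by rewrite (le_trans _ (ler_norm C1))//; have := h1 x; rewrite exprM sqr_enorm.
have wi := weight_inv_le x.
apply: le_trans (_ : (1 + dotrV x x) ^+ m * f x * ((1 + dotrV x x) ^+ d * weight x) <= _).
  by rewrite ler_peMr// mulr_ge0// exprn_ge0// addr_ge0.
have -> : (1 + dotrV x x) ^+ m * f x * ((1 + dotrV x x) ^+ d * weight x) =
    (1 + dotrV x x) ^+ (m + d) * f x * weight x by rewrite exprD; ring.
by rewrite ler_wpM2r// weight_ge0.
Qed.

End Weight.

(** * Schwartz functions *)

Section MeanValue.
Context {R : realType}.

Lemma mvt_bound (f f' : R -> R) (x B : R) :
  (forall t : R, is_derive t (1 : R) f (f' t)) ->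
  (forall t, `|t| <= `|x| -> `|f' t| <= B) -> `|f x - f 0| <= B * `|x|.
Proof.
move=> df f'B.
have cf (u v : R) : {within `[u, v], continuous f}.
  apply: derivable_within_continuous => t _; have [h _] := df t; exact: h.
have [x0|x0|<-] := ltgtP 0 x; last by rewrite subrr !normr0 mulr0.
  have [c] := MVT x0 (fun t _ => df t) (cf 0 x); rewrite in_itv /= => /andP[c0 cx] ->.
  rewrite subr0 normrM ler_wpM2r// f'B// !ger0_norm// ?ltW//.
have [c] := MVT x0 (fun t _ => df t) (cf x 0); rewrite in_itv /= => /andP[cx c0] e.
rewrite distrC e sub0r normrM normrN ler_wpM2r// f'B// !ler0_norm ?lerN2// ?ltW//.
Qed.

(** The chord is at most as long as the arc; the factor 2 comes from treating the
    two coordinates separately. *)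
Lemma cabs_cisB1 (a : R) : cabs (cis a - 1) <= 2 * `|a|.
Proof.
apply: le_trans (cabs_le_ReIm _) _; rewrite ReB ImB /=.
have hs : `|sin a| <= `|a|.
  have := @mvt_bound sin cos a 1; rewrite sin0 subr0 mul1r; apply => t _.
  by rewrite ler_norml cos_geN1 cos_le1.
have hc : `|cos a - 1| <= `|a|.
  have := @mvt_bound cos (fun y => - sin y) a 1; rewrite cos0 mul1r; apply => t _.
  by rewrite normrN ler_norml sin_geN1 sin_le1.
rewrite subr0; lra.
Qed.

(** Beyond [`|a| = 1] the triangle inequality is already good enough. *)
Lemma cabs_cis_taylor (a : R) : cabs (cis a - 1 - 'i * a%:C) <= 3 * `|a| ^+ 2.
Proof.
have [a1|a1] := leP `|a| 1; last first.
  rewrite (le_trans (le_cabsB _ _))// cabsM cabs_i mul1r cabs_real.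
  have := cabs_cisB1 a; rewrite expr2; nra.
have hs (t : R) : `|sin t| <= `|t|.
  have := @mvt_bound sin cos t 1; rewrite sin0 subr0 mul1r; apply => y _.
  by rewrite ler_norml cos_geN1 cos_le1.
have hc (t : R) : `|cos t - 1| <= `|t| ^+ 2.
  have := @mvt_bound cos (fun y => - sin y) t `|t|; rewrite cos0 expr2; apply => y yt.
  by rewrite normrN (le_trans (hs y)).
have hs2 : `|sin a - a| <= `|a| ^+ 2.
  apply: (@le_trans _ _ (`|a| ^+ 2 * `|a|)); last first.
    by rewrite -[leRHS]mulr1 ler_wpM2l// sqr_ge0.
  have := @mvt_bound (fun t => sin t - t) (fun y => cos y - 1) a (`|a| ^+ 2).
  rewrite sin0 !subr0; apply => y ya.
  by rewrite (le_trans (hc y))// lerXn2r ?nnegrE.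
apply: le_trans (cabs_le_ReIm _) _.
have := hc a; have := sqr_ge0 `|a|; rewrite !ReB !ImB ReM ImM /= !mul0r !mulr0 !mul1r ?subr0 ?addr0 ?add0r => ? ?; lra.
Qed.

End MeanValue.

Section Schwartz.
Context {R : realType} {d : nat}.
Local Notation Rd := 'rV[R]_d.
Local Notation leb := (@lebesgue_rV R d).
Implicit Types (f : Rd -> R) (g : Rd -> R[i]).

Lemma schwartz_partial f i : schwartz f -> schwartz (partial i f).
Proof.
move=> fS s; have := fS (rcons s i).
by rewrite /partials -cats1 foldr_cat.
Qed.

Lemma schwartz_differentiable f x : schwartz f -> differentiable f x.
Proof. by move=> /(_ [::])[+ _]; exact. Qed.

Lemma schwartz_continuous f : schwartz f -> continuous f.
Proof. by move=> fS x; apply: differentiable_continuous; exact: schwartz_differentiable. Qed.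

Lemma schwartz_measurable f : schwartz f -> measurable_fun setT f.
Proof. by move=> fS; apply: continuous_measurable_rV; exact: schwartz_continuous. Qed.

Lemma schwartz_weight f : schwartz f ->
  exists2 C, 0 <= C & forall x, `|f x| <= C * weight x.
Proof.
move=> fS; have [_ fd] := fS [::].
have [C C0 h] := rapid_decay_weight 0 (fun x => normr_ge0 (f x)) fd.
by exists C => // x; have := h x; rewrite expr0 mul1r.
Qed.

Lemma schwartz0 : schwartz (fun _ : Rd => 0 : R).
Proof.
have E s : partials s (fun _ : Rd => 0 : R) = (fun _ => 0).
  elim: s => //= i s ->; apply/funext => x; rewrite /partial.
  exact: derive_cst.
move=> s; rewrite E; split=> [x|k]; first exact: differentiable_cst.
by exists 0 => x; rewrite normr0 mulr0.
Qed.

Lemma cschwartz_real f : schwartz f -> cschwartz (fun x => (f x)%:C).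
Proof. by move=> fS; split => //=; exact: schwartz0. Qed.

Lemma cschwartz_cmeasurable g : cschwartz g -> cmeasurable setT g.
Proof. by move=> [g1 g2]; split; exact: schwartz_measurable. Qed.

Lemma cschwartz_weight g : cschwartz g ->
  exists2 C, 0 <= C & forall x, cabs (g x) <= C * weight x.
Proof.
move=> [/schwartz_weight[C1 C10 h1] /schwartz_weight[C2 C20 h2]].
exists (C1 + C2) => [|x]; first exact: addr_ge0.
by rewrite (le_trans (cabs_le_ReIm _))// mulrDl lerD.
Qed.

Lemma cschwartz_bounded g : cschwartz g -> exists2 C, 0 <= C & forall x, cabs (g x) <= C.
Proof.
move=> /cschwartz_weight[C C0 h]; exists C => // x.
rewrite (le_trans (h x))// ler_piMr// /weight; apply: prodr_ile1 => i _.
have : 0 < 1 + x ord0 i ^+ 2 by rewrite ltr_pwDl// sqr_ge0.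
move=> p; rewrite invr_ge0 (ltW p)/= invf_le1// lerDl sqr_ge0//.
Qed.

Lemma weight_cintegrable g (C : R) : cmeasurable setT g ->
  (forall x, cabs (g x) <= C * weight x) -> cintegrable leb setT g.
Proof.
move=> mg gC; apply: (le_cintegrable (h := fun x => C * weight x)) => //.
apply: (eq_integrable measurableT (fun x => C%:E * (weight x)%:E)%E) => //.
by apply: integrableZl => //; exact: integrable_weight.
Qed.

Lemma cschwartz_cintegrable g : cschwartz g -> cintegrable leb setT g.
Proof.
move=> gS; have [C C0 h] := cschwartz_weight gS.
by apply: (weight_cintegrable (C := C)) => //; exact: cschwartz_cmeasurable.
Qed.

(** Reduces directional derivatives to one-variable calculus, at every point of
    the line and not only at its origin. *)
Lemma is_derive_line f (x v : Rd) (t : R) : differentiable f (x + t *: v) ->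
  is_derive t (1 : R) (fun s : R => f (x + s *: v)) ('D_v f (x + t *: v)).
Proof.
move=> df; have dv : derivable f (x + t *: v) v by apply: diff_derivable.
have E : (fun h : R => h^-1 *: (((fun s : R => f (x + s *: v)) \o shift t) (h *: (1 : R))
    - f (x + t *: v))) =
    (fun h => h^-1 *: ((f \o shift (x + t *: v)) (h *: v) - f (x + t *: v))).
  apply/funext => h /=; congr (_ *: (f _ - _)).
  by rewrite [h *: 1]mulr1 scalerDl addrCA addrA.
split; first by rewrite /derivable E.
by rewrite /derive E.
Qed.

Definition step (n : nat) : R := n.+1%:R^-1.

Lemma step_gt0 n : 0 < step n.
Proof. by rewrite invr_gt0. Qed.

Lemma step_le1 n : step n <= 1.
Proof. by rewrite invf_le1// ler1n. Qed.

Lemma cvg_step : step n @[n --> \oo] --> (0 : R).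
Proof. exact: cvg_harmonic. Qed.

Lemma cvg_squeeze0 (a b : nat -> R) : (forall n, 0 <= a n <= b n) ->
  b n @[n --> \oo] --> (0 : R) -> a n @[n --> \oo] --> (0 : R).
Proof.
move=> ab b0; apply: (squeeze_cvgr _ (cvg_cst 0) b0).
exact: nearW.
Qed.

Lemma cvg_cabs_unique (a : nat -> R[i]) (l l' : R[i]) :
  cabs (a n - l) @[n --> \oo] --> (0 : R) -> cabs (a n - l') @[n --> \oo] --> (0 : R) ->
  l = l'.
Proof.
move=> al al'; apply/eqP; rewrite -subr_eq0; apply/eqP/cabs_eq0.
have h : cabs (l - l') @[n --> \oo] --> (0 : R).
  apply: (@cvg_squeeze0 (fun _ => cabs (l - l')) (fun n => cabs (a n - l) + cabs (a n - l'))).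
    move=> n; rewrite cabs_ge0 /= (cabs_distC (a n) l) (le_trans _ (le_cabsD _ _))//.
    by rewrite addrA subrK.
  by rewrite -[X in _ --> X]addr0; exact: cvgD.
by have /cvg_lim <- := h; rewrite ?lim_cst.
Qed.

(** The transform of the difference quotient of [f] is computed by translating
    the variable of integration; dominated convergence passes to the limit. *)
Lemma fourier_partial f i y : schwartz f ->
  fourier (fun x => (partial i f x)%:C) y =
  'i * (y ord0 i)%:C * fourier (fun x => (f x)%:C) y.
Proof.
move=> fS; pose e : Rd := delta_mx ord0 i.
pose q n x := (step n)^-1 * (f (x + step n *: e) - f x).
have fpS := schwartz_partial i fS.
have [C C0 hC] := schwartz_weight fpS.
have mf := schwartz_measurable fS.
have mtr n : measurable_fun setT (fun x : Rd => f (x + step n *: e)).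
  by apply: (measurableT_comp mf); apply: measurable_add_rV.
have mcis : measurable_fun setT (fun x : Rd => - dotrV x y).
  by apply: measurableT_comp => //; exact: measurable_dotrV.
have qC n x : `|q n x| <= 4 * C * weight x.
  rewrite /q normrM gtr0_norm ?invr_gt0 ?step_gt0// mulrC ler_pdivrMr ?step_gt0//.
  have := @mvt_bound R (fun s => f (x + s *: e)) (fun s => 'D_e f (x + s *: e))
    (step n) (4 * C * weight x).
  rewrite scale0r addr0 (gtr0_norm (step_gt0 n)); apply.
    by move=> t; apply: is_derive_line; exact: schwartz_differentiable.
  move=> t tn; apply: le_trans (hC _) _.
  have -> : 4 * C * weight x = C * (4 * weight x) by ring.
  rewrite ler_wpM2l// weight_shift//.
  exact: le_trans tn (step_le1 n).
have qcvg x : q n x @[n --> \oo] --> partial i f x.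
  have dv : derivable f x e by apply: diff_derivable; exact: schwartz_differentiable.
  have h0 : (forall n, step n != 0) /\ step n @[n --> \oo] --> (0 : R).
    by split; [move=> n; rewrite gt_eqF ?step_gt0|exact: cvg_step].
  have -> : q ^~ x = (fun n => (step n)^-1 *: (f (step n *: e + x) - f x)).
    by apply/funext => n; rewrite /q [x + _]addrC.
  by move: dv => /cvgr_dnbhsP/(_ _ h0).
have fint : cintegrable leb setT (fun x => cis (- dotrV x y) * (f x)%:C).
  by apply: cintegrable_cisM => //; apply: cschwartz_cintegrable; exact: cschwartz_real.
have trint n := cintegral_translate (step n *: e) fint.
have FE n : fourier (fun x => (q n x)%:C) y =
    (step n)^-1%:C * (cis (step n * y ord0 i) - 1) * fourier (fun x => (f x)%:C) y.
  have [t1 t2] := trint n.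
  rewrite /fourier -mulrA mulrBl mul1r -{1}t2 -cintegralZl// -cintegralB//; last first.
    exact: cintegrableZl.
  rewrite -cintegralZl//; last first.
    by apply: cintegrableB => //; exact: cintegrableZl.
  apply: eq_cintegral => x _.
  rewrite mulrA -cisD dotrVDl dotrVZl [dotrV e y]dotrVC dotrV_delta /q rmorphM rmorphB /=.
  have -> : step n * y ord0 i - (dotrV x y + step n * y ord0 i) = - dotrV x y by ring.
  ring.
apply: (@cvg_cabs_unique (fun n => fourier (fun x => (q n x)%:C) y)).
  apply: (cdominated_cvg (h := fun x => 4 * C * weight x)) => //.
  - move=> n; apply: cmeasurableM; first exact: cmeasurable_cis.
    apply: cmeasurable_real; apply: measurable_funM => //.
    exact: measurable_funB.
  - apply: cmeasurableM; first exact: cmeasurable_cis.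
    by apply: cmeasurable_real; exact: schwartz_measurable.
  - apply: (eq_integrable measurableT (fun x => (4 * C)%:E * (weight x)%:E)%E) => //.
    by apply: integrableZl => //; exact: integrable_weight.
  - by move=> n x _; rewrite cabs_cisM cabs_real.
  - move=> x _; apply: (@cvg_squeeze0 _ (fun n => `|q n x - partial i f x|)).
      by move=> n; apply/andP; split; [exact: cabs_ge0|rewrite -mulrBr cabs_cisM -rmorphB cabs_real].
    by apply/norm_cvg0P/subr_cvg0; exact: qcvg.
pose M := cabs (fourier (fun x => (f x)%:C) y).
apply: (@cvg_squeeze0 _ (fun n => step n * (3 * `|y ord0 i| ^+ 2 * M))); last first.
  by rewrite -[X in _ --> X](mul0r (3 * `|y ord0 i| ^+ 2 * M)); apply: cvgMl => //; exact: cvg_step.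
move=> n; apply/andP; split; [exact: cabs_ge0|rewrite FE -mulrBl cabsM mulrA ler_wpM2r ?cabs_ge0//].
have s0 := step_gt0 n.
have -> : (step n)^-1%:C * (cis (step n * y ord0 i) - 1) - 'i * (y ord0 i)%:C =
    (step n)^-1%:C * (cis (step n * y ord0 i) - 1 - 'i * (step n * y ord0 i)%:C).
  rewrite [RHS]mulrBr; congr (_ - _); rewrite mulrCA -rmorphM mulrA mulVf ?gt_eqF//.
  by rewrite mul1r.
rewrite cabsM cabs_real gtr0_norm ?invr_gt0// mulrC ler_pdivrMr//.
apply: le_trans (cabs_cis_taylor _) _; rewrite normrM (gtr0_norm s0) exprMn !expr2.
by rewrite le_eqVlt; apply/orP; left; apply/eqP; ring.
Qed.

End Schwartz.

(** * The Fourier integral *)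

Section FourierBasics.
Context {R : realType} {d : nat}.
Local Notation Rd := 'rV[R]_d.
Local Notation leb := (@lebesgue_rV R d).
Implicit Types (f g u : Rd -> R[i]).

Lemma cintegrable_fourier_kernel f y : cintegrable leb setT f ->
  cintegrable leb setT (fun x => cis (- dotrV x y) * f x).
Proof.
move=> fi; apply: cintegrable_cisM => //.
by apply: measurableT_comp => //; exact: measurable_dotrV.
Qed.

Lemma cintegrable_inv_fourier_kernel f x : cintegrable leb setT f ->
  cintegrable leb setT (fun y => cis (dotrV x y) * f y).
Proof. by move=> fi; apply: cintegrable_cisM => //; exact: measurable_dotrV. Qed.

Lemma L1norm_ge0 f : (0 <= L1norm leb f)%E.
Proof. by apply: integral_ge0 => x _; rewrite lee_fin cabs_ge0. Qed.

Lemma L1norm_fin f : cintegrable leb setT f -> L1norm leb f \is a fin_num.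
Proof. by move=> /cintegrableP[]// _ h; rewrite ge0_fin_numE ?L1norm_ge0. Qed.

Lemma cintegrable_L1norm f (C : R) : cmeasurable setT f -> (L1norm leb f <= C%:E)%E ->
  cintegrable leb setT f.
Proof. by move=> mf fC; apply/cintegrableP => //; split => //; exact: le_lt_trans fC (ltry _). Qed.

Lemma L1norm_cisM (h : Rd -> R) f : L1norm leb (fun x => cis (h x) * f x) = L1norm leb f.
Proof. by apply: eq_integral => x _; rewrite cabs_cisM. Qed.

Lemma cabs_fourier_le f (C : R) y : cintegrable leb setT f -> (L1norm leb f <= C%:E)%E ->
  cabs (fourier f y) <= C.
Proof.
move=> fi fC; apply: cabs_cintegral_leR => //; first exact: cintegrable_fourier_kernel.
by rewrite [leLHS]L1norm_cisM.
Qed.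

Definition kappa : R := ((2 * pi) ^+ d)^-1.

Lemma kappa_gt0 : 0 < kappa.
Proof. by rewrite invr_gt0 exprn_gt0// mulr_gt0// pi_gt0. Qed.

Lemma kappa_ge0 : 0 <= kappa.
Proof. exact/ltW/kappa_gt0. Qed.

Lemma cabs_inv_fourier_le g (C : R) x : cintegrable leb setT g -> (L1norm leb g <= C%:E)%E ->
  cabs (inv_fourier g x) <= kappa * C.
Proof.
move=> gi gC; rewrite /inv_fourier cabsM cabs_real ger0_norm ?kappa_ge0// ler_wpM2l ?kappa_ge0//.
apply: cabs_cintegral_leR => //; first exact: cintegrable_inv_fourier_kernel.
by rewrite [leLHS]L1norm_cisM.
Qed.

Lemma cmeasurable_fourier f : cmeasurable setT f -> cmeasurable setT (fourier f).
Proof.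
move=> mf; apply: (cmeasurable_cintegral leb
  (f := fun z : Rd * Rd => cis (- dotrV z.2 z.1) * f z.2)).
apply: cmeasurableM; last by apply: (cmeasurable_comp (f := f)) => //; exact: measurable_snd.
apply: cmeasurable_cis; apply: measurableT_comp => //; exact: measurable_dotrV.
Qed.

Lemma cmeasurable_inv_fourier f : cmeasurable setT f -> cmeasurable setT (inv_fourier f).
Proof.
move=> mf; apply: cmeasurableM; first exact: cmeasurable_cst.
apply: (cmeasurable_cintegral leb
  (f := fun z : Rd * Rd => cis (dotrV z.1 z.2) * f z.2)).
apply: cmeasurableM; last by apply: (cmeasurable_comp (f := f)) => //; exact: measurable_snd.
by apply: cmeasurable_cis; exact: measurable_dotrV.
Qed.

Lemma fourierB f g y : cintegrable leb setT f -> cintegrable leb setT g ->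
  fourier (fun x => f x - g x) y = fourier f y - fourier g y.
Proof.
move=> fi gi; rewrite /fourier -cintegralB//; [|exact: cintegrable_fourier_kernel..].
by apply: eq_cintegral => x _; rewrite mulrBr.
Qed.

Lemma fourierD f g y : cintegrable leb setT f -> cintegrable leb setT g ->
  fourier (fun x => f x + g x) y = fourier f y + fourier g y.
Proof.
move=> fi gi; rewrite /fourier -cintegralD//; [|exact: cintegrable_fourier_kernel..].
by apply: eq_cintegral => x _; rewrite mulrDr.
Qed.

Lemma fourierZ (c : R[i]) f y : cintegrable leb setT f ->
  fourier (fun x => c * f x) y = c * fourier f y.
Proof.
move=> fi; rewrite /fourier -cintegralZl//; last exact: cintegrable_fourier_kernel.
by apply: eq_cintegral => x _; rewrite mulrCA.
Qed.

Lemma inv_fourierB f g x : cintegrable leb setT f -> cintegrable leb setT g ->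
  inv_fourier (fun y => f y - g y) x = inv_fourier f x - inv_fourier g x.
Proof.
move=> fi gi; rewrite /inv_fourier -mulrBr -cintegralB//; [|exact: cintegrable_inv_fourier_kernel..].
by congr (_ * _); apply: eq_cintegral => y _; rewrite mulrBr.
Qed.

Lemma inv_fourierZ (c : R[i]) f x : cintegrable leb setT f ->
  inv_fourier (fun y => c * f y) x = c * inv_fourier f x.
Proof.
move=> fi; rewrite /inv_fourier mulrCA -(cintegralZl c)//; last exact: cintegrable_inv_fourier_kernel.
by congr (_ * _); apply: eq_cintegral => y _; rewrite mulrCA.
Qed.

End FourierBasics.

Section FourierSchwartz.
Context {R : realType} {d : nat}.
Local Notation Rd := 'rV[R]_d.
Local Notation leb := (@lebesgue_rV R d).

(** Each partial derivative of [f] buys one power of the frequency. *)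
Lemma fourier_coord_decay (f : Rd -> R) i k : schwartz f ->
  exists C, forall y : Rd, `|y ord0 i| ^+ k * cabs (fourier (fun x => (f x)%:C) y) <= C.
Proof.
elim: k f => [|k IH] f fS.
  have fi := cschwartz_cintegrable (cschwartz_real fS).
  exists (fine (L1norm leb (fun x => (f x)%:C))) => y; rewrite expr0 mul1r.
  by apply: cabs_fourier_le => //; rewrite fineK ?L1norm_fin.
have [C hC] := IH _ (schwartz_partial i fS); exists C => y.
by have := hC y; rewrite fourier_partial// !cabsM cabs_i mul1r cabs_real mulrA -exprSr.
Qed.

Lemma expr_sum_le n (a : 'I_n -> R) N : (forall i, 0 <= a i) ->
  (\sum_i a i) ^+ N <= n%:R ^+ N * (1 + \sum_i a i ^+ N).
Proof.
case: n a => [|n] a a0; first by rewrite !big_ord0 addr0 mulr1.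
pose j := [arg max_(i > ord0) a i]%O.
have aj i : a i <= a j by rewrite /j; case: arg_maxP => // k _; exact.
apply: (@le_trans _ _ ((n.+1%:R * a j) ^+ N)).
  apply: lerXn2r; rewrite ?nnegrE ?sumr_ge0 ?mulr_ge0//.
  apply: le_trans (ler_sum _ (fun i _ => aj i)) _.
  by rewrite sumr_const card_ord mulr_natl.
rewrite exprMn ler_wpM2l ?exprn_ge0// (bigD1 j)//= addrCA lerDl addr_ge0//.
by apply: sumr_ge0 => i _; rewrite exprn_ge0.
Qed.

Lemma enorm_le_sum (y : Rd) : enorm y <= \sum_i `|y ord0 i|.
Proof.
have s0 : 0 <= \sum_(i < d) `|y ord0 i| by exact: sumr_ge0.
rewrite -[leRHS]ger0_norm// -sqrtr_sqr ler_sqrt ?sqr_ge0// expr2 mulr_suml.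
apply: ler_sum => i _; rewrite -expr2 -real_normK ?num_real// expr2 ler_wpM2l//.
by rewrite (bigD1 i)//= lerDl sumr_ge0.
Qed.

(** The [k]-th power of [enorm y] is at most a multiple of [1 + \sum_i
    `|y_i|^k], so that decay in each coordinate is enough. *)
Lemma rapid_decay_fourier (f : Rd -> R) : schwartz f ->
  rapid_decay (fun y => cabs (fourier (fun x => (f x)%:C) y)).
Proof.
move=> fS k.
have [C0 h0] : exists C, forall y : Rd, cabs (fourier (fun x => (f x)%:C) y) <= C.
  have fi := cschwartz_cintegrable (cschwartz_real fS).
  exists (fine (L1norm leb (fun x => (f x)%:C))) => y.
  by apply: cabs_fourier_le => //; rewrite fineK ?L1norm_fin.
have [C hC] := choice (fun i => fourier_coord_decay i k fS).
exists (d%:R ^+ k * (C0 + \sum_i C i)) => y.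
have F0 := cabs_ge0 (fourier (fun x => (f x)%:C) y).
apply: le_trans (_ : (d%:R ^+ k * (1 + \sum_i `|y ord0 i| ^+ k)) *
    cabs (fourier (fun x => (f x)%:C) y) <= _).
  apply: ler_wpM2r => //; apply: le_trans (expr_sum_le k (fun i => normr_ge0 (y ord0 i))).
  by apply: lerXn2r (enorm_le_sum y); rewrite nnegrE ?enorm_ge0// sumr_ge0.
rewrite -mulrA ler_wpM2l ?exprn_ge0// mulrDl mul1r lerD// mulr_suml.
by apply: ler_sum => i _; exact: hC.
Qed.

Lemma fourier_schwartz_decay (g : Rd -> R[i]) m : cschwartz g ->
  exists2 C, 0 <= C &
    forall y, (1 + dotrV y y) ^+ m * cabs (fourier g y) <= C * weight y.
Proof.
move=> [g1 g2].
have [C1 C10 h1] := rapid_decay_weight m (fun y => cabs_ge0 _) (rapid_decay_fourier g1).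
have [C2 C20 h2] := rapid_decay_weight m (fun y => cabs_ge0 _) (rapid_decay_fourier g2).
exists (C1 + C2) => [|y]; first exact: addr_ge0.
have i1 := cschwartz_cintegrable (cschwartz_real g1).
have i2 := cschwartz_cintegrable (cschwartz_real g2).
have -> : fourier g y = fourier (fun x => (complex.Re (g x))%:C) y +
    'i * fourier (fun x => (complex.Im (g x))%:C) y.
  rewrite -fourierZ// -fourierD//; last exact: cintegrableZl.
  by congr (fourier _ y); apply/funext => x; rewrite -complexE.
rewrite mulrDl; apply: le_trans (lerD (h1 y) (h2 y)).
rewrite -mulrDr ler_wpM2l ?exprn_ge0 ?addr_ge0 ?dotrVv_ge0//.
by rewrite (le_trans (le_cabsD _ _))// cabsM cabs_i mul1r.
Qed.

Lemma fourier_schwartz_cintegrable (g : Rd -> R[i]) : cschwartz g ->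
  cintegrable leb setT (fourier g).
Proof.
move=> gS; have [C C0 h] := fourier_schwartz_decay 0 gS.
apply: (weight_cintegrable (C := C)).
  by apply: cmeasurable_fourier; exact: cschwartz_cmeasurable.
by move=> y; have := h y; rewrite expr0 mul1r.
Qed.

End FourierSchwartz.

(** * Modulated Gaussians are Schwartz functions *)

Section Gaussian.
Context {R : realType} {d : nat}.
Local Notation Rd := 'rV[R]_d.
Local Notation leb := (@lebesgue_rV R d).

Definition gauss (a : R) (x : Rd) : R := expR (- (a * dotrV x x)).

Lemma gauss_gt0 a x : 0 < gauss a x.
Proof. exact: expR_gt0. Qed.

Lemma gauss_le1 a x : 0 <= a -> gauss a x <= 1.
Proof. by move=> a0; rewrite -expR0 ler_expR oppr_le0 mulr_ge0// dotrVv_ge0. Qed.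

Lemma differentiable_dotrV_l (b x : Rd) : differentiable (dotrV b) x.
Proof.
rewrite (_ : dotrV b = \sum_(i < d) (fun y : Rd => b ord0 i * y ord0 i)); last first.
  by apply/funext => y; rewrite fct_sumE.
apply: differentiable_sum => i; apply: differentiableM; first exact: differentiable_cst.
exact: differentiable_coord.
Qed.

Lemma differentiable_dotrVv (x : Rd) : differentiable (fun y : Rd => dotrV y y) x.
Proof.
rewrite (_ : (fun y : Rd => dotrV y y) = \sum_(i < d) (fun y : Rd => y ord0 i * y ord0 i)); last first.
  by apply/funext => y; rewrite fct_sumE.
by apply: differentiable_sum => i; apply: differentiableM; exact: differentiable_coord.
Qed.

Lemma differentiable_comp1 (h : R -> R) (g : Rd -> R) x :
  (forall t, derivable h t (1 : R)) -> differentiable g x ->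
  differentiable (fun y => h (g y)) x.
Proof.
move=> dh dg; apply: (differentiable_comp dg); exact/derivable1_diffP.
Qed.

Lemma differentiable_gauss a x : differentiable (gauss a) x.
Proof.
apply: (differentiable_comp1 (h := fun t => expR (- (a * t)))); last exact: differentiable_dotrVv.
by move=> t; apply: ex_derive.
Qed.

Lemma derive_along_line (f : Rd -> R) (x v : Rd) (D : R) :
  is_derive (0 : R) (1 : R) (fun t : R => f (x + t *: v)) D -> 'D_v f x = D.
Proof.
move=> [_ <-]; rewrite /derive.
have -> : (fun h : R => h^-1 *: (((fun t : R => f (x + t *: v)) \o shift 0) (h *: (1 : R))
      - f (x + 0 *: v))) = (fun h => h^-1 *: ((f \o shift x) (h *: v) - f x)).
  apply/funext => h /=; rewrite addr0 scale0r addr0 [h *: 1]mulr1.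
  by rewrite [x + _]addrC.
by [].
Qed.

(** Polynomials times modulated Gaussians: the smallest family that contains
    [cos (b . x) exp (- a |x|^2)] and is stable under the operations that
    differentiation produces. *)
Inductive hermite (a : R) (b : Rd) : (Rd -> R) -> Prop :=
| hermite_cos : hermite a b (fun x => cos (dotrV b x) * gauss a x)
| hermite_sin : hermite a b (fun x => sin (dotrV b x) * gauss a x)
| hermiteX i f : hermite a b f -> hermite a b (fun x => x ord0 i * f x)
| hermiteD f g : hermite a b f -> hermite a b g -> hermite a b (fun x => f x + g x)
| hermiteZ c f : hermite a b f -> hermite a b (fun x => c * f x).

Lemma hermite_differentiable a b f x : hermite a b f -> differentiable f x.
Proof.
elim=> [||i g _ IH|g h _ IHg _ IHh|c g _ IH].
- apply: differentiableM; last exact: differentiable_gauss.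
  by apply: (differentiable_comp1 (h := cos)) => //; exact: differentiable_dotrV_l.
- apply: differentiableM; last exact: differentiable_gauss.
  by apply: (differentiable_comp1 (h := sin)) => //; exact: differentiable_dotrV_l.
- by apply: differentiableM => //; exact: differentiable_coord.
- exact: differentiableD.
- by apply: differentiableM => //; exact: differentiable_cst.
Qed.

Lemma dotrV_line (x : Rd) i (t : R) :
  dotrV (x + t *: delta_mx ord0 i) (x + t *: delta_mx ord0 i) =
  dotrV x x + 2 * t * x ord0 i + t ^+ 2.
Proof.
rewrite dotrVDl !dotrVDr !dotrVZl !dotrVZr [dotrV (delta_mx _ _) x]dotrVC !dotrV_delta.
by rewrite !mxE !eqxx /=; ring.
Qed.

Lemma partial_mul_coord i j (f : Rd -> R) x : differentiable f x ->
  partial j (fun x => x ord0 i * f x) x =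
  (i == j)%:R * f x + x ord0 i * partial j f x.
Proof.
move=> df; apply: derive_along_line.
have h := is_derive_line (t := 0) (v := delta_mx ord0 j) (x := x) (f := f).
rewrite scale0r addr0 in h; have {}h := h df.
have -> : (fun t : R => (x + t *: delta_mx ord0 j) ord0 i * f (x + t *: delta_mx ord0 j)) =
    (fun t => x ord0 i + t * (i == j)%:R) * (fun t => f (x + t *: delta_mx ord0 j)).
  by apply/funext => t; rewrite !mxE eqxx.
apply: is_derive_eq => /=.
rewrite scale0r addr0 !mul0r !addr0 /GRing.scale /= /partial; ring.
Qed.

Lemma partial_cos_gauss a b i x :
  partial i (fun x => cos (dotrV b x) * gauss a x) x =
  - b ord0 i * (sin (dotrV b x) * gauss a x) +
  (- (2 * a)) * (x ord0 i * (cos (dotrV b x) * gauss a x)).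
Proof.
apply: derive_along_line.
have -> : (fun t : R => cos (dotrV b (x + t *: delta_mx ord0 i)) * gauss a (x + t *: delta_mx ord0 i)) =
    (fun t => cos (dotrV b x + t * b ord0 i) *
              expR (- (a * (dotrV x x + 2 * t * x ord0 i + t ^+ 2)))).
  by apply/funext => t; rewrite /gauss dotrV_line dotrVDr dotrVZr dotrV_delta.
apply: is_derive_eq; rewrite /gauss /GRing.scale /= !expr0n /=.
rewrite !(mul0r, mulr0, addr0, add0r); ring.
Qed.

Lemma partial_sin_gauss a b i x :
  partial i (fun x => sin (dotrV b x) * gauss a x) x =
  b ord0 i * (cos (dotrV b x) * gauss a x) +
  (- (2 * a)) * (x ord0 i * (sin (dotrV b x) * gauss a x)).
Proof.
apply: derive_along_line.
have -> : (fun t : R => sin (dotrV b (x + t *: delta_mx ord0 i)) * gauss a (x + t *: delta_mx ord0 i)) =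
    (fun t => sin (dotrV b x + t * b ord0 i) *
              expR (- (a * (dotrV x x + 2 * t * x ord0 i + t ^+ 2)))).
  by apply/funext => t; rewrite /gauss dotrV_line dotrVDr dotrVZr dotrV_delta.
apply: is_derive_eq; rewrite /gauss /GRing.scale /= !expr0n /=.
rewrite !(mul0r, mulr0, addr0, add0r); ring.
Qed.

Lemma hermite_partial a b f i : hermite a b f -> hermite a b (partial i f).
Proof.
elim=> [||j g hg IH|g h hg IHg hh IHh|c g hg IH].
- rewrite (_ : partial i _ = fun x => - b ord0 i * (sin (dotrV b x) * gauss a x) +
    (- (2 * a)) * (x ord0 i * (cos (dotrV b x) * gauss a x))); last first.
    by apply/funext => x; exact: partial_cos_gauss.
  apply: hermiteD; first exact/hermiteZ/hermite_sin.
  exact/hermiteZ/hermiteX/hermite_cos.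
- rewrite (_ : partial i _ = fun x => b ord0 i * (cos (dotrV b x) * gauss a x) +
    (- (2 * a)) * (x ord0 i * (sin (dotrV b x) * gauss a x))); last first.
    by apply/funext => x; exact: partial_sin_gauss.
  apply: hermiteD; first exact/hermiteZ/hermite_cos.
  exact/hermiteZ/hermiteX/hermite_sin.
- rewrite (_ : partial i _ = fun x => (j == i)%:R * g x + x ord0 j * partial i g x); last first.
    by apply/funext => x; apply: partial_mul_coord; exact: hermite_differentiable hg.
  by apply: hermiteD; [exact: hermiteZ|exact: hermiteX].
- rewrite (_ : partial i _ = fun x => partial i g x + partial i h x); last first.
    apply/funext => x; apply: deriveD; apply: diff_derivable.
      exact: hermite_differentiable hg.
    exact: hermite_differentiable hh.
  exact: hermiteD.
- rewrite (_ : partial i _ = fun x => c * partial i g x); last first.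
    apply/funext => x; apply: (deriveZ (f := g)); apply: diff_derivable.
    exact: hermite_differentiable hg.
  exact: hermiteZ.
Qed.

Lemma gauss_decay a N : 0 < a ->
  exists2 C, 0 <= C & forall x : Rd, (1 + dotrV x x) ^+ N * gauss a x <= C.
Proof.
move=> a0; pose c := Num.min 1 (a / N.+1%:R).
have c0 : 0 < c by rewrite lt_min ltr01 divr_gt0.
exists (c ^- N.+1) => [|x]; first by rewrite invr_ge0 exprn_ge0// ltW.
have xx := dotrVv_ge0 x.
have h : c * (1 + dotrV x x) <= expR (a / N.+1%:R * dotrV x x).
  apply: le_trans (expR_ge1Dx _); rewrite mulrDr mulr1 lerD//.
    by rewrite ge_min lexx.
  by rewrite ler_wpM2r// ge_min lexx orbT.
have key : c ^+ N.+1 * (1 + dotrV x x) ^+ N.+1 <= expR (a * dotrV x x).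
  have -> : a * dotrV x x = N.+1%:R * (a / N.+1%:R * dotrV x x) by field; rewrite ?pnatr_eq0.
  rewrite expRM_natl -exprMn; apply: lerXn2r => //.
    by rewrite nnegrE mulr_ge0 ?addr_ge0// ltW.
  by rewrite nnegrE expR_ge0.
rewrite /gauss expRN ler_pdivrMr ?expR_gt0// mulrC ler_pdivlMr ?exprn_gt0//.
apply: le_trans key; rewrite mulrC ler_wpM2l ?exprn_ge0 ?(ltW c0)// exprS ler_peMl ?exprn_ge0 ?addr_ge0//.
by rewrite lerDl.
Qed.

Lemma hermite_bound a b f : hermite a b f ->
  exists m C, 0 <= C /\ forall x, `|f x| <= C * ((1 + dotrV x x) ^+ m * gauss a x).
Proof.
have one (x : Rd) m : 1 <= (1 + dotrV x x) ^+ m by rewrite exprn_ege1// lerDl dotrVv_ge0.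
elim=> [||i g _ [m [C [C0 h]]]|g h _ [m [C [C0 hg]]] _ [n [B [B0 hh]]]|c g _ [m [C [C0 h]]]].
- exists 0%N, 1; split => // x; rewrite mul1r expr0 normrM ler_pM//.
    by rewrite ler_norml cos_geN1 cos_le1.
  by rewrite gtr0_norm// gauss_gt0.
- exists 0%N, 1; split => // x; rewrite mul1r expr0 normrM ler_pM//.
    by rewrite ler_norml sin_geN1 sin_le1.
  by rewrite gtr0_norm// gauss_gt0.
- exists m.+1, C; split => // x; rewrite normrM exprS -[_ * _ * gauss a x]mulrA mulrCA ler_pM//.
  have := sqr_coord_le x i; rewrite -real_normK ?num_real// => h1.
  by apply: (@le_trans _ _ (1 + `|x ord0 i| ^+ 2)); rewrite ?lerD2l//; nra.
- exists (m + n)%N, (C + B); split => [|x]; first exact: addr_ge0.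
  have G0 := ltW (gauss_gt0 a x); have D0 : 0 <= 1 + dotrV x x by rewrite addr_ge0// dotrVv_ge0.
  apply: le_trans (ler_normD _ _) _; rewrite mulrDl lerD//.
    apply: le_trans (hg x) _; rewrite ler_wpM2l// ler_wpM2r// exprD ler_peMr// exprn_ge0//.
  apply: le_trans (hh x) _; rewrite ler_wpM2l// ler_wpM2r// exprD ler_peMl// exprn_ge0//.
- exists m, (`|c| * C); split => [|x]; first exact: mulr_ge0.
  by rewrite normrM -mulrA ler_wpM2l.
Qed.

Lemma hermite_schwartz a b f : 0 < a -> hermite a b f -> schwartz f.
Proof.
move=> a0 hf s; have hs : hermite a b (partials s f).
  by elim: s => //= i s IH; exact: hermite_partial.
split=> [x|k]; first exact: hermite_differentiable hs.
have [m [C [C0 h]]] := hermite_bound hs.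
have [B B0 hB] := gauss_decay (k + m) a0.
exists (C * B) => x; have D0 := dotrVv_ge0 x.
apply: (@le_trans _ _ (enorm x ^+ k * (C * ((1 + dotrV x x) ^+ m * gauss a x)))).
  by rewrite ler_wpM2l// exprn_ge0// enorm_ge0.
rewrite mulrCA ler_wpM2l//; apply: le_trans (hB x).
rewrite mulrA exprD ler_wpM2r ?(ltW (gauss_gt0 _ _))// ler_wpM2r ?exprn_ge0 ?addr_ge0//.
apply: lerXn2r; rewrite ?nnegrE ?enorm_ge0 ?addr_ge0//.
rewrite -sqr_enorm; have := enorm_ge0 x; nra.
Qed.

End Gaussian.

(** * The Fourier transform of a Gaussian *)

Section GaussianFourier.
Context {R : realType} {d : nat}.
Local Notation Rd := 'rV[R]_d.
Local Notation leb := (@lebesgue_rV R d).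

Lemma hermite_gauss (a : R) : hermite a 0 (@gauss R d a).
Proof.
have := hermite_cos a (0 : Rd).
have -> : (fun x : Rd => cos (dotrV 0 x) * gauss a x) = gauss a; last by [].
by apply/funext => x; rewrite -(scale0r 0) dotrVZl mul0r cos0 mul1r.
Qed.

Lemma schwartz_gauss (a : R) : 0 < a -> schwartz (@gauss R d a).
Proof. by move=> a0; exact: hermite_schwartz a0 (hermite_gauss a). Qed.

Lemma cschwartz_modulated_gauss (a : R) (b : Rd) : 0 < a ->
  cschwartz (fun x => cis (dotrV b x) * (gauss a x)%:C).
Proof.
move=> a0; split.
  under eq_fun do rewrite ReM /= mulr0 subr0.
  exact: hermite_schwartz a0 (hermite_cos a b).
under eq_fun do rewrite ImM /= mulr0 add0r.
exact: hermite_schwartz a0 (hermite_sin a b).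
Qed.

Lemma integrable_schwartz (f : Rd -> R) : schwartz f -> leb.-integrable setT (EFin \o f).
Proof. by move=> /cschwartz_real/cschwartz_cintegrable[]. Qed.

Definition gauss_mass : R := \int[leb]_x gauss 1 x.

Lemma ge0_integral_gauss1 :
  (\int[leb]_x (gauss 1 x)%:E = ((Num.sqrt pi) ^+ d)%:E)%E.
Proof.
have E (x : Rd) : gauss 1 x = \prod_(i < d) gauss_fun (x ord0 i).
  rewrite /gauss mul1r /dotrV -sumrN expR_sum.
  by apply: eq_bigr => i _; rewrite /gauss_fun expr2.
under eq_integral do rewrite E.
rewrite (ge0_integral_prod (f := fun _ => gauss_fun)).
- rewrite (eq_bigr (fun _ => (Num.sqrt pi)%:E)); last by move=> i _; exact: integralT_gauss.
  by rewrite prodEFin prodr_const card_ord.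
- by move=> _; exact: measurable_gauss_fun.
- by move=> _ x; exact: gauss_fun_ge0.
Qed.

Lemma gauss_massE : gauss_mass = (Num.sqrt pi) ^+ d.
Proof. by rewrite /gauss_mass /Rintegral ge0_integral_gauss1. Qed.

Lemma gauss_mass_sqr : gauss_mass ^+ 2 * 2 ^+ d = (2 * pi) ^+ d.
Proof.
by rewrite gauss_massE -exprM mulnC exprM sqr_sqrtr ?pi_ge0// exprMn mulrC.
Qed.

Lemma gauss_scale (c : R) (x : Rd) : gauss 1 (c *: x) = gauss (c ^+ 2) x.
Proof. by rewrite /gauss dotrVZl dotrVZr mul1r mulrA. Qed.

Lemma integral_gauss (c : R) : 0 < c ->
  \int[leb]_x gauss (c ^+ 2) x = (c^-1) ^+ d * gauss_mass.
Proof.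
move=> c0; rewrite /gauss_mass /Rintegral.
under eq_integral => x _ do rewrite -gauss_scale -[c *: x]addr0.
rewrite (ge0_integral_affine 0 (f := fun x => (gauss 1 x)%:E)) ?gt_eqF//.
- by rewrite ge0_integral_gauss1 -EFinM /= gtr0_norm.
- by apply/measurable_EFinP; apply: schwartz_measurable; exact: schwartz_gauss.
- by move=> x; rewrite lee_fin ltW// gauss_gt0.
Qed.

Lemma cintegrable_real (f : Rd -> R) : leb.-integrable setT (EFin \o f) ->
  cintegrable leb setT (fun x => (f x)%:C).
Proof. by move=> fi; split => //=; exact: integrable0. Qed.

(** For real [f] the transform along a ray is a cosine and a sine transform,
    functions of the real variable [t]. *)
Lemma fourier_real_ray (f : Rd -> R) (y : Rd) (t : R) : leb.-integrable setT (EFin \o f) ->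
  fourier (fun x => (f x)%:C) (t *: y) =
  (\int[leb]_x (cos (t * dotrV x y) * f x)) +i* (- \int[leb]_x (sin (t * dotrV x y) * f x)).
Proof.
move=> fi; have mf : measurable_fun setT f by apply/measurable_EFinP; exact: measurable_int fi.
have mxy : measurable_fun setT (fun x : Rd => t * dotrV x y).
  by apply: measurable_funM => //; exact: measurable_dotrV.
rewrite /fourier /cintegral; congr Complex.
  by apply: eq_Rintegral => x _; rewrite ReM /= mulr0 subr0 dotrVZr cosN.
rewrite -mulN1r -RintegralZl//.
  by apply: eq_Rintegral => x _; rewrite ImM /= mulr0 add0r dotrVZr sinN mulNr mulN1r.
apply: (le_integrable measurableT _ _ fi).
  apply/measurable_EFinP; apply: measurable_funM => //.
  apply: measurableT_comp => //.
  by apply: continuous_measurable_fun; exact: continuous_sin.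
move=> x _ /=; rewrite lee_fin normrM ler_piMl//.
by rewrite ler_norml sin_geN1 sin_le1.
Qed.

Lemma fourier_sum (I : Type) (r : seq I) (F : I -> Rd -> R[i]) y :
  (forall i, cintegrable leb setT (F i)) ->
  cintegrable leb setT (fun x => \sum_(i <- r) F i x) /\
  fourier (fun x => \sum_(i <- r) F i x) y = \sum_(i <- r) fourier (F i) y.
Proof.
move=> Fi; elim: r => [|i r [IH1 IH2]].
  rewrite big_nil; under eq_fun do rewrite big_nil.
  split; first by split; exact: integrable0.
  rewrite /fourier; under eq_cintegral do rewrite mulr0.
  exact: cintegral0.
rewrite big_cons -IH2 -fourierD//.
have -> : (fun x => \sum_(j <- i :: r) F j x) = (fun x => F i x + \sum_(j <- r) F j x).
  by apply/funext => x; rewrite big_cons.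
by split => //; exact: cintegrableD.
Qed.

Lemma partial_gauss (a : R) i (x : Rd) :
  partial i (gauss a) x = - (2 * a) * (x ord0 i * gauss a x).
Proof.
have := partial_cos_gauss a (0 : Rd) i x.
have -> : (fun x : Rd => cos (dotrV 0 x) * gauss a x) = gauss a.
  by apply/funext => z; rewrite -(scale0r 0) dotrVZl mul0r cos0 mul1r.
by move=> ->; rewrite mxE oppr0 mul0r add0r -(scale0r 0) dotrVZl mul0r cos0 mul1r.
Qed.

Section ODE.
Variables (a : R) (a0 : 0 < a) (y : Rd).
Local Notation G := (@gauss R d a).
Let k : R := dotrV y y / (2 * a).

Let dotG (x : Rd) : R := dotrV x y * G x.

Let integrable_dotG : leb.-integrable setT (EFin \o dotG).
Proof.
apply: (eq_integrable measurableT (fun x : Rd => \sum_(i < d) (y ord0 i * (x ord0 i * G x))%:E)%E).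
  move=> x _; rewrite /= sumEFin; congr EFin.
  by rewrite /dotG /dotrV mulr_suml; apply: eq_bigr => i _; rewrite mulrCA mulrA.
apply: integrable_sum => // i _.
apply: (integrable_schwartz (f := fun x : Rd => y ord0 i * (x ord0 i * G x))).
apply: (hermite_schwartz (a := a) (b := 0)) => //; apply: hermiteZ; apply: hermiteX.
exact: hermite_gauss.
Qed.

(* Differentiation under the integral sign, for [h = cos, sin]; the derivative is
   dominated by [`|dotG|]. *)
Let osc_deriv (h h' : R -> R) : (forall t : R, is_derive t (1 : R) h (h' t)) ->
  (forall t, `|h t| <= 1) -> (forall t, `|h' t| <= 1) -> measurable_fun setT h ->
  forall t : R, is_derive t (1 : R) (fun t : R => \int[leb]_x (h (t * dotrV x y) * G x))
    (\int[leb]_x (h' (t * dotrV x y) * (dotrV x y * G x))).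
Proof.
move=> dh h1 h'1 mh t.
have GS := schwartz_gauss a0.
have mG := schwartz_measurable GS.
have mxy (s : R) : measurable_fun setT (fun x : Rd => s * dotrV x y).
  by apply: measurable_funM => //; exact: measurable_dotrV.
pose f (s : R) (x : Rd) := h (s * dotrV x y) * G x.
have df s x : is_derive s (1 : R) (f ^~ x) (h' (s * dotrV x y) * (dotrV x y * G x)).
  have := dh (s * dotrV x y) => dhs.
  have d1 : is_derive s (1 : R) (fun s : R => s * dotrV x y) (dotrV x y).
    by apply: is_derive_eq; rewrite /GRing.scale /= !mulr0 add0r mulr1.
  have d2 : is_derive s (1 : R) (h \o (fun s : R => s * dotrV x y))
      (h' (s * dotrV x y) * dotrV x y) by exact: is_derive1_comp.
  have -> : f ^~ x = (h \o (fun s : R => s * dotrV x y)) * cst (G x) by [].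
  apply: is_derive_eq; rewrite /GRing.scale /= mulr0 add0r; ring.
have intf s : leb.-integrable setT (EFin \o f s).
  apply: (le_integrable measurableT _ _ (integrable_schwartz GS)).
    by apply/measurable_EFinP; apply: measurable_funM => //; exact: measurableT_comp.
  by move=> x _ /=; rewrite lee_fin normrM ler_piMl.
pose D (x : Rd) : R := `|dotrV x y * G x|.
have intD : leb.-integrable setT (EFin \o D).
  exact: (integrable_abse integrable_dotG).
have It : `]t - 1, t + 1[%classic t by rewrite /= in_itv /= ltrBlDr !ltrDl ltr01.
have der s x : derivable (f ^~ x) s 1 by have [] := df s x.
have dE s x : partial1of2 f s x = h' (s * dotrV x y) * (dotrV x y * G x).
  by rewrite partial1of2E; have [_] := df s x.
have D0 x : 0 <= D x by exact: normr_ge0.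
have Dub s x : `]t - 1, t + 1[%classic s -> setT x -> `|partial1of2 f s x| <= D x.
  by move=> _ _; rewrite dE normrM ler_piMl.
split.
  exact: (derivable_under_integral measurableT It (fun s _ => intf s)
    (fun s x _ _ => der s x) D0 intD Dub).
rewrite -derive1E (differentiation_under_integral measurableT It (fun s _ => intf s)
    (fun s x _ _ => der s x) D0 intD Dub).
by apply: eq_Rintegral => x _; rewrite dE.
Qed.

(* The Gaussian solves [grad G = - 2 a x G]; its transform solves the dual equation. *)
Let fourier_dotG (t : R) : (- (2 * a))%:C * fourier (fun x => (dotG x)%:C) (t *: y) =
  'i * (t * dotrV y y)%:C * fourier (fun x => (G x)%:C) (t *: y).
Proof.
have GS := schwartz_gauss a0.
pose F i x : R[i] := (y ord0 i)%:C * (partial i G x)%:C.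
have Fi i : cintegrable leb setT (F i).
  apply: cintegrableZl => //; apply: cschwartz_cintegrable; apply: cschwartz_real.
  exact: schwartz_partial.
have [_ e] := fourier_sum (index_enum 'I_d) (t *: y) Fi.
have e1 : (fun x => \sum_(i < d) F i x) = (fun x => (- (2 * a))%:C * (dotG x)%:C).
  apply/funext => x; rewrite /F /dotG /dotrV -rmorphM mulr_suml mulr_sumr rmorph_sum.
  by apply: eq_bigr => i _; rewrite -rmorphM partial_gauss; congr (_%:C); ring.
rewrite -fourierZ; last exact: cintegrable_real.
rewrite -e1 e /dotrV mulr_sumr rmorph_sum mulr_sumr mulr_suml; apply: eq_bigr => i _.
rewrite /F fourierZ; last by apply: cschwartz_cintegrable; apply: cschwartz_real; exact: schwartz_partial.
rewrite fourier_partial// mxE !rmorphM; ring.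
Qed.

Let cos_moment (t : R) : \int[leb]_x (sin (t * dotrV x y) * dotG x) =
  k * t * \int[leb]_x (cos (t * dotrV x y) * G x).
Proof.
have := fourier_dotG t; rewrite !fourier_real_ray//; last exact/integrable_schwartz/schwartz_gauss.
move=> /(congr1 (@complex.Im R)).
rewrite ImM [in RHS]ImM ReM /= !(mul0r, mulr0, addr0, add0r, mul1r, subr0, sub0r).
rewrite /k => e; apply: (@mulfI _ (2 * a)); first by rewrite gt_eqF// mulr_gt0.
rewrite -[LHS]opprK; move: e; rewrite mulrN mulNr opprK => ->; field.
by rewrite gt_eqF.
Qed.

Let sin_moment (t : R) : \int[leb]_x (cos (t * dotrV x y) * dotG x) =
  - (k * t) * \int[leb]_x (sin (t * dotrV x y) * G x).
Proof.
have := fourier_dotG t; rewrite !fourier_real_ray//; last exact/integrable_schwartz/schwartz_gauss.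
move=> /(congr1 (@complex.Re R)).
rewrite ReM [in RHS]ReM ImM /= !(mul0r, mulr0, addr0, add0r, mul1r, subr0, sub0r).
rewrite /k => e; apply: (@mulfI _ (- (2 * a))); first by rewrite oppr_eq0 gt_eqF// mulr_gt0.
by rewrite e; field; rewrite gt_eqF.
Qed.

(* The product of [h] with [expR (k / 2 * t ^+ 2)] has derivative 0. *)
Let ode_solution (h : R -> R) : (forall t : R, is_derive t (1 : R) h (- (k * t) * h t)) ->
  h 1 = h 0 * expR (- (k / 2)).
Proof.
move=> dh.
have dE (t : R) : is_derive t (1 : R) (fun t => h t * expR (k / 2 * t ^+ 2)) 0.
  have de : is_derive t (1 : R) (fun t : R => expR (k / 2 * t ^+ 2))
      (expR (k / 2 * t ^+ 2) * (k * t)).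
    apply: (is_derive1_comp (f := expR) (g := fun t => k / 2 * t ^+ 2)).
    apply: is_derive_eq; rewrite /GRing.scale /= !(mulr0, add0r, mulr1, expr1, addr0).
    by rewrite -mulr_natl; field.
  have -> : (fun t => h t * expR (k / 2 * t ^+ 2)) = h * (fun t => expR (k / 2 * t ^+ 2)) by [].
  by apply: is_derive_eq; rewrite /GRing.scale /=; ring.
have : `|h 1 * expR (k / 2 * 1 ^+ 2) - h 0 * expR (k / 2 * 0 ^+ 2)| <= 0 * `|1 : R|.
  by apply: (mvt_bound dE) => t _; rewrite normr0.
rewrite mul0r normr_le0 subr_eq0 expr1n mulr1 expr0n /= mulr0 expR0 mulr1.
by move=> /eqP <-; rewrite -mulrA -expRD subrr expR0 mulr1.
Qed.

(** Along the ray through [y] both the cosine and the sine transform solve [h'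
    = - k t h], and the sine transform vanishes at 0. *)
Lemma fourier_gauss_aux : fourier (fun x => (G x)%:C) y =
  (\int[leb]_x G x * expR (- (k / 2)))%:C.
Proof.
have GS := schwartz_gauss a0.
have msin : measurable_fun setT (@sin R) by apply: continuous_measurable_fun; exact: continuous_sin.
have mcos : measurable_fun setT (@cos R) by apply: continuous_measurable_fun; exact: continuous_cos.
have sin1 (s : R) : `|sin s| <= 1 by rewrite ler_norml sin_geN1 sin_le1.
have cos1 (s : R) : `|cos s| <= 1 by rewrite ler_norml cos_geN1 cos_le1.
have dc (t : R) : is_derive t (1 : R) (fun t : R => \int[leb]_x (cos (t * dotrV x y) * G x))
    (- (k * t) * \int[leb]_x (cos (t * dotrV x y) * G x)).
  have -> : - (k * t) * \int[leb]_x (cos (t * dotrV x y) * G x) =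
      \int[leb]_x (- sin (t * dotrV x y) * (dotrV x y * G x)).
    rewrite mulNr -cos_moment -mulN1r -RintegralZl//.
      by apply: eq_Rintegral => x _; rewrite mulN1r mulNr.
    apply: (le_integrable measurableT _ _ integrable_dotG).
      apply/measurable_EFinP; apply: measurable_funM; last first.
        by apply/measurable_EFinP; exact: measurable_int integrable_dotG.
      apply: measurableT_comp => //.
      by apply: measurable_funM => //; exact: measurable_dotrV.
    by move=> x _ /=; rewrite lee_fin normrM ler_piMl.
  apply: (osc_deriv (h := cos) (h' := fun s => - sin s)) => //.
  by move=> s; rewrite normrN.
have ds (t : R) : is_derive t (1 : R) (fun t : R => \int[leb]_x (sin (t * dotrV x y) * G x))
    (- (k * t) * \int[leb]_x (sin (t * dotrV x y) * G x)).
  by rewrite -sin_moment; exact: (osc_deriv (h := sin) (h' := cos)).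
rewrite -[y in LHS]scale1r fourier_real_ray; last exact: integrable_schwartz.
congr Complex.
  rewrite (ode_solution dc).
  by congr (_ * _); apply: eq_Rintegral => x _; rewrite mul0r cos0 mul1r.
rewrite (ode_solution ds).
have -> : \int[leb]_x (sin (0 * dotrV x y) * G x) = 0.
  under eq_Rintegral do rewrite mul0r sin0 mul0r.
  by rewrite /Rintegral integral0.
by rewrite mul0r oppr0.
Qed.

End ODE.

Lemma fourier_gauss (a : R) (y : Rd) : 0 < a -> fourier (fun x : Rd => (gauss a x)%:C) y =
  ((\int[leb]_x (gauss a x)) * gauss (4 * a)^-1 y)%:C.
Proof.
move=> a0; rewrite fourier_gauss_aux//; congr (_ * expR (- _))%:C.
by field; rewrite gt_eqF.
Qed.

(** The multiplication formula, that is, Fubini. *)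
Lemma fourier_mul_formula (f g : Rd -> R[i]) : cintegrable leb setT f -> cintegrable leb setT g ->
  cintegral leb setT (fun y => fourier f y * g y) =
  cintegral leb setT (fun x => f x * fourier g x).
Proof.
move=> fi gi; have mf := cintegrable_cmeasurable fi; have mg := cintegrable_cmeasurable gi.
pose h (z : Rd * Rd) := cis (- dotrV z.2 z.1) * f z.2 * g z.1.
have mh : cmeasurable setT h.
  apply: cmeasurableM; last by apply: (cmeasurable_comp (f := g)) => //; exact: measurable_fst.
  apply: cmeasurableM; last by apply: (cmeasurable_comp (f := f)) => //; exact: measurable_snd.
  by apply: cmeasurable_cis; apply: measurableT_comp => //; exact: measurable_dotrV.
transitivity (cintegral leb setT (fun y => cintegral leb setT (fun x => h (y, x)))).
  apply: eq_cintegral => y _; rewrite mulrC -cintegralZl//; last exact: cintegrable_fourier_kernel.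
  by apply: eq_cintegral => x _; rewrite /h /= mulrC.
rewrite (cFubini (m1 := leb) (m2 := leb) mh).
  apply: eq_cintegral => x _; rewrite -cintegralZl//; last exact: cintegrable_fourier_kernel.
  by apply: eq_cintegral => y _; rewrite /h /= dotrVC; ring.
rewrite /h /=.
rewrite (eq_integral (fun y => (cabs (g y))%:E * L1norm leb f)%E); last first.
  move=> y _; rewrite /L1norm -ge0_integralZl//.
  - by apply: eq_integral => x _; rewrite -mulrA cabs_cisM cabsM mulrC EFinM.
  - exact: measurable_cabs_EFin.
  - by move=> x _; rewrite lee_fin cabs_ge0.
  - by rewrite lee_fin cabs_ge0.
rewrite ge0_integralZr//; last 3 first.
- exact: measurable_cabs_EFin.
- by move=> x _; rewrite lee_fin cabs_ge0.
- exact: L1norm_ge0.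
by rewrite -/(L1norm leb g) -(fineK (L1norm_fin fi)) -(fineK (L1norm_fin gi)) -EFinM ltry.
Qed.

End GaussianFourier.

(** * Fourier inversion *)

Section Inversion.
Context {R : realType} {d : nat}.
Local Notation Rd := 'rV[R]_d.
Local Notation leb := (@lebesgue_rV R d).
Local Notation mass := (@gauss_mass R d).

Lemma gauss_mass_gt0 : 0 < mass.
Proof. by rewrite gauss_massE exprn_gt0// sqrtr_gt0 pi_gt0. Qed.

Lemma fourier_modulated_gauss (c : R) (x0 x : Rd) : 0 < c ->
  fourier (fun y => cis (dotrV x0 y) * (gauss (c ^+ 2) y)%:C) x =
  ((c^-1) ^+ d * mass * gauss 1 ((2 * c)^-1 *: (x - x0)))%:C.
Proof.
move=> c0; have c20 : 0 < c ^+ 2 by rewrite exprn_gt0.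
rewrite -integral_gauss// gauss_scale.
have -> : ((2 * c)^-1) ^+ 2 = (4 * c ^+ 2)^-1.
  by rewrite exprVn exprMn; congr ((_ * _)^-1); ring.
rewrite -fourier_gauss//; apply: eq_cintegral => y _.
by rewrite mulrA -cisD dotrVDr dotrVNr [dotrV x0 y]dotrVC opprB addrC.
Qed.

(** Convolution with the shrinking Gaussian, after rescaling. *)
Lemma cintegral_gauss_rescale (f : Rd -> R[i]) (c : R) (x0 : Rd) : 0 < c ->
  cintegrable leb setT (fun w => f (x0 + c *: w) * (gauss 1 w)%:C) ->
  cintegral leb setT (fun x => f x * (gauss 1 (c^-1 *: (x - x0)))%:C) =
  (c ^+ d)%:C * cintegral leb setT (fun w => f (x0 + c *: w) * (gauss 1 w)%:C).
Proof.
move=> c0 fi; have ci0 : c^-1 != 0 by rewrite invr_eq0 gt_eqF.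
have [_] := cintegral_affine (- (c^-1 *: x0)) ci0 fi.
rewrite gtr0_norm ?invr_gt0// invrK => <-; apply: eq_cintegral => x _.
rewrite -scalerBr scalerA divff ?gt_eqF// scale1r.
by rewrite [x0 + _]addrC subrK.
Qed.

(** Damp the inversion integral by a Gaussian of width [(step n)^-1]. By the
    multiplication formula it becomes an average of [f] against a Gaussian of
    width proportional to [step n] centred at [x0]. The damped integral tends
    to the inversion integral as [fourier f] is integrable, and the average
    tends to [f x0]. *)
Lemma inversion_at (f : Rd -> R[i]) (C : R) (x0 : Rd) :
  cintegrable leb setT f -> cintegrable leb setT (fourier f) ->
  (forall x, cabs (f x) <= C) ->
  (forall w : Rd, cabs (f (x0 + (2 * (step n : R)) *: w) - f x0) @[n --> \oo] --> (0 : R)) ->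
  inv_fourier (fourier f) x0 = f x0.
Proof.
move=> fi ffi fC fx0.
pose dl n : R := step n.
have dl0 n : 0 < dl n by exact: step_gt0.
pose A n := cintegral leb setT
  (fun y => fourier f y * (cis (dotrV x0 y) * (gauss (dl n ^+ 2) y)%:C)).
have mcis : measurable_fun setT (fun y : Rd => dotrV x0 y) by exact: measurable_dotrV.
have A1 : cabs (A n - cintegral leb setT (fun y => cis (dotrV x0 y) * fourier f y)) @[n --> \oo]
    --> (0 : R).
  apply: (cdominated_cvg (h := fun y => cabs (fourier f y))) => //.
  - move=> n; apply: cmeasurableM; first exact: cintegrable_cmeasurable ffi.
    by apply: cschwartz_cmeasurable; apply: cschwartz_modulated_gauss; rewrite exprn_gt0.
  - apply: cmeasurableM; first exact: cmeasurable_cis.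
    exact: cintegrable_cmeasurable ffi.
  - exact: cintegrable_cabs.
  - move=> n y _; rewrite cabsM cabs_cisM cabs_real ler_piMr ?cabs_ge0//.
    by rewrite gtr0_norm ?gauss_gt0// gauss_le1// exprn_ge0// ltW.
  - move=> y _.
    apply: (@cvg_squeeze0 _ _ (fun n => dl n * (dotrV y y * cabs (fourier f y)))); last first.
      rewrite -[X in _ --> X](mul0r (dotrV y y * cabs (fourier f y))).
      by apply: cvgMl => //; exact: cvg_step.
    move=> n; apply/andP; split; first exact: cabs_ge0.
    have -> : fourier f y * (cis (dotrV x0 y) * (gauss (dl n ^+ 2) y)%:C) -
        cis (dotrV x0 y) * fourier f y =
        (gauss (dl n ^+ 2) y - 1)%:C * (cis (dotrV x0 y) * fourier f y).
      by rewrite rmorphB rmorph1; ring.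
    rewrite cabsM cabs_cisM cabs_real mulrA ler_wpM2r ?cabs_ge0//.
    have g1 : gauss (dl n ^+ 2) y <= 1 by rewrite gauss_le1// exprn_ge0// ltW.
    rewrite distrC ger0_norm ?subr_ge0//.
    have := expR_ge1Dx (- (dl n ^+ 2 * dotrV y y)); rewrite -/(gauss _ y).
    have dd : dl n ^+ 2 * dotrV y y <= dl n * dotrV y y.
      by rewrite ler_wpM2r ?dotrVv_ge0// expr2 ler_piMr ?step_le1// ltW.
    lra.
have fwi n : cintegrable leb setT (fun w => f (x0 + (2 * dl n) *: w) * (gauss 1 w)%:C).
  have [+ _] := cintegral_affine x0 (lt0r_neq0 (mulr_gt0 (ltr0Sn R 1) (dl0 n))) fi.
  rewrite (_ : (fun x => f _) = (fun w => f (x0 + (2 * dl n) *: w))); last first.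
    by apply/funext => w; rewrite addrC.
  move=> fwi; apply: (cintegrableMb (C := 1)) => //.
    by apply: cmeasurable_real; apply: schwartz_measurable; exact: schwartz_gauss.
  by move=> w _; rewrite cabs_real gtr0_norm ?gauss_gt0// gauss_le1.
have AE n : A n = (2 ^+ d * mass)%:C *
    cintegral leb setT (fun w => f (x0 + (2 * dl n) *: w) * (gauss 1 w)%:C).
  rewrite /A fourier_mul_formula//; last first.
    by apply/cschwartz_cintegrable/cschwartz_modulated_gauss; rewrite exprn_gt0.
  under eq_cintegral do rewrite fourier_modulated_gauss//.
  have e2 : (2 ^+ d * mass)%:C = ((dl n)^-1 ^+ d * mass)%:C * ((2 * dl n) ^+ d)%:C :> R[i].
    rewrite -rmorphM; congr (_%:C); rewrite mulrAC -exprMn mulrCA mulVf ?mulr1//.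
    by rewrite gt_eqF.
  rewrite e2 -mulrA -cintegral_gauss_rescale ?mulr_gt0//.
  rewrite -cintegralZl//.
    by apply: eq_cintegral => x _; rewrite rmorphM; ring.
  apply: (cintegrableMb (C := 1)) => //.
    apply: cmeasurable_real; apply: (measurableT_comp (f := gauss 1)).
      by apply: schwartz_measurable; exact: schwartz_gauss.
    by apply: measurable_scale_rV => //; exact: measurable_add_rV.
  by move=> w _; rewrite cabs_real gtr0_norm ?gauss_gt0// gauss_le1.
have gi : cintegrable leb setT (fun w => (gauss 1 w)%:C : R[i]).
  by apply/cschwartz_cintegrable/cschwartz_real/schwartz_gauss.
have A2 : cabs (A n - (2 ^+ d * mass)%:C * (f x0 * mass%:C)) @[n --> \oo] --> (0 : R).
  have -> : f x0 * mass%:C = cintegral leb setT (fun w => f x0 * (gauss 1 w)%:C).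
    rewrite cintegralZl//; congr (_ * _); rewrite /cintegral /=; congr Complex.
    by rewrite /Rintegral integral0.
  have L : cabs (cintegral leb setT (fun w => f (x0 + (2 * dl n) *: w) * (gauss 1 w)%:C) -
      cintegral leb setT (fun w => f x0 * (gauss 1 w)%:C)) @[n --> \oo] --> (0 : R).
    apply: (cdominated_cvg (h := fun w => C * gauss 1 w)) => //.
    - by move=> n; exact: cintegrable_cmeasurable (fwi n).
    - exact: (cintegrable_cmeasurable (cintegrableZl (f x0) measurableT gi)).
    - apply: (eq_integrable measurableT (fun w => (C%:E * (gauss 1 w)%:E)%E)) => //.
      by apply: integrableZl => //; apply: integrable_schwartz; exact: schwartz_gauss.
    - move=> n w _; rewrite cabsM cabs_real gtr0_norm ?gauss_gt0//.
      by rewrite ler_wpM2r// ltW// gauss_gt0.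
    - move=> w _; apply: (@cvg_squeeze0 _ _ _ _ (fx0 w)) => n.
      apply/andP; split; first exact: cabs_ge0.
      rewrite -mulrBl cabsM cabs_real ler_piMr ?cabs_ge0//.
      by rewrite gtr0_norm ?gauss_gt0// gauss_le1.
  apply: (@cvg_squeeze0 _ _ (fun n => (2 ^+ d * mass) *
    cabs (cintegral leb setT (fun w => f (x0 + (2 * dl n) *: w) * (gauss 1 w)%:C) -
      cintegral leb setT (fun w => f x0 * (gauss 1 w)%:C)))).
    move=> n; apply/andP; split; first exact: cabs_ge0.
    rewrite AE -mulrBr cabsM cabs_real gtr0_norm// mulr_gt0// ?exprn_gt0//.
    exact: gauss_mass_gt0.
  by rewrite -[X in _ --> X](mulr0 (2 ^+ d * mass)); apply: cvgMr.
rewrite /inv_fourier (cvg_cabs_unique A1 A2).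
have p0 : (2 * pi : R) ^+ d != 0 by rewrite gt_eqF// exprn_gt0// mulr_gt0// pi_gt0.
have -> : (2 ^+ d * mass)%:C * (f x0 * mass%:C) = ((2 * pi) ^+ d)%:C * f x0.
  by rewrite -gauss_mass_sqr expr2 !rmorphM; ring.
by rewrite mulrA -rmorphM mulVf// rmorph1 mul1r.
Qed.

Lemma cvg_along_steps (f : Rd -> R) (x w : Rd) (c : R) : continuous f ->
  `|f (x + (c * (step n : R)) *: w) - f x| @[n --> \oo] --> (0 : R).
Proof.
move=> cf; apply/norm_cvg0P/subr_cvg0.
have h : x + (c * (step n : R)) *: w @[n --> \oo] --> x.
  rewrite -[X in _ --> X]addr0 -(scale0r w) -(mulr0 c).
  apply: cvgD; first exact: cvg_cst.
  by apply: cvgZr_tmp; apply: cvgMr; exact: cvg_step.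
by apply: continuous_cvg => //; exact: cf.
Qed.

Lemma schwartz_inversion (f : Rd -> R[i]) x : cschwartz f -> inv_fourier (fourier f) x = f x.
Proof.
move=> fS; have [C C0 fC] := cschwartz_bounded fS.
apply: (inversion_at (C := C)) => //.
- exact: cschwartz_cintegrable.
- exact: fourier_schwartz_cintegrable.
- move=> w; have [f1 f2] := fS.
  apply: (@cvg_squeeze0 _ _ (fun n =>
    `|complex.Re (f (x + (2 * (step n : R)) *: w)) - complex.Re (f x)| +
    `|complex.Im (f (x + (2 * (step n : R)) *: w)) - complex.Im (f x)|)).
    move=> n; apply/andP; split; first exact: cabs_ge0.
    by apply: le_trans (cabs_le_ReIm _) _; rewrite ReB ImB.
  rewrite -[X in _ --> X]addr0; apply: cvgD.
    exact: (cvg_along_steps (f := fun z => complex.Re (f z)) _ _ _ (schwartz_continuous f1)).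
  exact: (cvg_along_steps (f := fun z => complex.Im (f z)) _ _ _ (schwartz_continuous f2)).
Qed.

End Inversion.

(** * Gaussian bumps separate functions *)

Section Orthants.
Context {R : realType} {d : nat}.
Local Notation Rd := 'rV[R]_d.

Definition orthant (a : Rd) : set Rd := [set x | forall i, a ord0 i < x ord0 i].

Lemma measurable_orthant a : measurable (orthant a).
Proof.
have -> : orthant a = \bigcap_(i in [set: 'I_d])
    ((fun x : Rd => x ord0 i) @^-1` `]a ord0 i, +oo[%classic).
  apply/seteqP; split => x /= h i; first by move=> _; rewrite /= in_itv /= andbT; exact: h.
  by have := h i I; rewrite /= in_itv /= andbT.
apply: fin_bigcap_measurable => // i _.
by rewrite -[X in measurable X]setTI; apply: measurable_coord_rV => //; exact: measurable_itv.
Qed.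

Lemma orthant_setI_closed : setI_closed (range orthant).
Proof.
move=> _ _ [a _ <-] [b _ <-]; exists (\row_i Num.max (a ord0 i) (b ord0 i)) => //.
apply/seteqP; split => x /= h.
  split => i; have := h i; rewrite mxE gt_max => /andP[]//.
by move=> i; rewrite mxE gt_max h.1 h.2.
Qed.

(** Orthants are stable under intersection and generate the Borel sets: a
    coordinate half-space is the increasing union of the orthants whose other
    corners are [- n]. *)
Lemma measurable_rV_orthants : @measurable _ Rd = <<s range orthant >>.
Proof.
apply/seteqP; split; last first.
  apply: smallest_sub; first exact: sigma_algebra_measurable.
  by move=> _ [a _ <-]; exact: measurable_orthant.
pose X := g_sigma_algebraType (range orthant).
have mid : measurable_fun [set: X] (fun x : X => x : Rd).
  apply: measurable_fun_rVP => i.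
  apply: (measurability _ (RGenOInfty.measurableE R)) => _ [_ [b ->] <-]; rewrite setTI.
  have -> : (fun x : X => (x : Rd) ord0 i) @^-1` `]b, +oo[%classic =
      \bigcup_n (orthant (\row_j if j == i then b else - n%:R) : set X).
    apply/seteqP; split => x /=; rewrite in_itv /= andbT.
      move=> bx; have [n hn] : exists n : nat, forall j, - x ord0 j < n%:R.
        exists (Num.bound (\sum_k `|(x : Rd) ord0 k|)) => j.
        apply: le_lt_trans (archi_boundP _); last exact: sumr_ge0.
        rewrite (bigD1 j)//= ler_wpDr ?sumr_ge0//.
        by rewrite (le_trans (ler_norm _))// normrN.
      exists n => // j; rewrite mxE; case: eqP => [->//|_]; rewrite ltrNl; exact: hn.
    by move=> [n _ /(_ i)]; rewrite mxE eqxx.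
  apply: bigcupT_measurable => n; apply: sub_sigma_algebra.
  by exists (\row_j if j == i then b else - n%:R).
move=> A mA; have := mid measurableT A mA; rewrite setTI.
exact.
Qed.

End Orthants.

Section GaussTests.
Context {R : realType} {d : nat}.
Local Notation Rd := 'rV[R]_d.
Local Notation leb := (@lebesgue_rV R d).
Local Notation mass := (@gauss_mass R d).

Lemma gaussN a (x : Rd) : gauss a (- x) = gauss a x.
Proof. by rewrite /gauss dotrVNl dotrVNr opprK. Qed.

Lemma continuous_gauss a : continuous (@gauss R d a).
Proof. by move=> x; apply: differentiable_continuous; exact: differentiable_gauss. Qed.

Lemma measurable_gauss a : measurable_fun setT (@gauss R d a).
Proof. by apply: continuous_measurable_rV; exact: continuous_gauss. Qed.

(** With [v] a scaled-down copy of [w], this dominates an average of a function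
    below [gauss 1] by one fixed Gaussian in [x], uniformly in the scale. *)
Lemma gauss_product_le (x v : Rd) (w : Rd) : dotrV v v <= dotrV w w ->
  gauss 1 (x + v) * gauss 1 w <= gauss (1 / 4) x * gauss (1 / 2) w.
Proof.
move=> vw; rewrite /gauss -!expRD ler_expR.
have xv : dotrV (x + v) (x + v) = dotrV x x + 2 * dotrV x v + dotrV v v.
  by rewrite dotrVDl !dotrVDr [dotrV v x]dotrVC; ring.
have v0 := dotrVv_ge0 v.
(* Completing the square in [x]. *)
have := dotrVv_ge0 (3 *: x + 4 *: v : Rd).
rewrite xv [dotrV (3 *: x + _) _]dotrVDl !dotrVDr !dotrVZl !dotrVZr [dotrV v x]dotrVC; lra.
Qed.

Lemma gauss_kernel_le (c : R) (x x0 : Rd) : 0 < c <= 1 ->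
  gauss 1 x0 * gauss 1 (c^-1 *: (x - x0)) <= gauss (1 / 4) x * gauss (1 / 2) x0.
Proof.
move=> /andP[c0 c1].
apply: (@le_trans _ _ (gauss 1 (x - x0) * gauss 1 x0)); last first.
  by apply: gauss_product_le; rewrite dotrVNl dotrVNr opprK.
rewrite mulrC ler_wpM2r ?(ltW (gauss_gt0 _ _))// gauss_scale /gauss ler_expR lerN2 mul1r.
by rewrite ler_peMl ?dotrVv_ge0// exprn_ege1// invf_ge1.
Qed.

Section Tests.
Variable h : Rd -> R[i].
Hypothesis mh : cmeasurable setT h.
Hypothesis hi : forall a, 0 < a -> cintegrable leb setT (fun x => h x * (gauss a x)%:C).
Hypothesis h0 : forall (c : R) (x0 : Rd), 0 < c ->
  cintegral leb setT (fun x => h x * (gauss 1 (c^-1 *: (x - x0)))%:C) = 0.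

(** [M n x] averages [chi] around [x] at scale [step n]. Up to a factor it is a
    superposition of the Gaussian bumps in [h0], hence orthogonal to [h] by
    Fubini; it tends to a multiple of [chi] and is dominated by a fixed
    Gaussian, against which [h] is integrable. *)
Lemma gauss_tests_continuous (chi : Rd -> R) : continuous chi ->
  (forall x, 0 <= chi x <= gauss 1 x) -> cintegral leb setT (fun x => h x * (chi x)%:C) = 0.
Proof.
move=> cchi chib.
have mchi : measurable_fun setT chi by exact: continuous_measurable_rV.
have c0 n : 0 < step n :> R by exact: step_gt0.
have chi1 x : `|chi x| <= 1.
  by have /andP[a b] := chib x; rewrite ger0_norm// (le_trans b)// gauss_le1.
pose M n x : R[i] := cintegral leb setT (fun w => (chi (x + (step n : R) *: w))%:C * (gauss 1 w)%:C).
have mshift n : measurable_fun setT (fun z : Rd * Rd => chi (z.1 + (step n : R) *: z.2)).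
  apply: (measurableT_comp mchi); apply: measurable_add_rV; first exact: measurable_fst.
  by apply: measurable_scale_rV => //; exact: measurable_snd.
have mshift1 n x : measurable_fun setT (fun w : Rd => chi (x + (step n : R) *: w)).
  by apply: (measurableT_comp mchi); apply: measurable_add_rV => //; exact: measurable_scale_rV.
have mM n : cmeasurable setT (M n).
  apply: (cmeasurable_cintegral leb
    (f := fun z : Rd * Rd => (chi (z.1 + (step n : R) *: z.2))%:C * (gauss 1 z.2)%:C)).
  apply: cmeasurableM; apply: cmeasurable_real => //.
  by apply: (measurableT_comp (measurable_gauss 1)); exact: measurable_snd.
have gi a : 0 < a -> leb.-integrable setT (EFin \o gauss a).
  by move=> a0; apply: integrable_schwartz; exact: schwartz_gauss.
have innerb n (x w : Rd) :
    cabs ((chi (x + (step n : R) *: w))%:C * (gauss 1 w)%:C) <= gauss (1 / 4) x * gauss (1 / 2) w.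
  rewrite cabsM !cabs_real (gtr0_norm (gauss_gt0 _ _)).
  have /andP[a b] := chib (x + (step n : R) *: w); rewrite (ger0_norm a).
  apply: (@le_trans _ _ (gauss 1 (x + (step n : R) *: w) * gauss 1 w)).
    by rewrite ler_wpM2r// ltW// gauss_gt0.
  apply: gauss_product_le; rewrite dotrVZl dotrVZr mulrA ler_piMl ?dotrVv_ge0//.
  by rewrite -expr2 expr_le1 ?step_le1// ltW.
have inneri n x : cintegrable leb setT
    (fun w => (chi (x + (step n : R) *: w))%:C * (gauss 1 w)%:C).
  apply: (le_cintegrable (h := fun w => gauss (1 / 4) x * gauss (1 / 2) w)) => //.
    by apply: cmeasurableM; apply: cmeasurable_real => //; exact: measurable_gauss.
  apply: (eq_integrable measurableT (fun w => ((gauss (1 / 4) x)%:E * (gauss (1 / 2) w)%:E)%E)) => //.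
  by apply: integrableZl => //; apply: gi.
pose K := \int[leb]_w gauss (1 / 2) w.
have KE : (\int[leb]_w (gauss (1 / 2) w)%:E = K%:E)%E.
  by rewrite /K /Rintegral fineK// integrable_fin_num//; apply: gi.
have Mb n x : cabs (M n x) <= gauss (1 / 4) x * K.
  apply: cabs_cintegral_leR => //.
  rewrite EFinM -KE -ge0_integralZl//.
  - apply: ge0_le_integral_nm => w; first by rewrite lee_fin cabs_ge0.
    by rewrite -EFinM lee_fin.
  - by apply/measurable_EFinP; exact: measurable_gauss.
  - by move=> w _; rewrite lee_fin ltW// gauss_gt0.
  - by rewrite lee_fin ltW// gauss_gt0.
(* [M n] is a superposition of the tests in [h0]. *)
have zero n : cintegral leb setT (fun x => h x * M n x) = 0.
  pose c : R := step n.
  pose F (z : Rd * Rd) := (chi z.1)%:C * (h z.2 * (gauss 1 (c^-1 *: (z.2 - z.1)))%:C).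
  have mF : cmeasurable setT F.
    apply: cmeasurableM.
      by apply: cmeasurable_real; apply: (measurableT_comp mchi); exact: measurable_fst.
    apply: cmeasurableM; first by apply: (cmeasurable_comp (f := h)) => //; exact: measurable_snd.
    apply: cmeasurable_real; apply: (measurableT_comp (measurable_gauss 1)).
    apply: measurable_scale_rV => //; apply: measurable_sub_rV.
      exact: measurable_snd.
    exact: measurable_fst.
  have FB (x0 x : Rd) : cabs (F (x0, x)) <= gauss (1 / 2) x0 * cabs (h x * (gauss (1 / 4) x)%:C).
    rewrite /F /= !cabsM !cabs_real mulrCA [leRHS]mulrCA ler_wpM2l ?cabs_ge0//.
    have /andP[a b] := chib x0.
    rewrite (ger0_norm a) !(gtr0_norm (gauss_gt0 _ _)) [leRHS]mulrC.
    apply: (@le_trans _ _ (gauss 1 x0 * gauss 1 (c^-1 *: (x - x0)))).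
      by rewrite ler_wpM2r// ltW// gauss_gt0.
    by apply: gauss_kernel_le; rewrite c0 step_le1.
  have q : 0 < 1 / 4 :> R by lra.
  have H1 := L1norm_fin (hi q).
  have Ffin : (\int[leb]_x0 \int[leb]_x (cabs (F (x0, x)))%:E < +oo)%E.
    apply: (@le_lt_trans _ _ (K%:E * L1norm leb (fun x => h x * (gauss (1 / 4) x)%:C)%R)%E); last first.
      by rewrite -(fineK H1) -EFinM ltry.
    rewrite -KE -ge0_integralZr//; last 3 first.
    - by apply/measurable_EFinP; exact: measurable_gauss.
    - by move=> w _; rewrite lee_fin ltW// gauss_gt0.
    - exact: L1norm_ge0.
    apply: ge0_le_integral_nm => x0.
      by apply: integral_ge0 => x _; rewrite lee_fin cabs_ge0.
    rewrite /L1norm -ge0_integralZl//.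
    - apply: ge0_le_integral_nm => x; first by rewrite lee_fin cabs_ge0.
      by rewrite -EFinM lee_fin.
    - by apply: measurable_cabs_EFin; exact: cintegrable_cmeasurable (hi q).
    - by move=> x _; rewrite lee_fin cabs_ge0.
    - by rewrite lee_fin ltW// gauss_gt0.
  have := cFubini (m1 := leb) (m2 := leb) mF Ffin.
  rewrite [X in X = _ -> _](_ : _ = 0); last first.
    rewrite -[RHS](cintegral0 leb setT); apply: eq_cintegral => x0 _.
    rewrite -[RHS](mulr0 (chi x0)%:C) -(h0 x0 (c0 n)) -cintegralZl//.
    apply: (le_cintegrable (h := fun x => (gauss (1 / 2) x0 / gauss 1 x0) *
        cabs (h x * (gauss (1 / 4) x)%:C))) => //.
    - apply: cmeasurableM => //; apply: cmeasurable_real; apply: (measurableT_comp (measurable_gauss 1)).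
      by apply: measurable_scale_rV => //; exact: measurable_sub_rV.
    - apply: (eq_integrable measurableT (fun x => (gauss (1 / 2) x0 / gauss 1 x0)%:E *
        (cabs (h x * (gauss (1 / 4) x)%:C))%:E)%E) => //.
      by apply: integrableZl => //; apply: cintegrable_cabs => //; exact: hi.
    - move=> x _; rewrite !cabsM !cabs_real !(gtr0_norm (gauss_gt0 _ _)) mulrCA ler_wpM2l ?cabs_ge0//.
      rewrite mulrAC ler_pdivlMr ?gauss_gt0// mulrC [leRHS]mulrC.
      by apply: gauss_kernel_le; rewrite c0 step_le1.
  have cp : 0 < c by exact: c0.
  move=> /esym; rewrite [X in X = _ -> _](_ : _ =
      cintegral leb setT (fun x => (c ^+ d)%:C * (h x * M n x))); last first.
    apply: eq_cintegral => x _; rewrite mulrCA /M -(cintegral_gauss_rescale (f := fun z => (chi z)%:C))//; last exact: inneri.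
    rewrite -(cintegralZl (h x)); [|by []|].
      by apply: eq_cintegral => x0 _; rewrite /F /= -(gaussN _ (_ *: _)) -scalerN opprB; ring.
    apply: (le_cintegrable (h := fun x0 => gauss 1 x0)) => //.
    - apply: cmeasurableM; first exact: cmeasurable_real.
      apply: cmeasurable_real; apply: (measurableT_comp (measurable_gauss 1)).
      by apply: measurable_scale_rV => //; exact: measurable_sub_rV.
    - exact: gi.
    - move=> x0 _; rewrite cabsM !cabs_real (gtr0_norm (gauss_gt0 _ _)).
      have /andP[a b] := chib x0; rewrite (ger0_norm a).
      by rewrite -[leRHS]mulr1 ler_pM// ?gauss_le1// ltW// gauss_gt0.
  rewrite (@cintegralZl _ _ _ leb setT (fun x => h x * M n x) (c ^+ d)%:C)//; last first.
    apply: (le_cintegrable (h := fun x => K * cabs (h x * (gauss (1 / 4) x)%:C))) => //.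
    - exact: cmeasurableM.
    - apply: (eq_integrable measurableT (fun x => K%:E * (cabs (h x * (gauss (1 / 4) x)%:C))%:E)%E) => //.
      by apply: integrableZl => //; apply: cintegrable_cabs => //; exact: hi.
    - move=> x _; rewrite !cabsM cabs_real (gtr0_norm (gauss_gt0 _ _)) mulrCA ler_wpM2l ?cabs_ge0//.
      by rewrite mulrC.
  move=> /eqP; rewrite mulf_eq0 => /orP[|/eqP//].
  by move=> /eqP/(congr1 (@complex.Re R)) /= /eqP; rewrite expf_eq0 (gt_eqF (c0 n)) andbF.
have Mcvg x : cabs (M n x - (chi x)%:C * mass%:C) @[n --> \oo] --> (0 : R).
  have -> : (chi x)%:C * mass%:C = cintegral leb setT (fun w => (chi x)%:C * (gauss 1 w)%:C).
    rewrite cintegralZl//; last by apply: cintegrable_real; exact: gi.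
    by congr (_ * _); rewrite /cintegral /=; congr Complex; rewrite /Rintegral integral0.
  apply: (cdominated_cvg (h := gauss 1)) => //.
  - by move=> n; exact: cintegrable_cmeasurable (inneri n x).
  - by apply: cmeasurableM; apply: cmeasurable_real => //; exact: measurable_gauss.
  - exact: gi.
  - move=> n w _; rewrite cabsM !cabs_real (gtr0_norm (gauss_gt0 _ _)) ler_piMl//.
    by rewrite ltW// gauss_gt0.
  - move=> w _; have := cvg_along_steps x w 1 cchi; apply: cvg_squeeze0 => n.
    apply/andP; split; first exact: cabs_ge0.
    rewrite -mulrBl -rmorphB cabsM !cabs_real (gtr0_norm (gauss_gt0 _ _)) mul1r ler_piMr//.
    exact: gauss_le1.
have q : 0 < 1 / 4 :> R by lra.
have C1 : cabs (cintegral leb setT (fun x => h x * M n x) -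
    cintegral leb setT (fun x => h x * ((chi x)%:C * mass%:C))) @[n --> \oo] --> (0 : R).
  apply: (cdominated_cvg (h := fun x => K * cabs (h x * (gauss (1 / 4) x)%:C))) => //.
  - by move=> n; exact: cmeasurableM.
  - apply: cmeasurableM => //; apply: cmeasurableM; first exact: cmeasurable_real.
    exact: cmeasurable_cst.
  - apply: (eq_integrable measurableT (fun x => K%:E * (cabs (h x * (gauss (1 / 4) x)%:C))%:E)%E) => //.
    by apply: integrableZl => //; apply: cintegrable_cabs => //; exact: hi.
  - move=> n x _; rewrite !cabsM cabs_real (gtr0_norm (gauss_gt0 _ _)) mulrCA ler_wpM2l ?cabs_ge0//.
    by rewrite mulrC.
  - move=> x _; apply: (@cvg_squeeze0 _ _ (fun n => cabs (h x) * cabs (M n x - (chi x)%:C * mass%:C))).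
      by move=> n; apply/andP; split; [exact: cabs_ge0|rewrite -mulrBr cabsM].
    by rewrite -[X in _ --> X](mulr0 (cabs (h x))); apply: cvgMr; exact: Mcvg.
have C2 : cabs (cintegral leb setT (fun x => h x * M n x) - 0) @[n --> \oo] --> (0 : R).
  rewrite (_ : (fun n => _) = (fun=> 0)); first exact: cvg_cst.
  by apply/funext => n; rewrite zero subrr cabs0.
have := cvg_cabs_unique C1 C2.
rewrite (eq_cintegral leb (g := fun x => mass%:C * (h x * (chi x)%:C))); last by move=> x _; ring.
rewrite cintegralZl//; last first.
  apply: (le_cintegrable (h := fun x => cabs (h x * (gauss 1 x)%:C))) => //.
  - by apply: cmeasurableM => //; exact: cmeasurable_real.
  - by apply: cintegrable_cabs => //; exact: hi.
  - move=> x _; rewrite !cabsM !cabs_real ler_wpM2l ?cabs_ge0//.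
    by have /andP[a b] := chib x; rewrite !ger0_norm// ltW// gauss_gt0.
move=> /eqP; rewrite mulf_eq0 => /orP[|/eqP//].
by move=> /eqP/(congr1 (@complex.Re R)) /= /eqP; rewrite gt_eqF// gauss_mass_gt0.
Qed.

Let clamp (t : R) : R := (`|t| - `|t - 1| + 1) / 2.

Let clamp_le0 t : t <= 0 -> clamp t = 0.
Proof. by move=> t0; rewrite /clamp !ler0_norm//; lra. Qed.

Let clamp_ge1 t : 1 <= t -> clamp t = 1.
Proof. by move=> t1; rewrite /clamp !ger0_norm//; lra. Qed.

Let clamp01 t : 0 <= clamp t <= 1.
Proof.
have [t0|t0] := leP t 0; first by rewrite clamp_le0// lexx ler01.
have [t1|t1] := leP 1 t; first by rewrite clamp_ge1// lexx ler01.
by rewrite /clamp gtr0_norm// ltr0_norm ?subr_lt0//; apply/andP; split; lra.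
Qed.

Let clamp_continuous : continuous clamp.
Proof.
move=> t; apply: cvgM; last exact: cvg_cst.
apply: cvgD; last exact: cvg_cst.
apply: cvgB; first exact: norm_continuous.
apply: (continuous_comp (f := fun t : R => t - 1)); last exact: norm_continuous.
by apply: cvgB; [exact: cvg_id|exact: cvg_cst].
Qed.

Let bump (a : Rd) (k : nat) (x : Rd) : R :=
  gauss 1 x * \prod_(i < d) clamp (k%:R * (x ord0 i - a ord0 i)).

Let bump_continuous a k : continuous (bump a k).
Proof.
move=> x; apply: (continuousM (s := gauss 1)); first exact: continuous_gauss.
have H (r : seq 'I_d) : continuous (fun x : Rd => \prod_(i <- r) clamp (k%:R * (x ord0 i - a ord0 i))).
  elim: r => [|i r IH].
    rewrite (_ : (fun x => _) = cst 1); first by move=> ?; exact: cst_continuous.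
    by apply/funext => z; rewrite big_nil.
  rewrite (_ : (fun x => _) = (fun x : Rd => clamp (k%:R * (x ord0 i - a ord0 i))) \*
      (fun x : Rd => \prod_(i <- r) clamp (k%:R * (x ord0 i - a ord0 i)))); last first.
    by apply/funext => z; rewrite big_cons.
  move=> z; apply: continuousM; last exact: IH.
  apply: (continuous_comp (f := fun x : Rd => k%:R * (x ord0 i - a ord0 i))); last first.
    exact: clamp_continuous.
  apply: (continuousM (s := cst (k%:R : R))); first exact: cst_continuous.
  apply: (continuousB (f := fun x : Rd => x ord0 i)); first exact: coord_continuous.
  exact: cst_continuous.
exact: H.
Qed.

Let bump_bounds a k x : 0 <= bump a k x <= gauss 1 x.
Proof.
have p0 : 0 <= \prod_(i < d) clamp (k%:R * (x ord0 i - a ord0 i)).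
  by apply: prodr_ge0 => i _; case/andP: (clamp01 (k%:R * (x ord0 i - a ord0 i))).
rewrite mulr_ge0//=; last by rewrite ltW// gauss_gt0.
by rewrite ler_piMr// ?(ltW (gauss_gt0 _ _))//; apply: prodr_ile1 => i _; exact: clamp01.
Qed.

Let bump_cvg a x :
  `|bump a k x - (x \in orthant a)%:R * gauss 1 x| @[k --> \oo] --> (0 : R).
Proof.
have [xa|xa] := pselect (orthant a x); last first.
  rewrite memNset// mul0r (_ : (fun k => _) = (fun=> 0)); first exact: cvg_cst.
  apply/funext => k; rewrite subr0 /bump.
  have [i xi] : exists i, x ord0 i <= a ord0 i.
    by have /existsNP[i /negP] := xa; rewrite -leNgt; exists i.
  by rewrite (bigD1 i)//= clamp_le0 ?mul0r ?mulr0 ?normr0// mulr_ge0_le0// subr_le0.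
rewrite mem_set// mul1r.
pose K := (\sum_(i < d) Num.bound (x ord0 i - a ord0 i)^-1)%N.
apply: cvg_near_cst; exists K => // k /= Kk.
rewrite /bump big1 ?mulr1 ?subrr ?normr0// => i _; apply: clamp_ge1.
have pi : 0 < x ord0 i - a ord0 i by rewrite subr_gt0; exact: xa.
rewrite -ler_pdivrMr// mul1r (le_trans (ltW (archi_boundP _)))//; first by rewrite invr_ge0 ltW.
rewrite ler_nat (leq_trans _ Kk)// /K (bigD1 i)//= leq_addr//.
Qed.

(** The indicator of an open orthant is a pointwise limit of continuous
    functions, products of one-variable clamps. *)
Lemma gauss_tests_orthant a :
  cintegral leb setT (fun x => h x * ((x \in orthant a)%:R * gauss 1 x)%:C) = 0.
Proof.
have mE : measurable_fun setT (@gauss R d 1) by exact: measurable_gauss.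
have m1 : measurable_fun setT (fun x : Rd => (x \in orthant a)%:R : R).
  have -> : (fun x : Rd => (x \in orthant a)%:R) = \1_(orthant a) :> (Rd -> R).
    by apply/funext => x; rewrite indicE.
  by apply: measurable_indic; exact: measurable_orthant.
have gE x : `|gauss 1 x| = gauss 1 x :> R by rewrite gtr0_norm ?gauss_gt0.
apply: (cvg_cabs_unique (a := fun k => cintegral leb setT (fun x => h x * (bump a k x)%:C))); last first.
  rewrite (_ : (fun n => _) = (fun=> 0)); first exact: cvg_cst.
  by apply/funext => n; rewrite gauss_tests_continuous// subrr cabs0.
apply: (cdominated_cvg (h := fun x => cabs (h x * (gauss 1 x)%:C))) => //.
- move=> k; apply: cmeasurableM => //; apply: cmeasurable_real.
  by apply: continuous_measurable_rV; exact: bump_continuous.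
- by apply: cmeasurableM => //; apply: cmeasurable_real; exact: measurable_funM.
- by apply: cintegrable_cabs => //; exact: hi.
- move=> k x _; rewrite !cabsM !cabs_real ler_wpM2l ?cabs_ge0// gE.
  by have /andP[b1 b2] := bump_bounds a k x; rewrite ger0_norm.
- move=> x _; apply: (@cvg_squeeze0 _ _ (fun k => cabs (h x) *
      `|bump a k x - (x \in orthant a)%:R * gauss 1 x|)).
    by move=> k; apply/andP; split; [exact: cabs_ge0|rewrite -mulrBr -rmorphB cabsM cabs_real].
  by rewrite -[X in _ --> X](mulr0 (cabs (h x))); apply: cvgMr; exact: bump_cvg.
Qed.

Let dynkin (f : Rd -> R) : leb.-integrable setT (EFin \o f) -> \int[leb]_x f x = 0 ->
  (forall a, \int[leb]_x ((x \in orthant a)%:R * f x) = 0) ->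
  {ae leb, forall x, f x = 0}.
Proof.
move=> fi fT fa.
have fin A : measurable A -> (\int[leb]_(x in A) (f x)%:E)%E \is a fin_num.
  by move=> mA; apply: integrable_fin_num => //; exact: integrableS fi.
have P A : measurable A -> (\int[leb]_(x in A) (f x)%:E = 0)%E.
  rewrite measurable_rV_orthants => mA.
  apply: (dynkin_induction (P := fun A => (\int[leb]_(x in A) (f x)%:E = 0)%E) measurable_rV_orthants) mA.
  - exact: orthant_setI_closed.
  - by rewrite -(fineK (fin _ measurableT)) -[fine _]/(\int[leb]_x f x) fT.
  - move=> _ [a _ <-]; have mo := measurable_orthant a.
    rewrite -(fineK (fin _ mo)) -[fine _]/(\int[leb]_(x in orthant a) f x).
    rewrite Rintegral_mkcond.
    transitivity (\int[leb]_x ((x \in orthant a)%:R * f x))%:E; last by rewrite fa.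
    congr EFin; apply: eq_Rintegral => x _.
    by rewrite patchE; case: ifP => _; rewrite ?mul1r ?mul0r.
  - move=> S mS S0.
    have := @integral_setU_EFin _ _ _ leb S (~` S) f mS (measurableC mS).
    rewrite setUv S0 add0e => <-//.
    + by rewrite -(fineK (fin _ measurableT)) -[fine _]/(\int[leb]_x f x) fT.
    + by apply/measurable_EFinP; exact: measurable_int fi.
    + by apply/disj_setPCl.
  - move=> F mF tF F0; rewrite integral_bigcup//.
      by apply: eseries0 => i _ _; exact: F0.
    by apply: integrableS fi => //; exact: bigcupT_measurable.
have := integral_ae_eq measurableT (g := cst 0%E) fi (measurable_cst _).
move=> H; have {H} : ae_eq leb setT (EFin \o f) (cst 0%E).
  by apply: H => A _ mA; rewrite integral0 P.
by apply: filterS => x /(_ I) /= [].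
Qed.

(** The signed density [h * gauss 1] has integral 0 over every orthant, hence
    over every Borel set. *)
Lemma gauss_tests_ae0 : {ae leb, forall x, h x = 0}.
Proof.
have hE := hi ltr01; have [hE1 hE2] := hE.
have h1 : cintegral leb setT (fun x => h x * (gauss 1 x)%:C) = 0.
  apply: gauss_tests_continuous => [|x]; first exact: continuous_gauss.
  by rewrite lexx ltW// gauss_gt0.
have ho a (p : R[i] -> R) : (forall z (r : R), p (z * r%:C) = p z * r) ->
    forall x, p (h x * ((x \in orthant a)%:R * gauss 1 x)%:C) =
      (x \in orthant a)%:R * p (h x * (gauss 1 x)%:C).
  by move=> pM x; rewrite !pM mulrCA.
have pRe z (r : R) : complex.Re (z * r%:C) = complex.Re z * r by rewrite ReM /= mulr0 subr0.
have pIm z (r : R) : complex.Im (z * r%:C) = complex.Im z * r by rewrite ImM /= mulr0 add0r.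
have aRe : {ae leb, forall x, complex.Re (h x * (gauss 1 x)%:C) = 0}.
  apply: dynkin => //; first by have [] := h1.
  move=> a; have [<- _] := gauss_tests_orthant a.
  by apply: eq_Rintegral => x _; rewrite (ho a _ pRe).
have aIm : {ae leb, forall x, complex.Im (h x * (gauss 1 x)%:C) = 0}.
  apply: dynkin => //; first by have [] := h1.
  move=> a; have [_ <-] := gauss_tests_orthant a.
  by apply: eq_Rintegral => x _; rewrite (ho a _ pIm).
apply: filterS2 aRe aIm => x; rewrite pRe pIm => /eqP.
rewrite mulf_eq0 (gt_eqF (gauss_gt0 _ _)) orbF => /eqP r0 /eqP.
rewrite mulf_eq0 (gt_eqF (gauss_gt0 _ _)) orbF => /eqP i0.
by move: r0 i0; case: (h x) => u v /= -> ->.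
Qed.

End Tests.

End GaussTests.

(** * The Wiener algebra *)

Section Wiener.
Context {R : realType} {d : nat}.
Local Notation Rd := 'rV[R]_d.
Local Notation leb := (@lebesgue_rV R d).
Local Notation kappa := (@kappa R d).
Implicit Types (f g u : Rd -> R[i]).

Lemma inv_fourierE g x : inv_fourier g x = kappa%:C * fourier g (- x).
Proof.
rewrite /inv_fourier /fourier -/kappa; congr (_ * _); apply: eq_cintegral => y _.
by rewrite dotrVNr opprK dotrVC.
Qed.

Lemma cintegral_reflect f : cintegrable leb setT f ->
  cintegrable leb setT (fun x => f (- x)) /\
  cintegral leb setT (fun x => f (- x)) = cintegral leb setT f.
Proof.
have n1 : (-1 : R) != 0 by rewrite oppr_eq0 oner_eq0.
move=> fi; have := cintegral_affine 0 n1 fi.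
have -> : (fun x => f (-1 *: x + 0)) = (fun x => f (- x)).
  by apply/funext => x; rewrite addr0 scaleN1r.
by rewrite normrN1 invr1 expr1n mul1r.
Qed.

Lemma L1norm_reflect f : cmeasurable setT f -> L1norm leb (fun x => f (- x)) = L1norm leb f.
Proof.
have n1 : (-1 : R) != 0 by rewrite oppr_eq0 oner_eq0.
move=> mf; have := L1norm_affine 0 n1 mf.
have -> : (fun x => f (-1 *: x + 0)) = (fun x => f (- x)).
  by apply/funext => x; rewrite addr0 scaleN1r.
by rewrite normrN1 invr1 expr1n mul1e.
Qed.

Lemma inv_fourier_bounded g : cintegrable leb setT g ->
  exists2 C, 0 <= C & forall x, cabs (inv_fourier g x) <= C.
Proof.
move=> gi; exists (kappa * fine (L1norm leb g)) => [|x].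
  by rewrite mulr_ge0 ?kappa_ge0// fine_ge0// L1norm_ge0.
by apply: cabs_inv_fourier_le => //; rewrite fineK// L1norm_fin.
Qed.

Lemma cintegrable_mul_inv_fourier f g : cintegrable leb setT f -> cintegrable leb setT g ->
  cintegrable leb setT (fun x => f x * inv_fourier g x).
Proof.
move=> fi gi; have [C C0 h] := inv_fourier_bounded gi.
apply: (cintegrableMb (C := C)) => //.
by apply: cmeasurable_inv_fourier; exact: cintegrable_cmeasurable gi.
Qed.

(** The inversion formula for the test function, followed by the multiplication
    formula. *)
Lemma inv_fourier_duality g phi : cintegrable leb setT g -> cschwartz phi ->
  cintegral leb setT (fun y => g y * phi y) =
  cintegral leb setT (fun x => inv_fourier g x * fourier phi x).
Proof.
move=> gi phiS; have pi := fourier_schwartz_cintegrable phiS.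
have [pri _] := cintegral_reflect pi.
transitivity (kappa%:C * cintegral leb setT (fun x => fourier g x * fourier phi (- x))); last first.
  have i1 : cintegrable leb setT (fun x => fourier g x * fourier phi (- x)).
    under eq_fun do rewrite mulrC.
    apply: (cintegrableMb (C := fine (L1norm leb g))) => //.
      by apply: cmeasurable_fourier; exact: cintegrable_cmeasurable gi.
    by move=> x _; apply: cabs_fourier_le => //; rewrite fineK// L1norm_fin.
  have [i2 <-] := cintegral_reflect i1.
  rewrite -cintegralZl//; apply: eq_cintegral => x _.
  by rewrite inv_fourierE opprK mulrA.
rewrite fourier_mul_formula// -cintegralZl//; last first.
  apply: (cintegrableMb (C := fine (L1norm leb (fun x => fourier phi (- x))))) => //.
    by apply: cmeasurable_fourier; exact: cintegrable_cmeasurable pri.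
  by move=> x _; apply: cabs_fourier_le => //; rewrite fineK// L1norm_fin.
apply: eq_cintegral => y _; rewrite mulrCA; congr (_ * _).
have [_ e] := cintegral_reflect (cintegrable_fourier_kernel (- y) pi).
have E : fourier (fourier phi) (- y) = fourier (fun x => fourier phi (- x)) y.
  rewrite [LHS](esym e); apply: eq_cintegral => x _.
  by rewrite dotrVNr dotrVNl opprK.
by rewrite -[LHS](schwartz_inversion y phiS) inv_fourierE E.
Qed.

Lemma wiener_is_fourier g : cintegrable leb setT g -> is_fourier (inv_fourier g) g.
Proof.
move=> gi; have mg := cintegrable_cmeasurable gi; split; last first.
- by move=> phi phiS; exact: inv_fourier_duality.
- split => // phi phiS; have [C C0 hC] := cschwartz_bounded phiS.
  by apply: (cintegrableMb (C := C)) => //; exact: cschwartz_cmeasurable.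
- split; first exact: cmeasurable_inv_fourier.
  move=> phi phiS; under eq_fun do rewrite mulrC.
  by apply: cintegrable_mul_inv_fourier => //; exact: cschwartz_cintegrable.
Qed.

(** A translated Gaussian is below a multiple of a wider centred one, against
    which tempered functions are integrable by definition. *)
Lemma gauss_translate_le (c : R) (x0 x : Rd) : 0 < c ->
  gauss 1 (c^-1 *: (x - x0)) <=
  expR ((c^-1) ^+ 2 * dotrV x0 x0) * gauss ((c^-1) ^+ 2 / 2) x.
Proof.
move=> c0; rewrite gauss_scale /gauss -expRD ler_expR.
have := dotrVv_ge0 (x - 2 *: x0).
rewrite !dotrVDl !dotrVDr !dotrVNl !dotrVNr !dotrVZl !dotrVZr [dotrV x0 x]dotrVC => h.
have : 0 <= c^-1 ^+ 2 by rewrite exprn_ge0// invr_ge0 ltW.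
set k := c^-1 ^+ 2 => k0; nra.
Qed.

(** The Fourier transforms of modulated Gaussians are the Gaussian bumps of
    every centre and width. Tested with them, [u] and [inv_fourier g] agree by
    duality, and [gauss_tests_ae0] concludes. *)
Lemma is_fourier_ae u g : is_fourier u g -> cintegrable leb setT g ->
  {ae leb, forall x, u x = inv_fourier g x}.
Proof.
move=> [[mu_ ui] _ dual] gi.
have mg := cintegrable_cmeasurable gi.
have mw := cmeasurable_inv_fourier mg.
have gS a : 0 < a -> cschwartz (fun x : Rd => (gauss a x)%:C : R[i]).
  by move=> a0; apply: cschwartz_real; exact: schwartz_gauss.
have wi a : 0 < a -> cintegrable leb setT (fun x => inv_fourier g x * (gauss a x)%:C).
  move=> a0; under eq_fun do rewrite mulrC.
  by apply: cintegrable_mul_inv_fourier => //; apply: cschwartz_cintegrable; exact: gS.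
have tri v (c : R) x0 : 0 < c -> cmeasurable setT v ->
    (forall a, 0 < a -> cintegrable leb setT (fun x => v x * (gauss a x)%:C)) ->
    cintegrable leb setT (fun x => v x * (gauss 1 (c^-1 *: (x - x0)))%:C).
  move=> c0 mv vi.
  have q : 0 < c^-1 ^+ 2 / 2 by rewrite divr_gt0// exprn_gt0// invr_gt0.
  apply: (le_cintegrable (h := fun x => expR ((c^-1) ^+ 2 * dotrV x0 x0) *
      cabs (v x * (gauss ((c^-1) ^+ 2 / 2) x)%:C))) => //.
  - apply: cmeasurableM => //; apply: cmeasurable_real; apply: (measurableT_comp (measurable_gauss 1)).
    by apply: measurable_scale_rV => //; exact: measurable_sub_rV.
  - apply: (eq_integrable measurableT (fun x => (expR ((c^-1) ^+ 2 * dotrV x0 x0))%:E *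
      (cabs (v x * (gauss ((c^-1) ^+ 2 / 2) x)%:C))%:E)%E) => //.
    by apply: integrableZl => //; apply: cintegrable_cabs => //; exact: vi.
  - move=> x _; rewrite !cabsM !cabs_real !(gtr0_norm (gauss_gt0 _ _)) mulrCA ler_wpM2l ?cabs_ge0//.
    exact: gauss_translate_le.
have ui' a : 0 < a -> cintegrable leb setT (fun x => u x * (gauss a x)%:C).
  by move=> a0; apply: ui; exact: gS.
have : {ae leb, forall x, u x - inv_fourier g x = 0}.
  apply: gauss_tests_ae0.
  - exact: cmeasurableB.
  - by move=> a a0; under eq_fun do rewrite mulrBl; apply: cintegrableB => //; [exact: ui'|exact: wi].
  - (* A Gaussian of parameter [b ^+ 2] transforms to a bump of width [2 * b]. *)
    move=> c x0 c0; pose b := c / 2; have b0 : 0 < b by rewrite divr_gt0.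
    have cb : c = 2 * b by rewrite /b mulrC divfK.
    pose phi (y : Rd) : R[i] := cis (dotrV x0 y) * (gauss (b ^+ 2) y)%:C.
    have phiS : cschwartz phi by apply: cschwartz_modulated_gauss; rewrite exprn_gt0.
    pose K := (b^-1) ^+ d * @gauss_mass R d.
    have K0 : 0 < K by rewrite mulr_gt0 ?gauss_mass_gt0// exprn_gt0// invr_gt0.
    have pE x : fourier phi x = K%:C * (gauss 1 (c^-1 *: (x - x0)))%:C.
      by rewrite fourier_modulated_gauss// cb rmorphM.
    have E v : cmeasurable setT v ->
        (forall a, 0 < a -> cintegrable leb setT (fun x => v x * (gauss a x)%:C)) ->
        cintegral leb setT (fun x => v x * fourier phi x) =
        K%:C * cintegral leb setT (fun x => v x * (gauss 1 (c^-1 *: (x - x0)))%:C).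
      move=> mv vi; rewrite -cintegralZl//; last exact: tri.
      by apply: eq_cintegral => x _; rewrite pE mulrCA.
    have := dual _ phiS; rewrite inv_fourier_duality// !E// => KK.
    under eq_cintegral do rewrite mulrBl.
    rewrite cintegralB//; [|exact: tri..].
    apply/eqP; rewrite subr_eq0; apply/eqP.
    have K1 : K^-1%:C * K%:C = 1 :> R[i] by rewrite -rmorphM mulVf ?gt_eqF.
    by rewrite -[LHS]mul1r -K1 -mulrA -KK mulrA K1 mul1r.
by apply: filterS => x /eqP; rewrite subr_eq0 => /eqP.
Qed.

End Wiener.

(** * Products and the cubic term *)

Section Convolution.
Context {R : realType} {d : nat}.
Local Notation Rd := 'rV[R]_d.
Local Notation leb := (@lebesgue_rV R d).
Local Notation kappa := (@kappa R d).
Implicit Types (f g : Rd -> R[i]).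

(** Fubini: the factor [g] is given on the Fourier side from the start. *)
Lemma fourier_mul_inv_fourier f g y : cintegrable leb setT f -> cintegrable leb setT g ->
  fourier (fun x => f x * inv_fourier g x) y =
  kappa%:C * cintegral leb setT (fun z => fourier f (y - z) * g z).
Proof.
move=> fi gi; have mf := cintegrable_cmeasurable fi; have mg := cintegrable_cmeasurable gi.
pose h (z : Rd * Rd) := cis (- dotrV z.1 y) * f z.1 * (cis (dotrV z.1 z.2) * g z.2).
have mh : cmeasurable setT h.
  apply: cmeasurableM.
    apply: cmeasurableM; last by apply: (cmeasurable_comp (f := f)) => //; exact: measurable_fst.
    by apply: cmeasurable_cis; apply: measurableT_comp => //; exact: measurable_dotrV.
  apply: cmeasurableM; last by apply: (cmeasurable_comp (f := g)) => //; exact: measurable_snd.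
  by apply: cmeasurable_cis; exact: measurable_dotrV.
have gxi x := cintegrable_inv_fourier_kernel x gi.
transitivity (kappa%:C * cintegral leb setT (fun x => cintegral leb setT (fun z => h (x, z)))).
  rewrite -cintegralZl//; last first.
    rewrite (_ : (fun x => _) = (fun x => cis (- dotrV x y) * (f x *
        cintegral leb setT (fun z => cis (dotrV x z) * g z)))); last first.
      by apply/funext => x; rewrite /h /= cintegralZl// mulrA.
    apply: cintegrable_fourier_kernel.
    have kk : kappa^-1%:C * kappa%:C = 1 :> R[i].
      by rewrite -rmorphM mulVf ?gt_eqF// kappa_gt0.
    rewrite (_ : (fun x => _) = (fun x => kappa^-1%:C * (f x * inv_fourier g x))); last first.
      apply/funext => x; rewrite /inv_fourier -/kappa.
      by rewrite mulrCA [X in _ = _ * X]mulrA kk mul1r.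
    by apply: cintegrableZl => //; exact: cintegrable_mul_inv_fourier.
  apply: eq_cintegral => x _; rewrite /h /= cintegralZl// /inv_fourier -/kappa.
  by rewrite [RHS]mulrCA mulrA.
rewrite (cFubini (m1 := leb) (m2 := leb) mh); last first.
  rewrite /h /=.
  rewrite (eq_integral (fun x => (cabs (f x))%:E * L1norm leb g)%E); last first.
    move=> x _; rewrite /L1norm -ge0_integralZl//.
    - by apply: eq_integral => z _; rewrite !cabsM !cabs_cis !mul1r EFinM.
    - exact: measurable_cabs_EFin.
    - by move=> z _; rewrite lee_fin cabs_ge0.
    - by rewrite lee_fin cabs_ge0.
  rewrite ge0_integralZr//; last 3 first.
  - exact: measurable_cabs_EFin.
  - by move=> x _; rewrite lee_fin cabs_ge0.
  - exact: L1norm_ge0.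
  by rewrite -/(L1norm leb f) -(fineK (L1norm_fin fi)) -(fineK (L1norm_fin gi)) -EFinM ltry.
congr (_ * _); apply: eq_cintegral => z _.
rewrite mulrC -cintegralZl//; last exact: cintegrable_fourier_kernel.
apply: eq_cintegral => x _; rewrite /h /= dotrVDr dotrVNr opprB [dotrV x z - _]addrC cisD; ring.
Qed.

Lemma L1norm_translate f (h : Rd) : cmeasurable setT f ->
  L1norm leb (fun x => f (x + h)) = L1norm leb f.
Proof.
move=> mf; have := L1norm_affine h (oner_neq0 R) mf.
have -> : (fun x => f (1 *: x + h)) = (fun x => f (x + h)).
  by apply/funext => x; rewrite scale1r.
by rewrite normr1 invr1 expr1n mul1e.
Qed.

(** The Wiener algebra is an algebra: the transform of a product is a
    convolution, whose [L^1] norm is at most the product of the norms, up to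
    [kappa]. *)
Lemma L1norm_mul_inv_fourier f g (A B : R) : cintegrable leb setT f -> cintegrable leb setT g ->
  (L1norm leb (fourier f) <= A%:E)%E -> (L1norm leb g <= B%:E)%E ->
  (L1norm leb (fourier (fun x => f x * inv_fourier g x)%R) <= (kappa * A * B)%:E)%E.
Proof.
move=> fi gi fA gB.
have mf := cintegrable_cmeasurable fi; have mg := cintegrable_cmeasurable gi.
have mff := cmeasurable_fourier mf.
pose h (z : Rd * Rd) := kappa%:C * (fourier f (z.2 - z.1) * g z.1).
have mh : cmeasurable setT h.
  apply: cmeasurableM; first exact: cmeasurable_cst.
  apply: cmeasurableM; last by apply: (cmeasurable_comp (f := g)) => //; exact: measurable_fst.
  apply: (cmeasurable_comp (f := fourier f)) => //.
  by apply: measurable_sub_rV; [exact: measurable_snd|exact: measurable_fst].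
have hi0 y : cintegrable leb setT (fun z => fourier f (y - z) * g z).
  under eq_fun do rewrite mulrC.
  apply: (cintegrableMb (C := fine (L1norm leb f))) => //.
    apply: (cmeasurable_comp (f := fourier f)) => //.
    exact: measurable_sub_rV.
  by move=> z _; apply: cabs_fourier_le => //; rewrite fineK// L1norm_fin.
have hi y : cintegrable leb setT (fun z => h (z, y)).
  exact: (cintegrableZl kappa%:C measurableT (hi0 y)).
have := L1norm_cintegral_le leb (m1 := leb) mh hi.
rewrite [X in (X <= _)%E -> _](_ : _ = L1norm leb (fourier (fun x => f x * inv_fourier g x))); last first.
  by apply: eq_integral => y _; rewrite fourier_mul_inv_fourier// -(cintegralZl kappa%:C measurableT (hi0 y)).
move=> le1; apply: le_trans le1 _.
have F0 := L1norm_ge0 (fourier f).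
have k0 := @kappa_ge0 R d.
have inner z : (\int[leb]_y (cabs (h (z, y)))%:E =
    (kappa * cabs (g z))%:E * L1norm leb (fourier f))%E.
  rewrite -(L1norm_translate (- z) mff) /L1norm -ge0_integralZl//.
  - apply: eq_integral => y _; rewrite /h !cabsM cabs_real ger0_norm// -EFinM.
    by congr EFin; rewrite [X in _ * X]mulrC mulrA.
  - apply: measurable_cabs_EFin; apply: (cmeasurable_comp (f := fourier f)) => //.
    exact: measurable_add_rV.
  - by move=> y _; rewrite lee_fin cabs_ge0.
  - by rewrite lee_fin mulr_ge0// cabs_ge0.
under eq_integral do rewrite inner.
rewrite ge0_integralZr//; last 2 first.
- apply/measurable_EFinP; apply: measurable_funM => //; exact: measurable_cabs.
- by move=> z _; rewrite lee_fin mulr_ge0// cabs_ge0.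
have -> : (\int[leb]_x (kappa * cabs (g x))%:E = kappa%:E * L1norm leb g)%E.
  rewrite /L1norm -ge0_integralZl//.
  - exact: measurable_cabs_EFin.
  - by move=> x _; rewrite lee_fin cabs_ge0.
have -> : (kappa * A * B)%:E = (kappa%:E * B%:E * A%:E)%E by rewrite -!EFinM; congr EFin; ring.
apply: lee_pmul => //; first by rewrite mule_ge0 ?lee_fin ?L1norm_ge0.
by apply: lee_pmul => //; rewrite ?lee_fin// L1norm_ge0.
Qed.

Lemma conjM (z w : R[i]) : (z * w)^* = z^* * w^*.
Proof. exact: rmorphM. Qed.

Lemma conj_real (a : R) : (a%:C : R[i])^* = a%:C.
Proof. exact: conjc_real. Qed.

(** Conjugation, on the Fourier side. *)
Definition conj_reflect g : Rd -> R[i] := fun y => (g (- y))^*.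

Lemma conj_inv_fourier g x : cintegrable leb setT g ->
  (inv_fourier g x)^* = inv_fourier (conj_reflect g) x.
Proof.
move=> gi; rewrite /inv_fourier conjM conj_real; congr (_ * _).
have ki := cintegrable_inv_fourier_kernel x gi.
have [ri <-] := cintegral_reflect ki.
rewrite -cintegral_conj//; apply: eq_cintegral => y _.
by rewrite conjM conj_cis dotrVNr opprK /conj_reflect.
Qed.

Lemma cintegrable_conj_reflect g : cintegrable leb setT g ->
  cintegrable leb setT (conj_reflect g).
Proof.
move=> gi; have [ri _] := cintegral_reflect gi.
apply: (le_cintegrable (h := fun y : Rd => cabs (g (- y)))) => //.
- by apply: cmeasurable_conj; exact: cintegrable_cmeasurable ri.
- exact: cintegrable_cabs.
- by move=> y _; rewrite cabs_conj.
Qed.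

Lemma L1norm_conj_reflect g : cmeasurable setT g ->
  L1norm leb (conj_reflect g) = L1norm leb g.
Proof.
by move=> mg; rewrite -(L1norm_reflect mg); apply: eq_integral => y _; rewrite cabs_conj.
Qed.

(** Conjugate-linear in the middle argument, so that [nonlinearity] is its
    diagonal and differences of nonlinearities telescope. *)
Definition cubic (a : Rd -> R) (u v w : Rd -> R[i]) : Rd -> R[i] :=
  fun x => (a x)%:C * u x * (v x)^* * w x.

Lemma nonlinearityE a u : nonlinearity a u = cubic a u u u.
Proof. by apply/funext => x; rewrite /nonlinearity /cubic sqr_cabsC; ring. Qed.

Lemma cubicB a u v x : nonlinearity a u x - nonlinearity a v x =
  cubic a (fun x => u x - v x) u u x + cubic a v (fun x => u x - v x) u x +
  cubic a v v (fun x => u x - v x) x.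
Proof. by rewrite !nonlinearityE /cubic rmorphB; ring. Qed.

Section Cubic.
Variables (a : Rd -> R) (A : R).
Hypothesis ai : cintegrable leb setT (fun x => (a x)%:C).
Hypothesis aA : (L1norm leb (fourier (fun x => (a x)%:C)) <= A%:E)%E.

(** Three uses of the algebra property. The factor [a] is integrable, hence so
    are all the products, and their Fourier transforms are honest integrals. *)
Lemma cubic_wiener g1 g2 g3 (B1 B2 B3 : R) :
  cintegrable leb setT g1 -> cintegrable leb setT g2 -> cintegrable leb setT g3 ->
  (L1norm leb g1 <= B1%:E)%E -> (L1norm leb g2 <= B2%:E)%E -> (L1norm leb g3 <= B3%:E)%E ->
  cintegrable leb setT (cubic a (inv_fourier g1) (inv_fourier g2) (inv_fourier g3)) /\
  (L1norm leb (fourier (cubic a (inv_fourier g1) (inv_fourier g2) (inv_fourier g3))) <=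
   (kappa ^+ 3 * A * B1 * B2 * B3)%:E)%E.
Proof.
move=> i1 i2 i3 b1 b2 b3.
have j1 := cintegrable_mul_inv_fourier ai i1.
have n1 := L1norm_mul_inv_fourier ai i1 aA b1.
have ci := cintegrable_conj_reflect i2.
have cn : (L1norm leb (conj_reflect g2) <= B2%:E)%E.
  by rewrite L1norm_conj_reflect//; exact: cintegrable_cmeasurable i2.
have j2 := cintegrable_mul_inv_fourier j1 ci.
have n2 := L1norm_mul_inv_fourier j1 ci n1 cn.
have j3 := cintegrable_mul_inv_fourier j2 i3.
have n3 := L1norm_mul_inv_fourier j2 i3 n2 b3.
have E : cubic a (inv_fourier g1) (inv_fourier g2) (inv_fourier g3) =
    (fun x => (a x)%:C * inv_fourier g1 x * inv_fourier (conj_reflect g2) x * inv_fourier g3 x).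
  by apply/funext => x; rewrite /cubic conj_inv_fourier.
rewrite E; split => //; apply: le_trans n3 _; rewrite lee_fin.
by rewrite le_eqVlt; apply/orP; left; apply/eqP; ring.
Qed.

End Cubic.

End Convolution.

(** * The Duhamel integral on the Fourier side *)

Section Duhamel.
Context {R : realType} {d : nat}.
Local Notation Rd := 'rV[R]_d.
Local Notation leb := (@lebesgue_rV R d).
Local Notation lam := (@lebesgue_measure R).
Local Notation kappa := (@kappa R d).
Variables (T : R).

Lemma measurable_between {dX : measure_display} {X : measurableType dX} (a b c : X -> R) :
  measurable_fun setT a -> measurable_fun setT b -> measurable_fun setT c ->
  measurable_fun setT (fun x => (b x \in `[a x, c x])%:R : R).
Proof.
move=> ma mb mc.
pose E := (fun x => b x - a x) @^-1` `[0, +oo[%classic `&` (fun x => c x - b x) @^-1` `[0, +oo[%classic.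
have mE : measurable E.
  apply: measurableI.
    by rewrite -[X in measurable X]setTI; apply: measurable_funB => //; exact: measurable_itv.
  by rewrite -[X in measurable X]setTI; apply: measurable_funB => //; exact: measurable_itv.
have -> : (fun x => (b x \in `[a x, c x])%:R) = \1_E :> (X -> R).
  apply/funext => x; rewrite indicE in_itv /=; congr (_%:R); congr nat_of_bool.
  apply/idP/idP => [/andP[h1 h2]|].
    by rewrite mem_set//; split; rewrite /= in_itv /= andbT subr_ge0.
  by move=> /set_mem[]; rewrite /= !in_itv /= !andbT !subr_ge0 => -> ->.
exact: measurable_indic.
Qed.

(** The pointwise bound makes the Duhamel integral absolutely convergent at
    every single frequency, not only at almost every one. *)
Definition forcing (L : R) (N : R -> Rd -> R[i]) :=
  cmeasurable setT (fun z : R * Rd => N z.1 z.2) /\ (forall s y, cabs (N s y) <= L).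

Definition duhamel (N : R -> Rd -> R[i]) (t : R) (y : Rd) : R[i] :=
  cintegral lam `[- T, t] (fun s => cis (- ((t - s) * enorm y ^+ 2 / 2)) * N s y).

(** Multiplying by this indicator turns integrals over [- T, t] into integrals
    over the line, to which parametric measurability and Fubini apply. *)
Definition window (t s : R) : R := (s \in `[- T, t])%:R.

Lemma measurable_window {dX : measure_display} {X : measurableType dX} (t s : X -> R) :
  measurable_fun setT t -> measurable_fun setT s ->
  measurable_fun setT (fun x => window (t x) (s x)).
Proof. by move=> mt ms; exact: measurable_between. Qed.

Lemma integrable_window t : lam.-integrable setT (EFin \o window t).
Proof.
have -> : EFin \o window t = EFin \o \1_(`[- T, t]%classic).
  by apply/funext => s; rewrite /= /window indicE; congr (_%:R%:E); rewrite mem_setE.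
apply: integrable_indic_itv.
Qed.

Lemma integrable_scaled_window L t : lam.-integrable setT (EFin \o (fun s => L * window t s)).
Proof.
have -> : EFin \o (fun s => L * window t s) = (fun s => L%:E * (EFin \o window t) s)%E.
  by apply/funext => s; rewrite /= EFinM.
by apply: integrableZl => //; exact: integrable_window.
Qed.

Lemma cintegral_window t (f : R -> R[i]) :
  cintegral lam `[- T, t] f = cintegral lam setT (fun s => (window t s)%:C * f s).
Proof.
rewrite cintegral_mkcond; apply: eq_cintegral => s _; rewrite mem_setE /window.
by case: ifP => _; rewrite ?mul1r ?mul0r.
Qed.

Lemma forcing_slice L N s : forcing L N -> cmeasurable setT (N s).
Proof.
move=> [mN _]; apply: (cmeasurable_comp (f := fun z : R * Rd => N z.1 z.2) (p := fun y => (s, y))) => //; exact: measurable_fun_pair.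
Qed.

Lemma forcing_slice_t L N y : forcing L N -> cmeasurable setT (fun s => N s y).
Proof.
move=> [mN _]; apply: (cmeasurable_comp (f := fun z : R * Rd => N z.1 z.2) (p := fun s => (s, y))) => //; exact: measurable_fun_pair.
Qed.

Lemma measurable_phase {dX : measure_display} {X : measurableType dX} (t s : X -> R) (y : X -> Rd) :
  measurable_fun setT t -> measurable_fun setT s -> measurable_fun setT y ->
  cmeasurable setT (fun x => cis (- ((t x - s x) * enorm (y x) ^+ 2 / 2))).
Proof.
move=> mt ms my; apply: cmeasurable_cis; apply: measurableT_comp => //.
apply: measurable_funM => //; apply: measurable_funM; first exact: measurable_funB.
by apply: measurable_funX; exact: measurable_enorm.
Qed.

Lemma cmeasurable_duhamel L N : forcing L N ->
  cmeasurable setT (fun z : R * Rd => duhamel N z.1 z.2).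
Proof.
move=> [mN _]; under eq_fun do rewrite /duhamel cintegral_window.
apply: (cmeasurable_cintegral lam (f := fun w : (R * Rd) * R => (window w.1.1 w.2)%:C *
   (cis (- ((w.1.1 - w.2) * enorm w.1.2 ^+ 2 / 2)) * N w.2 w.1.2))).
have m11 : measurable_fun setT (fun w : (R * Rd) * measurableTypeR R => w.1.1).
  by apply: (measurableT_comp (f := fst)) => //; exact: measurable_fst.
have m12 : measurable_fun setT (fun w : (R * Rd) * measurableTypeR R => w.1.2).
  by apply: (measurableT_comp (f := snd)) => //; exact: measurable_fst.
have m2 : measurable_fun setT (fun w : (R * Rd) * measurableTypeR R => w.2 : R) by exact: measurable_snd.
apply: cmeasurableM; first by apply: cmeasurable_real; exact: measurable_window.
apply: cmeasurableM; first exact: measurable_phase.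
apply: (cmeasurable_comp (f := fun z : R * Rd => N z.1 z.2)
  (p := fun w : (R * Rd) * measurableTypeR R => (w.2 : R, w.1.2))) => //.
exact: measurable_fun_pair.
Qed.

Lemma cintegrable_duhamel L N t y : forcing L N ->
  cintegrable lam setT (fun s => (window t s)%:C *
    (cis (- ((t - s) * enorm y ^+ 2 / 2)) * N s y)).
Proof.
move=> fN; have [_ NL] := fN.
apply: (@le_cintegrable _ _ (measurableTypeR R) lam _ _ (fun s => L * window t s)) => //.
- apply: cmeasurableM; first by apply: cmeasurable_real; exact: measurable_window.
  apply: cmeasurableM; first exact: measurable_phase.
  exact: forcing_slice_t fN.
- exact: integrable_scaled_window.
- move=> s _; rewrite cabsM cabs_cisM cabs_real ger0_norm; last by rewrite /window ler0n.
  by rewrite mulrC ler_wpM2r// /window ler0n.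
Qed.

Lemma duhamelB L L' N N' t y : forcing L N -> forcing L' N' ->
  duhamel N t y - duhamel N' t y = duhamel (fun s y => N s y - N' s y) t y.
Proof.
move=> fN fN'; rewrite /duhamel !cintegral_window -cintegralB//; last 2 first.
- exact: (cintegrable_duhamel t y fN).
- exact: (cintegrable_duhamel t y fN').
by apply: eq_cintegral => s _; ring.
Qed.

Lemma forcingB L L' N N' : forcing L N -> forcing L' N' ->
  forcing (L + L') (fun s y => N s y - N' s y).
Proof.
move=> [mN NL] [mN' NL']; split; first exact: cmeasurableB.
by move=> s y; rewrite (le_trans (le_cabsB _ _))// lerD.
Qed.

(** The free evolution is a unimodular factor on the Fourier side. *)
Lemma L1norm_duhamel L N t : forcing L N ->
  (L1norm leb (duhamel N t) <= \int[lam]_(s in `[(- T)%R, t]) L1norm leb (N s))%E.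
Proof.
move=> fN; have [mN NL] := fN.
pose h (z : R * Rd) := (window t z.1)%:C * (cis (- ((t - z.1) * enorm z.2 ^+ 2 / 2)) * N z.1 z.2).
have m1 : measurable_fun setT (fun z : measurableTypeR R * Rd => z.1 : R) by exact: measurable_fst.
have m2 : measurable_fun setT (fun z : measurableTypeR R * Rd => z.2) by exact: measurable_snd.
have mh : cmeasurable [set: measurableTypeR R * Rd] h.
  apply: cmeasurableM; first by apply: cmeasurable_real; exact: measurable_window.
  apply: cmeasurableM; first exact: measurable_phase.
  exact: mN.
have hi y : cintegrable lam setT (fun s => h (s, y)) by exact: (cintegrable_duhamel t y fN).
have le1 := L1norm_cintegral_le leb (m1 := lam) mh hi.
apply: le_trans (_ : \int[lam]_s \int[leb]_y (cabs (h (s, y)))%:E <= _)%E.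
  apply: le_trans le1; rewrite le_eqVlt; apply/orP; left; apply/eqP.
  by apply: eq_integral => y _; rewrite /duhamel cintegral_window.
rewrite [leRHS]integral_mkcond le_eqVlt; apply/orP; left; apply/eqP.
apply: eq_integral => s _; rewrite patchE mem_setE.
case: ifP => st; last first.
  rewrite integral0_eq// => y _; rewrite /h /= /window st cabsM cabs_real normr0 mul0r//.
by apply: eq_integral => y _; rewrite /h /= /window st cabsM cabs_cisM cabs_real normr1 mul1r.
Qed.

(** Fubini: the Duhamel integral may be computed at fixed frequency. *)
Lemma inv_fourier_duhamel L N (B : R) t x : forcing L N ->
  (forall s, (L1norm leb (N s) <= B%:E)%E) ->
  cintegral lam `[- T, t] (fun s =>
    inv_fourier (fun y => cis (- ((t - s) * enorm y ^+ 2 / 2)) * N s y) x) =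
  inv_fourier (duhamel N t) x.
Proof.
move=> fN NB; have [mN NL] := fN.
pose h (z : R * Rd) := (window t z.1)%:C * (cis (dotrV x z.2) *
  (cis (- ((t - z.1) * enorm z.2 ^+ 2 / 2)) * N z.1 z.2)).
have m1 : measurable_fun setT (fun z : measurableTypeR R * Rd => z.1 : R) by exact: measurable_fst.
have m2 : measurable_fun setT (fun z : measurableTypeR R * Rd => z.2) by exact: measurable_snd.
have mh : cmeasurable [set: measurableTypeR R * Rd] h.
  apply: cmeasurableM; first by apply: cmeasurable_real; exact: measurable_window.
  apply: cmeasurableM; first by apply: cmeasurable_cis; exact: measurable_dotrV.
  apply: cmeasurableM; first exact: measurable_phase.
  exact: mN.
have Ni s : cintegrable leb setT (fun y => cis (dotrV x y) *
    (cis (- ((t - s) * enorm y ^+ 2 / 2)) * N s y)).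
  apply: cintegrable_inv_fourier_kernel.
  apply: (cintegrable_L1norm (C := B)); last by rewrite L1norm_cisM.
  apply: cmeasurableM; first exact: measurable_phase.
  exact: forcing_slice fN.
have hfin : (\int[lam]_s \int[leb]_y (cabs (h (s, y)))%:E < +oo)%E.
  apply: (@le_lt_trans _ _ (\int[lam]_s (B%:E * `|window t s|%:E))%E).
    apply: ge0_le_integral_nm => s.
      by apply: integral_ge0 => y _; rewrite lee_fin cabs_ge0.
    rewrite muleC; apply: le_trans (lee_wpmul2l _ (NB s)); last by rewrite lee_fin.
    rewrite /L1norm -ge0_integralZl//.
    - rewrite le_eqVlt; apply/orP; left; apply/eqP.
      by apply: eq_integral => y _; rewrite /h /= cabsM !cabs_cisM cabs_real EFinM.
    - by apply: measurable_cabs_EFin; exact: forcing_slice fN.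
    - by move=> y _; rewrite lee_fin cabs_ge0.
  have /integrable_abse/(integrableZl measurableT B)/integrableP[_] := integrable_window t.
  apply: le_lt_trans; apply: ge0_le_integral_nm => s.
    by rewrite mule_ge0// lee_fin -lee_fin (le_trans _ (NB 0))// L1norm_ge0.
  exact: lee_abs.
have hE s : cintegral leb setT (fun y => h (s, y)) = (window t s)%:C *
    cintegral leb setT (fun y => cis (dotrV x y) *
      (cis (- ((t - s) * enorm y ^+ 2 / 2)) * N s y)).
  exact: (cintegralZl (window t s)%:C measurableT (Ni s)).
have hI : cintegrable lam setT (fun s => cintegral leb setT (fun y => h (s, y))).
  apply: (@le_cintegrable _ _ (measurableTypeR R) lam _ _ (fun s => B * window t s)) => //.
  - exact: cmeasurable_cintegral.
  - exact: integrable_scaled_window.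
  - move=> s _; rewrite hE cabsM cabs_real ger0_norm; last by rewrite /window ler0n.
    rewrite mulrC ler_wpM2r//.
    by apply: cabs_cintegral_leR => //; rewrite -/(L1norm _ _) !L1norm_cisM.
transitivity (kappa%:C * cintegral lam setT (fun s => cintegral leb setT (fun y => h (s, y)))).
  rewrite cintegral_window -(cintegralZl kappa%:C measurableT hI).
  by apply: eq_cintegral => s _; rewrite hE /inv_fourier -/kappa; ring.
rewrite (cFubini (m1 := lam) (m2 := leb) mh hfin) /inv_fourier -/kappa.
congr (kappa%:C * _).
apply: eq_cintegral => y _; rewrite /duhamel cintegral_window.
rewrite -(cintegralZl (cis (dotrV x y)) measurableT (cintegrable_duhamel t y fN)).
by apply: eq_cintegral => s _; rewrite /h /=; ring.
Qed.

End Duhamel.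

(** * Paths in the Wiener algebra and the force they exert *)

Section L1norm.
Context {R : realType} {d : nat}.
Local Notation Rd := 'rV[R]_d.
Local Notation leb := (@lebesgue_rV R d).

Lemma L1normD_le (f g : Rd -> R[i]) : cmeasurable setT f -> cmeasurable setT g ->
  (L1norm leb (fun y => f y + g y)%R <= L1norm leb f + L1norm leb g)%E.
Proof.
move=> mf mg; rewrite /L1norm -ge0_integralD//.
- apply: ge0_le_integral_nm => y; first by rewrite lee_fin cabs_ge0.
  by rewrite -EFinD lee_fin le_cabsD.
- by move=> y _; rewrite lee_fin cabs_ge0.
- exact: measurable_cabs_EFin.
- by move=> y _; rewrite lee_fin cabs_ge0.
- exact: measurable_cabs_EFin.
Qed.

Lemma L1normN (f : Rd -> R[i]) : L1norm leb (fun y => - f y)%R = L1norm leb f.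
Proof. by apply: eq_integral => y _; rewrite cabsN. Qed.

Lemma L1norm_iM (f : Rd -> R[i]) : L1norm leb (fun y => 'i%C * f y)%R = L1norm leb f.
Proof. by apply: eq_integral => y _; rewrite cabsM cabs_i mul1r. Qed.

Lemma L1norm_distC (f g : Rd -> R[i]) :
  L1norm leb (fun y => f y - g y)%R = L1norm leb (fun y => g y - f y)%R.
Proof. by apply: eq_integral => y _; rewrite cabs_distC. Qed.

Lemma L1normB_le (f g : Rd -> R[i]) : cmeasurable setT f -> cmeasurable setT g ->
  (L1norm leb (fun y => f y - g y)%R <= L1norm leb f + L1norm leb g)%E.
Proof.
move=> mf mg; rewrite -(L1normN g); apply: L1normD_le => //.
rewrite (_ : (fun y => - g y) = (fun y => 0 - g y)); last by apply/funext => y; rewrite sub0r.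
by apply: cmeasurableB => //; exact: cmeasurable_cst.
Qed.

Lemma L1norm_triangle (f g h : Rd -> R[i]) :
  cmeasurable setT f -> cmeasurable setT g -> cmeasurable setT h ->
  (L1norm leb (fun y => f y - h y)%R <=
   L1norm leb (fun y => f y - g y)%R + L1norm leb (fun y => g y - h y)%R)%E.
Proof.
move=> mf mg mh; apply: le_trans (L1normD_le (f := fun y => f y - g y) (g := fun y => g y - h y) _ _).
- rewrite le_eqVlt; apply/orP; left; apply/eqP; apply: eq_integral => y _.
  by rewrite addrA subrK.
- exact: cmeasurableB.
- exact: cmeasurableB.
Qed.

Lemma cmeasurable_fourier_param (U : R -> Rd -> R[i]) :
  cmeasurable setT (fun z : R * Rd => U z.1 z.2) ->
  cmeasurable setT (fun z : R * Rd => fourier (U z.1) z.2).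
Proof.
move=> mU.
apply: (cmeasurable_cintegral leb
  (f := fun w : (R * Rd) * Rd => cis (- dotrV w.2 w.1.2) * U w.1.1 w.2)).
apply: cmeasurableM.
  apply: cmeasurable_cis; apply: measurableT_comp => //.
  apply: measurable_dotrV => //.
  by apply: (measurableT_comp (f := snd)) => //; exact: measurable_fst.
apply: (cmeasurable_comp (f := fun z : R * Rd => U z.1 z.2)
  (p := fun w : (R * Rd) * Rd => (w.1.1, w.2))) => //.
apply: measurable_fun_pair => //.
by apply: (measurableT_comp (f := fst)) => //; exact: measurable_fst.
Qed.

Lemma cmeasurable_inv_fourier_param (U : R -> Rd -> R[i]) :
  cmeasurable setT (fun z : R * Rd => U z.1 z.2) ->
  cmeasurable setT (fun z : R * Rd => inv_fourier (U z.1) z.2).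
Proof.
move=> /cmeasurable_fourier_param mU.
under eq_fun do rewrite inv_fourierE.
apply: cmeasurableM; first exact: cmeasurable_cst.
apply: (cmeasurable_comp (f := fun z : R * Rd => fourier (U z.1) z.2)
  (p := fun w : R * Rd => (w.1, - w.2))) => //.
by apply: measurable_fun_pair => //; exact: measurable_opp_rV.
Qed.

End L1norm.

Section Force.
Context {R : realType} {d : nat}.
Local Notation Rd := 'rV[R]_d.
Local Notation leb := (@lebesgue_rV R d).
Local Notation lam := (@lebesgue_measure R).
Local Notation kappa := (@kappa R d).
Variables (a : Rd -> R) (A : R).
Hypothesis ai : cintegrable leb setT (fun x => (a x)%:C).
Hypothesis aA : (L1norm leb (fourier (fun x => (a x)%:C)) <= A%:E)%E.

(** The Fourier side of [L^oo([-T, T]; F L^1)], normalised: the bound holds at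
    every time of the real line. A path determines a function everywhere in
    space, by the inverse transform. *)
Definition L1path (M : R) (U : R -> Rd -> R[i]) :=
  cmeasurable setT (fun z : R * Rd => U z.1 z.2) /\ forall s, (L1norm leb (U s) <= M%:E)%E.

Lemma pathW M M' U : M <= M' -> L1path M U -> L1path M' U.
Proof. by move=> MM' [mU UM]; split => // s; rewrite (le_trans (UM s))// lee_fin. Qed.

Lemma path_ge0 M U : L1path M U -> 0 <= M.
Proof. by move=> [_ UM]; rewrite -lee_fin (le_trans (L1norm_ge0 _) (UM 0)). Qed.

Lemma path_slice M U s : L1path M U -> cintegrable leb setT (U s).
Proof.
move=> [mU UM]; apply: (cintegrable_L1norm (C := M)) => //.
apply: (cmeasurable_comp (f := fun z : R * Rd => U z.1 z.2) (p := fun y => (s, y))) => //.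
exact: measurable_fun_pair.
Qed.

Lemma path_cmeasurable M U s : L1path M U -> cmeasurable setT (U s).
Proof. by move=> /(path_slice s)/cintegrable_cmeasurable. Qed.

Definition force (U : R -> Rd -> R[i]) (s : R) : Rd -> R[i] :=
  fourier (nonlinearity a (inv_fourier (U s))).

Lemma amplitude_ge0 : 0 <= A.
Proof. by rewrite -lee_fin (le_trans (L1norm_ge0 _) aA). Qed.

Lemma cintegrable_nonlinearity M U s : L1path M U ->
  cintegrable leb setT (nonlinearity a (inv_fourier (U s))).
Proof.
move=> pU; have Ui := path_slice s pU; have UM := pU.2 s.
by rewrite nonlinearityE; have [] := cubic_wiener ai aA Ui Ui Ui UM UM UM.
Qed.

Lemma L1norm_force M U s : L1path M U ->
  (L1norm leb (force U s) <= (kappa ^+ 3 * A * M ^+ 3)%:E)%E.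
Proof.
move=> pU; have Ui := path_slice s pU; have UM := pU.2 s.
rewrite /force nonlinearityE; have [_] := cubic_wiener ai aA Ui Ui Ui UM UM UM.
by move/le_trans; apply; rewrite lee_fin exprSr expr2 !mulrA.
Qed.

(** The pointwise bound in frequency uses the [L^1] norm of [a] in space, while
    functions of the Wiener algebra are bounded. *)
Lemma force_forcing M U : L1path M U -> exists L, forcing L (force U).
Proof.
move=> pU; have M0 := path_ge0 pU.
pose B := fine (L1norm leb (fun x => (a x)%:C)).
exists (B * (kappa * M) ^+ 3); split.
  apply: (cmeasurable_fourier_param (U := fun s => nonlinearity a (inv_fourier (U s)))).
  have mu := cmeasurable_inv_fourier_param pU.1.
  apply: cmeasurableM => //; apply: cmeasurableM.
    apply: (cmeasurable_comp (f := fun x => (a x)%:C) (p := fun w : R * Rd => w.2)).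
      exact: measurable_snd.
    exact: cintegrable_cmeasurable ai.
  by apply: cmeasurable_real; apply: measurable_funX; exact: measurable_cabs.
move=> s y; apply: cabs_fourier_le; first exact: cintegrable_nonlinearity pU.
have -> : (B * (kappa * M) ^+ 3)%:E =
    (((kappa * M) ^+ 3)%:E * L1norm leb (fun x => (a x)%:C))%E.
  by rewrite mulrC EFinM fineK// L1norm_fin.
rewrite /L1norm -ge0_integralZl//; last 3 first.
- by apply: measurable_cabs_EFin; exact: cintegrable_cmeasurable ai.
- by move=> x _; rewrite lee_fin cabs_ge0.
- by rewrite lee_fin exprn_ge0// mulr_ge0// kappa_ge0.
apply: ge0_le_integral_nm => x; first by rewrite lee_fin cabs_ge0.
rewrite -EFinM lee_fin /nonlinearity (cabsM (_ * _)) (cabsM (a x)%:C).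
rewrite [X in _ * X * _]cabs_real [X in _ * X * _]ger0_norm ?sqr_ge0//.
rewrite -mulrA -exprSr mulrC ler_wpM2r ?cabs_ge0// lerXn2r ?nnegrE ?cabs_ge0//.
  by rewrite mulr_ge0// kappa_ge0.
exact: cabs_inv_fourier_le (path_slice s pU) (pU.2 s).
Qed.

Lemma L1norm_forceB M U V s : L1path M U -> L1path M V ->
  (L1norm leb (fun y => force U s y - force V s y)%R <=
   (3 * kappa ^+ 3 * A * M ^+ 2)%:E * L1norm leb (fun y => U s y - V s y)%R)%E.
Proof.
move=> pU pV; have Ui := path_slice s pU; have UM := pU.2 s.
have Vi := path_slice s pV; have VM := pV.2 s.
have Wi : cintegrable leb setT (fun y => U s y - V s y) by exact: cintegrableB.
pose D := fine (L1norm leb (fun y => U s y - V s y)).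
have DE : L1norm leb (fun y => U s y - V s y) = D%:E by rewrite fineK// L1norm_fin.
have WD : (L1norm leb (fun y => U s y - V s y)%R <= D%:E)%E by rewrite DE.
have [i1 n1] := cubic_wiener ai aA Wi Ui Ui WD UM UM.
have [i2 n2] := cubic_wiener ai aA Vi Wi Ui VM WD UM.
have [i3 n3] := cubic_wiener ai aA Vi Vi Wi VM VM WD.
set w := inv_fourier (fun y => U s y - V s y) in i1 n1 i2 n2 i3 n3.
have wE : (fun x => inv_fourier (U s) x - inv_fourier (V s) x) = w.
  by apply/funext => x; rewrite /w inv_fourierB.
set c1 := cubic _ _ _ _ in i1 n1; set c2 := cubic _ _ _ _ in i2 n2.
set c3 := cubic _ _ _ _ in i3 n3.
have E y : force U s y - force V s y = fourier c1 y + fourier c2 y + fourier c3 y.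
  rewrite /force -fourierB; [|exact: cintegrable_nonlinearity pU|exact: cintegrable_nonlinearity pV].
  rewrite -fourierD// -fourierD//; last exact: cintegrableD.
  by apply: eq_cintegral => x _; rewrite cubicB wE.
have mf1 : cmeasurable setT (fourier c1) by apply: cmeasurable_fourier; exact: cintegrable_cmeasurable i1.
have mf2 : cmeasurable setT (fourier c2) by apply: cmeasurable_fourier; exact: cintegrable_cmeasurable i2.
have mf3 : cmeasurable setT (fourier c3) by apply: cmeasurable_fourier; exact: cintegrable_cmeasurable i3.
rewrite DE -EFinM (_ : (fun y => _) = (fun y => fourier c1 y + fourier c2 y + fourier c3 y)); last first.
  by apply/funext => y; exact: E.
apply: le_trans (L1normD_le _ mf3) _; first exact: cmeasurableD.
apply: le_trans (leeD (le_trans (L1normD_le mf1 mf2) (leeD n1 n2)) n3) _.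
by rewrite -!EFinD lee_fin le_eqVlt; apply/orP; left; apply/eqP; ring.
Qed.

End Force.

(** * The Picard map *)

Section Picard.
Context {R : realType} {d : nat}.
Local Notation Rd := 'rV[R]_d.
Local Notation leb := (@lebesgue_rV R d).
Local Notation lam := (@lebesgue_measure R).
Local Notation kappa := (@kappa R d).
Variables (a : Rd -> R) (A : R).
Hypothesis ai : cintegrable leb setT (fun x => (a x)%:C).
Hypothesis aA : (L1norm leb (fourier (fun x => (a x)%:C)) <= A%:E)%E.
Variables (T : R) (g0 : Rd -> R[i]) (M0 : R).
Hypothesis T0 : 0 < T.
Hypothesis g0i : cintegrable leb setT g0.
Hypothesis g0M : (L1norm leb g0 <= M0%:E)%E.
Local Notation force := (force a).
Local Notation window := (window T).
Local Notation duhamel := (duhamel T).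

(** The Duhamel formula on the Fourier side; the window keeps the path bounded
    for all times. *)
Definition picard (U : R -> Rd -> R[i]) (t : R) (y : Rd) : R[i] :=
  (window T t)%:C * (cis (- ((t + T) * enorm y ^+ 2 / 2)) * g0 y
    - 'i%C * duhamel (force U) t y).

Lemma window_in t : t \in `[- T, T] -> window T t = 1.
Proof. by rewrite /window => ->. Qed.

Lemma window_out t : t \notin `[- T, T] -> window T t = 0.
Proof. by rewrite /window => /negbTE ->. Qed.

Lemma picard_in U t y : t \in `[- T, T] -> picard U t y =
  cis (- ((t + T) * enorm y ^+ 2 / 2)) * g0 y - 'i%C * duhamel (force U) t y.
Proof. by move=> tT; rewrite /picard window_in//; exact: mul1r. Qed.

Lemma picard_out U t y : t \notin `[- T, T] -> picard U t y = 0.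
Proof. by move=> tT; rewrite /picard window_out//; exact: mul0r. Qed.

Lemma cmeasurable_picard M U : L1path M U ->
  cmeasurable setT (fun z : R * Rd => picard U z.1 z.2).
Proof.
move=> pU; have [L fL] := force_forcing ai aA pU.
have m1 : measurable_fun setT (fun z : measurableTypeR R * Rd => z.1 : R) by exact: measurable_fst.
have m2 : measurable_fun setT (fun z : measurableTypeR R * Rd => z.2) by exact: measurable_snd.
apply: cmeasurableM; first by apply: cmeasurable_real; exact: measurable_window.
apply: cmeasurableB.
  apply: cmeasurableM.
    apply: cmeasurable_cis; apply: measurableT_comp => //.
    apply: measurable_funM => //; apply: measurable_funM; first exact: measurable_funD.
    by apply: measurable_funX; exact: measurable_enorm.
  apply: (cmeasurable_comp (f := g0) (p := fun w : R * Rd => w.2)); first exact: measurable_snd.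
  exact: cintegrable_cmeasurable g0i.
apply: cmeasurableM; first exact: cmeasurable_cst.
exact: cmeasurable_duhamel fL.
Qed.

Lemma integral_elapsed (c t : R) : 0 <= c -> t \in `[- T, T] ->
  (\int[lam]_(s in `[(- T)%R, t]) c%:E = (c * (t + T))%:E)%E.
Proof.
rewrite in_itv /= => c0 /andP[t1 t2].
rewrite integral_cst//= lebesgue_measure_itv /= lte_fin.
case: ltP => h; first by rewrite -EFinD -EFinM opprK.
by rewrite (_ : t = - T) ?addNr ?mulr0 ?mule0//; apply/eqP; rewrite eq_le h t1.
Qed.

Lemma integral_elapsed_le (c t : R) : 0 <= c -> t \in `[- T, T] ->
  (\int[lam]_(s in `[(- T)%R, t]) c%:E <= (2 * T * c)%:E)%E.
Proof.
move=> c0 tT; rewrite integral_elapsed// lee_fin mulrC ler_wpM2r//.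
by move: tT; rewrite in_itv /= => /andP[_]; lra.
Qed.

Lemma cmeasurable_duhamel_slice L (N : R -> Rd -> R[i]) t : forcing L N ->
  cmeasurable setT (duhamel N t).
Proof.
move=> fN.
apply: (cmeasurable_comp (f := fun z : R * Rd => duhamel N z.1 z.2) (p := fun y => (t, y))).
  exact: measurable_fun_pair.
exact: cmeasurable_duhamel fN.
Qed.

Lemma L1norm_duhamel_force M U t : L1path M U -> t \in `[- T, T] ->
  (L1norm leb (duhamel (force U) t) <= (2 * T * (kappa ^+ 3 * A * M ^+ 3))%:E)%E.
Proof.
move=> pU tT; have [L fL] := force_forcing ai aA pU.
apply: le_trans (L1norm_duhamel T t fL) _.
apply: le_trans (integral_elapsed_le _ tT); last first.
  by rewrite !mulr_ge0 ?exprn_ge0 ?kappa_ge0 ?(amplitude_ge0 aA) ?(path_ge0 pU).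
rewrite [leLHS]integral_mkcond [leRHS]integral_mkcond; apply: ge0_le_integral_nm => s.
  by rewrite patchE; case: ifP => // _; exact: L1norm_ge0.
by rewrite !patchE; case: ifP => // _; exact: L1norm_force pU.
Qed.

Lemma path_picard M U : L1path M U ->
  L1path (M0 + 2 * T * (kappa ^+ 3 * A * M ^+ 3)) (picard U).
Proof.
move=> pU; split; first exact: cmeasurable_picard pU.
move=> t; have [L fL] := force_forcing ai aA pU.
have K0 : 0 <= 2 * T * (kappa ^+ 3 * A * M ^+ 3).
  by rewrite !mulr_ge0 ?exprn_ge0 ?kappa_ge0 ?(amplitude_ge0 aA) ?(path_ge0 pU) ?ltW.
have [tT|tT] := boolP (t \in `[- T, T]); last first.
  rewrite (_ : picard U t = fun=> 0); last first.
    by apply/funext => y; exact: picard_out.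
  rewrite /L1norm integral0_eq => [|y _]; last by rewrite cabs0.
  by rewrite lee_fin addr_ge0// -lee_fin (le_trans (L1norm_ge0 _) g0M).
rewrite (_ : picard U t = fun y => cis (- ((t + T) * enorm y ^+ 2 / 2)) * g0 y
    - 'i%C * duhamel (force U) t y); last first.
  by apply/funext => y; exact: picard_in.
apply: le_trans (L1normB_le _ _) _.
- apply: cmeasurableM; last exact: cintegrable_cmeasurable g0i.
  apply: cmeasurable_cis; apply: measurableT_comp => //.
  by apply: measurable_funM => //; apply: measurable_funM => //; apply: measurable_funX; exact: measurable_enorm.
- by apply: cmeasurableM; [exact: cmeasurable_cst|exact: cmeasurable_duhamel_slice fL].
by rewrite L1norm_cisM L1norm_iM EFinD; apply: leeD => //; exact: L1norm_duhamel_force.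
Qed.

Lemma picard_contraction M U V t : L1path M U -> L1path M V -> t \in `[- T, T] ->
  (L1norm leb (fun y => picard U t y - picard V t y)%R <=
   \int[lam]_(s in `[(- T)%R, t])
     ((3 * kappa ^+ 3 * A * M ^+ 2)%:E * L1norm leb (fun y => U s y - V s y)%R))%E.
Proof.
move=> pU pV tT.
have [L fL] := force_forcing ai aA pU; have [L' fL'] := force_forcing ai aA pV.
have -> : L1norm leb (fun y => picard U t y - picard V t y)%R =
    L1norm leb (duhamel (fun s y => force U s y - force V s y) t).
  rewrite -[RHS]L1norm_iM -[RHS]L1normN; apply: eq_integral => y _.
  congr (cabs _)%:E; rewrite -(duhamelB T t y fL fL') !picard_in//.
  have E (u v w j : R[i]) : u - j * v - (u - j * w) = - (j * (v - w)) by ring.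
  exact: E.
apply: le_trans (L1norm_duhamel T t (forcingB fL fL')) _.
rewrite [leLHS]integral_mkcond [leRHS]integral_mkcond; apply: ge0_le_integral_nm => s.
  by rewrite patchE; case: ifP => // _; exact: L1norm_ge0.
by rewrite !patchE; case: ifP => // _; exact: (L1norm_forceB ai aA s pU pV).
Qed.

Lemma picard_lipschitz M U V (D : R) t : L1path M U -> L1path M V ->
  (forall s, (L1norm leb (fun y => U s y - V s y)%R <= D%:E)%E) ->
  (L1norm leb (fun y => picard U t y - picard V t y)%R <=
   (2 * T * (3 * kappa ^+ 3 * A * M ^+ 2) * D)%:E)%E.
Proof.
move=> pU pV UVD.
have D0 : 0 <= D by rewrite -lee_fin (le_trans (L1norm_ge0 _) (UVD 0)).
have K0 : 0 <= 3 * kappa ^+ 3 * A * M ^+ 2.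
  by rewrite !mulr_ge0 ?exprn_ge0 ?kappa_ge0 ?(amplitude_ge0 aA) ?(path_ge0 pU).
have [tT|tT] := boolP (t \in `[- T, T]); last first.
  rewrite (_ : (fun y => _) = fun=> 0); last first.
    by apply/funext => y; rewrite !picard_out// subr0.
  rewrite /L1norm integral0_eq => [|y _]; last by rewrite cabs0.
  by rewrite lee_fin; apply: mulr_ge0 => //; apply: mulr_ge0 => //; apply: mulr_ge0 => //; exact: ltW.
apply: le_trans (picard_contraction pU pV tT) _.
rewrite -[in leRHS]mulrA; apply: le_trans (integral_elapsed_le _ tT); last by rewrite mulr_ge0.
rewrite [leLHS]integral_mkcond [leRHS]integral_mkcond; apply: ge0_le_integral_nm => s.
  by rewrite patchE; case: ifP => // _; rewrite mule_ge0// ?lee_fin// L1norm_ge0.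
by rewrite !patchE; case: ifP => // _; rewrite [leRHS]EFinM; apply: lee_wpmul2l.
Qed.

End Picard.

(** * Two tools: summable increments and a Gronwall inequality *)

Section SummableIncrements.
Context {R : realType}.

Lemma cvg_summable_increments (u : nat -> R) (n : nat) :
  (\sum_(k <oo) `|u (k + n).+1 - u (k + n)%N|%:E < +oo)%E -> cvgn u.
Proof.
set S := (X in (X < _)%E) => Soo.
have S0 : (0 <= S)%E by apply: nneseries_ge0 => k _ _; rewrite lee_fin.
have SE : S = (fine S)%:E by rewrite fineK// ge0_fin_numE.
pose v k := u (k + n)%N.
suff /cvg_ex[l vl] : cvgn v.
  by apply/cvg_ex; exists l; move: vl; rewrite cvg_shiftn.
suff cs : cvgn (series (telescope v)).
  rewrite (_ : v = (fun k => v 0%N + series (telescope v) k)).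
    by apply: is_cvgD => //; exact: is_cvg_cst.
  by apply/funext => k; rewrite -eq_sum_telescope.
apply: normed_cvg; apply: nondecreasing_is_cvgn.
  by apply: nondecreasing_series => k _ _; rewrite /= normr_ge0.
exists (fine S) => _ [k _ <-]; rewrite -lee_fin -SE /series /= -sumEFin.
apply: le_trans (nneseries_lim_ge (P := xpredT) k _); last by move=> i _ _; rewrite lee_fin.
by [].
Qed.

Lemma cabs_increment_sum_le (u : nat -> R[i]) n j :
  ((cabs (u (j + n)%N - u n))%:E <=
   \sum_(k <oo) (cabs (u (k + n).+1 - u (k + n)%N))%:E)%E.
Proof.
apply: le_trans (nneseries_lim_ge (P := xpredT) j _); last first.
  by move=> i _ _; rewrite lee_fin cabs_ge0.
elim: j => [|j IH]; first by rewrite add0n subrr cabs0 big_geq.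
rewrite big_nat_recr//=; apply: le_trans (leeD IH (lexx _)).
rewrite -EFinD lee_fin; apply: le_trans (le_cabsD _ _).
by rewrite [in leRHS]addrC addrA subrK.
Qed.

Context {dX : measure_display} {X : measurableType dX}.

(** The limit is written with upper limits, which are measurable whether or not
    the sequence converges; where the increments are not summable the estimate is
    void. *)
Lemma limit_summable_increments (F : nat -> X -> R[i]) :
  (forall n, cmeasurable setT (F n)) ->
  exists2 G : X -> R[i], cmeasurable setT G &
    forall n x, ((cabs (G x - F n x))%:E <=
      \sum_(k <oo) (cabs (F (k + n).+1 x - F (k + n)%N x))%:E)%E.
Proof.
move=> mF.
pose gr x := fine (limn_esup (fun n => (complex.Re (F n x))%:E)).
pose gi x := fine (limn_esup (fun n => (complex.Im (F n x))%:E)).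
exists (fun x => gr x +i* gi x).
  have mfine (u : nat -> X -> R) : (forall n, measurable_fun setT (u n)) ->
      measurable_fun setT (fun x => fine (limn_esup (fun n => (u n x)%:E))).
    move=> mu.
    have ml : measurable_fun setT (fun x => limn_esup (fun n => (u n x)%:E)).
      apply: (measurable_fun_limn_esup (f := fun n x => (u n x)%:E)) => n.
      exact/measurable_EFinP.
    exact: (measurableT_comp (fine_measurable measurableT) ml).
  by split; apply: mfine => n; have [] := mF n.
move=> n x; set S := (X in (_ <= X)%E).
have [->|Soo] := eqVneq S +oo%E; first by rewrite leey.
have {}Soo : (S < +oo)%E by rewrite ltey.
have cr : cvgn (fun k => complex.Re (F k x)).
  apply: (cvg_summable_increments (n := n)); apply: le_lt_trans Soo.
  apply: lee_nneseries => [i _ _|k _]; first by rewrite lee_fin.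
  by rewrite lee_fin -ReB le_Re_cabs.
have ci : cvgn (fun k => complex.Im (F k x)).
  apply: (cvg_summable_increments (n := n)); apply: le_lt_trans Soo.
  apply: lee_nneseries => [i _ _|k _]; first by rewrite lee_fin.
  by rewrite lee_fin -ImB le_Im_cabs.
have S0 : (0 <= S)%E by apply: nneseries_ge0 => k _ _; rewrite lee_fin cabs_ge0.
have SE : S = (fine S)%:E by rewrite fineK// ge0_fin_numE.
have fineL (u : nat -> R) : cvgn u -> u @ \oo --> fine (limn_esup (EFin \o u)).
  move=> /cvg_ex[l ul].
  have ul' : (EFin \o u) @ \oo --> l%:E by apply: cvg_EFin => //; exact: nearW.
  by have [_ ->] := cvg_limn_einf_sup ul'.
have lr : complex.Re (F k x) @[k --> \oo] --> gr x by exact: fineL.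
have li : complex.Im (F k x) @[k --> \oo] --> gi x by exact: fineL.
rewrite SE lee_fin; apply/ler_addgt0Pl => e e0.
have e20 : 0 < e / 2 by rewrite divr_gt0.
move/cvgrPdist_lt : lr => /(_ _ e20) [N1 _ h1].
move/cvgrPdist_lt : li => /(_ _ e20) [N2 _ h2].
pose N := (maxn N1 N2 + n)%N.
have {}h1 := h1 N (leq_trans (leq_maxl _ _) (leq_addr _ _)).
have {}h2 := h2 N (leq_trans (leq_maxr _ _) (leq_addr _ _)).
have h3 : cabs (F N x - F n x) <= fine S.
  by rewrite -lee_fin -SE; exact: (cabs_increment_sum_le (fun k => F k x)).
have -> : (gr x +i* gi x) - F n x = ((gr x +i* gi x) - F N x) + (F N x - F n x).
  by rewrite addrA subrK.
apply: le_trans (le_cabsD _ _) _; apply: lerD => //.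
apply: le_trans (cabs_le_ReIm _) _; rewrite ReB ImB /=.
by move: h1 h2 => /=; lra.
Qed.

End SummableIncrements.

Section Gronwall.
Context {R : realType}.
Local Notation lam := (@lebesgue_measure R).

Lemma halvesS (c : R) n : c / 2 ^+ n.+1 = 2^-1 * (c / 2 ^+ n).
Proof. by rewrite exprS invfM mulrCA. Qed.

Lemma le_halves_le0 (x c : R) : (forall n, x <= c / 2 ^+ n) -> x <= 0.
Proof.
move=> xc; have h : `|2^-1 : R| < 1 by rewrite ger0_norm ?invr_ge0// invf_lt1 ?ltr1n.
have cv := @cvg_geometric R c 2^-1 h.
have <- : limn (geometric c 2^-1) = 0 by exact: cvg_lim cv.
apply: limr_ge; first by apply/cvg_ex; exists 0.
by apply: nearW => n; rewrite /= exprVn.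
Qed.

Lemma integral_exp_le (L T t : R) : 0 < L -> - T <= t ->
  (\int[lam]_(s in `[(- T)%R, t]) (expR (L * (s + T)))%:E <=
   (L^-1 * expR (L * (t + T)))%:E)%E.
Proof.
move=> L0 Tt; pose f s := expR (L * (s + T)); pose F s := L^-1 * f s.
have dF (x : R) : is_derive x 1 F (f x).
  have -> : f x = L^-1 *: (L *: f x) by rewrite scalerA mulVf ?scale1r// gt_eqF.
  apply: is_deriveZ; rewrite /f.
  have dl : is_derive x 1 (fun s => L * (s + T)) L.
    have d1 : is_derive x 1 (fun s : R => s + T) (1 + 0) by apply: is_deriveD.
    by have := is_deriveZ L d1; rewrite addr0 /GRing.scale /= mulr1.
  have := @is_derive1_comp R expR (fun s => L * (s + T)) x _ L (is_derive_expR _) dl.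
  by rewrite /comp mulrC.
have cF : continuous F.
  by move=> x; apply: differentiable_continuous; apply/derivable1_diffP; have [] := dF x.
have cf : continuous f.
  by move=> x; have -> : f = (fun s => L * F s); [apply/funext => s; rewrite /F mulrA divff ?mul1r// gt_eqF | apply: cvgM; [exact: cvg_cst|exact: cF]].
have [->|nt] := eqVneq t (- T).
  by rewrite set_itv1 integral_set1 lee_fin mulr_ge0 ?expR_ge0// invr_ge0 ltW.
have {}Tt : - T < t by rewrite lt_neqAle eq_sym nt.
rewrite (@continuous_FTC2 _ f F)//.
- by rewrite -EFinB lee_fin /F lerBlDr lerDl mulr_ge0 ?expR_ge0// invr_ge0 ltW.
- exact: continuous_subspaceT.
- split; first by move=> x _; have [] := dF x.
  + by apply: cvg_at_right_filter; exact: cF.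
  + by apply: cvg_at_left_filter; exact: cF.
- by move=> x _; rewrite derive1E; have [_] := dF x.
Qed.

(** Each use of the inequality halves the constant in front of a fixed
    exponential. *)
Lemma gronwall (delta : R -> \bar R) (T K M : R) : 0 <= K ->
  (forall s, 0 <= delta s)%E -> (forall s, delta s <= M%:E)%E ->
  (forall t, t \in `[(- T)%R, T] ->
     delta t <= \int[lam]_(s in `[(- T)%R, t]) (K%:E * delta s))%E ->
  forall t, t \in `[- T, T] -> delta t = 0%E.
Proof.
move=> K0 d0 dM dK.
have M0 : 0 <= M by rewrite -lee_fin (le_trans (d0 0)).
(* [L] is at least [2 * K], for the halving, and positive even if [K = 0]. *)
pose L := 2 * K + 1; have L0 : 0 < L by rewrite /L; lra.
have E0 s : 0 <= expR (L * (s + T)) by exact: expR_ge0.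
have main n : forall t, t \in `[- T, T] ->
    (delta t <= (M / 2 ^+ n * expR (L * (t + T)))%:E)%E.
  elim: n => [|n IH] t tT.
    apply: le_trans (dM t) _; rewrite lee_fin divr1 ler_peMr// -expR0 ler_expR.
    by rewrite mulr_ge0 ?(ltW L0)//; move: tT; rewrite in_itv /=; lra.
  have c0 : 0 <= K * (M / 2 ^+ n) by rewrite mulr_ge0// divr_ge0// exprn_ge0.
  apply: le_trans (dK t tT) _.
  apply: (@le_trans _ _ (\int[lam]_(s in `[(- T)%R, t])
     ((K * (M / 2 ^+ n))%:E * (expR (L * (s + T)))%:E))%E).
    rewrite [leLHS]integral_mkcond [leRHS]integral_mkcond; apply: ge0_le_integral_nm => s.
      by rewrite patchE; case: ifP => // _; rewrite mule_ge0.
    rewrite !patchE; case: ifP => //; rewrite inE /= => st.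
    rewrite -EFinM -mulrA EFinM; apply: lee_wpmul2l; first by rewrite lee_fin.
    apply: IH; move: st tT; rewrite !in_itv /= => /andP[-> h] /andP[_ h2].
    exact: le_trans h h2.
  have mE : measurable_fun `[(- T)%R, t]%classic (fun s : R => (expR (L * (s + T)))%:E).
    apply/measurable_EFinP; apply: measurable_funTS; apply: measurableT_comp => //.
    by apply: measurable_funM => //; exact: measurable_funD.
  rewrite ge0_integralZl//.
  apply: le_trans (lee_wpmul2l _ (integral_exp_le L0 _)) _.
  - by rewrite lee_fin.
  - by move: tT; rewrite in_itv => /andP[].
  have KL : K / L <= 2^-1 by rewrite ler_pdivrMr// /L; lra.
  have cn0 : 0 <= M / 2 ^+ n by rewrite divr_ge0// exprn_ge0.
  have := ler_wpM2r (E0 t) (ler_wpM2r cn0 KL).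
  rewrite -EFinM lee_fin halvesS; apply: le_trans.
  by rewrite le_eqVlt; apply/orP; left; apply/eqP; ring.
move=> t tT; apply/eqP; rewrite eq_le d0 andbT.
have dfin : delta t = (fine (delta t))%:E.
  by rewrite fineK// ge0_fin_numE//; exact: le_lt_trans (dM t) (ltry _).
rewrite dfin lee_fin; apply: (@le_halves_le0 _ (M * expR (L * (t + T)))) => n.
by rewrite -lee_fin -dfin mulrAC; exact: main.
Qed.

End Gronwall.

(** * Fixed points of the Picard map *)

Section FixedPoint.
Context {R : realType} {d : nat}.
Local Notation Rd := 'rV[R]_d.
Local Notation leb := (@lebesgue_rV R d).
Local Notation lam := (@lebesgue_measure R).
Local Notation kappa := (@kappa R d).
Variables (a : Rd -> R) (A : R).
Hypothesis ai : cintegrable leb setT (fun x => (a x)%:C).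
Hypothesis aA : (L1norm leb (fourier (fun x => (a x)%:C)) <= A%:E)%E.
Variables (T : R) (g0 : Rd -> R[i]) (M0 : R).
Hypothesis T0 : 0 < T.
Hypothesis g0i : cintegrable leb setT g0.
Hypothesis g0M : (L1norm leb g0 <= M0%:E)%E.
Local Notation Phi := (picard a T g0).

(** This is how [L^1] estimates in frequency decide equality at every point of
    space. *)
Lemma eq_inv_fourier_L1 (f g : Rd -> R[i]) : cintegrable leb setT f -> cintegrable leb setT g ->
  (L1norm leb (fun y => f y - g y)%R <= 0)%E -> inv_fourier f = inv_fourier g.
Proof.
move=> fi gi fg; apply/funext => x.
have := cabs_inv_fourier_le x (cintegrableB measurableT fi gi) fg.
rewrite inv_fourierB// mulr0 => h; apply/eqP; rewrite -subr_eq0; apply/eqP/cabs_eq0.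
by apply/eqP; rewrite eq_le h cabs_ge0.
Qed.

Lemma eq_picard_force U V :
  (forall t y, t \in `[- T, T] -> duhamel T (force a U) t y = duhamel T (force a V) t y) ->
  Phi U = Phi V.
Proof.
move=> UV; apply/funext => t; apply/funext => y.
have [tT|tT] := boolP (t \in `[- T, T]); last first.
  by transitivity (0 : R[i]); [|apply/esym]; exact: picard_out.
apply: etrans (picard_in a g0 U y tT) _; apply: etrans _ (esym (picard_in a g0 V y tT)).
exact: (congr1 (fun z : R[i] => _ - 'i%C * z) (UV t y tT)).
Qed.

Lemma eq_picard U V : (forall s, inv_fourier (U s) = inv_fourier (V s)) ->
  Phi U = Phi V.
Proof.
move=> UV; apply: eq_picard_force => t y _.
by apply: eq_cintegral => s _; rewrite /force UV.
Qed.

(** Gronwall rather than contraction, since uniqueness must hold against all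
    solutions, however large. *)
Lemma picard_unique M P Q : L1path M P -> L1path M Q -> Phi P = P -> Phi Q = Q ->
  forall t, t \in `[- T, T] -> inv_fourier (P t) = inv_fourier (Q t).
Proof.
move=> pP pQ fP fQ t tT.
apply: eq_inv_fourier_L1; [exact: path_slice pP|exact: path_slice pQ|].
pose K := 3 * kappa ^+ 3 * A * M ^+ 2.
have K0 : 0 <= K.
  by rewrite !mulr_ge0 ?exprn_ge0 ?kappa_ge0 ?(amplitude_ge0 aA) ?(path_ge0 pP).
rewrite (gronwall (delta := fun t => L1norm leb (fun y => P t y - Q t y)) (T := T) K0 _ (M := M + M))//.
- by move=> s; exact: L1norm_ge0.
- move=> s; apply: le_trans (L1normB_le (path_cmeasurable s pP) (path_cmeasurable s pQ)) _.
  by rewrite EFinD; apply: leeD; [exact: pP.2|exact: pQ.2].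
- move=> s sT; have := picard_contraction ai aA g0 pP pQ sT.
  by rewrite fP fQ.
Qed.

Hypothesis small1 : 2 * T * (kappa ^+ 3 * A * (2 * M0) ^+ 3) <= M0.
Hypothesis small2 : 2 * T * (3 * kappa ^+ 3 * A * (2 * M0) ^+ 2) <= 2^-1.

Definition iterate n : R -> Rd -> R[i] := iter n Phi (fun _ _ => 0).

Lemma M0_ge0 : 0 <= M0.
Proof. by rewrite -lee_fin (le_trans (L1norm_ge0 _) g0M). Qed.

Lemma path0 : L1path 0 (fun (_ : R) (_ : Rd) => 0 : R[i]).
Proof.
split; first exact: cmeasurable_cst.
by move=> s; rewrite /L1norm integral0_eq// => y _; rewrite cabs0.
Qed.

Lemma path_iterate n : L1path (2 * M0) (iterate n).
Proof.
elim: n => [|n IH]; first by apply: pathW path0; rewrite mulr_ge0// M0_ge0.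
apply: pathW (path_picard ai aA T0 g0i g0M IH).
by move: small1; lra.
Qed.

Lemma iterate_increment n s :
  (L1norm leb (fun y => iterate n.+1 s y - iterate n s y)%R <= (M0 / 2 ^+ n)%:E)%E.
Proof.
elim: n s => [|n IH] s.
  rewrite (_ : (fun y => _) = Phi (fun _ _ => 0) s); last first.
    by apply/funext => y; rewrite /iterate /= subr0.
  have [_ h] := path_picard ai aA T0 g0i g0M path0.
  by apply: le_trans (h s) _; rewrite expr0n /= !mulr0 addr0 divr1.
apply: le_trans (picard_lipschitz ai aA g0 T0 s (path_iterate n.+1) (path_iterate n) IH) _.
rewrite lee_fin halvesS; apply: ler_wpM2r => //.
by rewrite divr_ge0 ?M0_ge0// exprn_ge0.
Qed.

(** The iterates converge in [L^1] at each time to a limit [G], which is a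
    fixed point up to null sets of frequencies only. But [picard G] depends on
    [G] through the represented functions, so that [picard G] is a fixed point
    exactly. *)
Lemma picard_fixpoint : exists2 P, L1path (2 * M0) P & Phi P = P.
Proof.
have [G mG hG] := limit_summable_increments (F := fun n (z : R * Rd) => iterate n z.1 z.2)
  (fun n => (path_iterate n).1).
have GL n s : (L1norm leb (fun y => G (s, y) - iterate n s y)%R <= (2 * M0 / 2 ^+ n)%:E)%E.
  apply: (@le_trans _ _ (\int[leb]_y \sum_(k <oo)
     (cabs (iterate (k + n).+1 s y - iterate (k + n) s y))%:E)%E).
    by apply: ge0_le_integral_nm => y; [rewrite lee_fin cabs_ge0|exact: (hG n (s, y))].
  rewrite integral_nneseries//; last 2 first.
  - move=> k; apply: measurable_cabs_EFin; apply: cmeasurableB.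
      exact: path_cmeasurable (path_iterate _).
    exact: path_cmeasurable (path_iterate _).
  - by move=> k y _; rewrite lee_fin cabs_ge0.
  have <- := cvg_lim (@ereal_hausdorff R) (@cvg_geometric_eseries_half R (2 * M0) n).
  apply: lee_nneseries => [k _ _|k _]; first exact: L1norm_ge0.
  apply: le_trans (iterate_increment (k + n) s) _.
  by rewrite lee_fin addnS natrX exprS invfM mulrACA divff ?mul1r.
pose Gp s y := G (s, y).
have pG : L1path (2 * M0) Gp.
  split; first by rewrite (_ : (fun z => _) = G)//; apply/funext => -[].
  move=> s; have := GL 0%N s; rewrite expr0 divr1; apply: le_trans.
  rewrite le_eqVlt; apply/orP; left; apply/eqP; apply: eq_integral => y _.
  by rewrite /iterate /= subr0.
have GG s : inv_fourier (Phi Gp s) = inv_fourier (Gp s).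
  have pPG := path_picard ai aA T0 g0i g0M pG.
  apply: eq_inv_fourier_L1; [exact: path_slice pPG|exact: path_slice pG|].
  have h n : (L1norm leb (fun y => Phi Gp s y - Gp s y)%R <= (2 * M0 / 2 ^+ n)%:E)%E.
    apply: le_trans (L1norm_triangle (g := iterate n.+1 s) _ _ _) _.
    - exact: path_cmeasurable pPG.
    - exact: path_cmeasurable (path_iterate _).
    - exact: path_cmeasurable pG.
    have h1 : (L1norm leb (fun y => Phi Gp s y - iterate n.+1 s y)%R <=
        (2^-1 * (2 * M0 / 2 ^+ n))%:E)%E.
      apply: le_trans (picard_lipschitz ai aA g0 T0 s pG (path_iterate n) (GL n)) _.
      rewrite lee_fin; apply: ler_wpM2r => //.
      by rewrite divr_ge0 ?mulr_ge0 ?M0_ge0// exprn_ge0.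
    have h2 : (L1norm leb (fun y => iterate n.+1 s y - Gp s y)%R <=
        (2^-1 * (2 * M0 / 2 ^+ n))%:E)%E.
      rewrite L1norm_distC; apply: le_trans (GL n.+1 s) _.
      by rewrite lee_fin halvesS.
    apply: le_trans (leeD h1 h2) _.
    by rewrite -EFinD lee_fin; lra.
  have := L1norm_ge0 (fun y => Phi Gp s y - Gp s y).
  set D := L1norm _ _ in h *.
  move=> D0; have DE : D = (fine D)%:E.
    by rewrite fineK// ge0_fin_numE//; exact: le_lt_trans (h 0%N) (ltry _).
  rewrite DE lee_fin; apply: (@le_halves_le0 _ _ (2 * M0)) => n.
  by rewrite -lee_fin -DE; exact: h.
have E : Phi (Phi Gp) = Phi Gp by exact: eq_picard.
exists (Phi Gp); last exact: E.
apply: pathW (path_picard ai aA T0 g0i g0M pG).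
by move: small1; lra.
Qed.

End FixedPoint.

(** * Solutions are the fixed points *)

Section Solutions.
Context {R : realType} {d : nat}.
Local Notation Rd := 'rV[R]_d.
Local Notation leb := (@lebesgue_rV R d).
Local Notation lam := (@lebesgue_measure R).
Local Notation kappa := (@kappa R d).
Variable T : R.

(** The path is set to 0 at the times, negligible within the interval, where
    the norm exceeds its essential bound. *)
Lemma wiener_path (u : R -> Rd -> R[i]) : Linfty_wiener T u ->
  exists M V, L1path M V /\
    {ae lam, forall t, t \in `[- T, T] -> {ae leb, forall x, u t x = inv_fourier (V t) x}}.
Proof.
move=> [uhat [mu uF us]].
pose S := Linfty_norm lam `[(- T)%R, T] (fun t => L1norm leb (uhat t)).
(* The bound of a path is nonnegative, whereas [S] might be [-oo]. *)
pose M := Num.max 0 (fine S).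
have SM : (S <= M%:E)%E.
  have := us; rewrite -/S /M; case: (S) => [r _|//|_]; last exact: leNye.
  by rewrite lee_fin le_max lexx orbT.
pose W (z : R * Rd) := if z \in `[- T, T]%classic `*` [set: Rd] then uhat z.1 z.2 else 0.
have mD : measurable (`[- T, T]%classic `*` [set: Rd]) by apply: measurableX.
have mW : cmeasurable setT W.
  by apply: (cmeasurable_if (f := fun z => uhat z.1 z.2)) => //; rewrite setTI.
pose B := [set z : R * Rd | (L1norm leb (fun y => W (z.1, y)) <= M%:E)%E].
have mB : measurable B.
  have mL : measurable_fun setT (fun z : R * Rd => L1norm leb (fun y => W (z.1, y))).
    apply: (measurableT_comp (measurable_L1_param leb mW)).
    exact: measurable_fst.
  by have := emeasurable_fun_infty_c measurableT mL M%:E; rewrite setTI.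
pose V t y := if (t, y) \in B then W (t, y) else 0.
have mV : cmeasurable setT (fun z : R * Rd => V z.1 z.2).
  have : cmeasurable setT (fun z => if z \in B then W z else 0).
    by apply: cmeasurable_if => //; rewrite setTI; apply: cmeasurable_funS mW.
  by congr (cmeasurable setT _); apply/funext => -[t y].
have pV : L1path M V.
  split => // t; rewrite /V.
  have [h|h] := boolP ((L1norm leb (fun y => W (t, y)) <= M%:E)%E).
    rewrite (_ : (fun y => _) = (fun y => W (t, y)))//.
    by apply/funext => y; rewrite mem_set.
  rewrite (_ : (fun y => _) = fun=> 0); last first.
    by apply/funext => y; rewrite memNset//; exact/negP.
  rewrite /L1norm integral0_eq => [|y _]; last by rewrite cabs0.
  by rewrite lee_fin /M le_max lexx.
exists M, V; split => //.
move/ess_supP : SM => SM.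
apply: filterS2 SM uF => t tM tF tT.
have Vu : V t = uhat t.
  have WE y : W (t, y) = uhat t y by rewrite /W mem_set.
  apply/funext => y; rewrite /V mem_set ?WE// /B /=.
  rewrite (_ : (fun y => _) = uhat t); last by apply/funext => z; exact: WE.
  suff : ((fun t => L1norm leb (uhat t)) \_ `[(- T)%R, T] t <= M%:E)%E by rewrite patchE mem_set.
  exact: tM.
rewrite Vu; apply: is_fourier_ae; last by rewrite -Vu; exact: path_slice pV.
exact: tF.
Qed.

Variables (a : Rd -> R) (A : R).
Hypothesis ai : cintegrable leb setT (fun x => (a x)%:C).
Hypothesis aA : (L1norm leb (fourier (fun x => (a x)%:C)) <= A%:E)%E.
Variables (u0 : Rd -> R[i]) (M0 : R).
Hypothesis T0 : 0 < T.
Hypothesis g0i : cintegrable leb setT (fourier u0).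
Hypothesis g0M : (L1norm leb (fourier u0) <= M0%:E)%E.
Local Notation Phi := (picard a T (fourier u0)).

Lemma cintegrable_phase (c : R) (g : Rd -> R[i]) : cintegrable leb setT g ->
  cintegrable leb setT (fun y => cis (- (c * enorm y ^+ 2 / 2)) * g y).
Proof.
apply: cintegrable_cisM => //; apply: measurableT_comp => //.
by apply: measurable_funM => //; apply: measurable_funM => //; apply: measurable_funX; exact: measurable_enorm.
Qed.

Lemma cintegrable_duhamel_force M U t : L1path M U -> t \in `[- T, T] ->
  cintegrable leb setT (duhamel T (force a U) t).
Proof.
move=> pU tT; have [L fL] := force_forcing ai aA pU.
apply: cintegrable_L1norm (L1norm_duhamel_force ai aA pU tT).
exact: cmeasurable_duhamel_slice fL.
Qed.

Lemma inv_fourier_picard_sub M U t x : L1path M U -> t \in `[- T, T] ->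
  inv_fourier (Phi U t) x = propagator (t + T) u0 x -
    'i%C * inv_fourier (duhamel T (force a U) t) x.
Proof.
move=> pU tT.
have -> : Phi U t = (fun y => cis (- ((t + T) * enorm y ^+ 2 / 2)) * fourier u0 y
    - 'i%C * duhamel T (force a U) t y).
  by apply/funext => y; exact: picard_in.
have di := cintegrable_duhamel_force pU tT.
rewrite inv_fourierB//; last 2 first.
- exact: cintegrable_phase.
- exact: cintegrableZl.
by rewrite inv_fourierZ.
Qed.

Lemma inv_fourier_picard M U t x : L1path M U -> t \in `[- T, T] ->
  inv_fourier (Phi U t) x = propagator (t + T) u0 x -
    'i%C * cintegral lam `[- T, t] (fun s =>
      propagator (t - s) (nonlinearity a (inv_fourier (U s))) x).
Proof.
move=> pU tT; have [L fL] := force_forcing ai aA pU.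
rewrite (inv_fourier_picard_sub x pU tT).
by rewrite -(inv_fourier_duhamel T t x fL (fun s => L1norm_force ai aA s pU)).
Qed.

Lemma solution_of_fixpoint M P : L1path M P -> Phi P = P ->
  solution T a u0 (fun t => inv_fourier (P t)).
Proof.
move=> pP fP; split; last first.
  by move=> t x tT; rewrite -(inv_fourier_picard x pP tT) fP.
exists P; split.
- by apply: cmeasurable_funS pP.1.
- by apply: nearW => t _; apply: wiener_is_fourier; exact: path_slice pP.
- apply: (@le_lt_trans _ _ M%:E); last exact: ltry.
  apply/ess_supP; apply: nearW => t; rewrite patchE; case: ifP => _.
    exact: pP.2.
  by rewrite lee_fin (path_ge0 pP).
Qed.

(** In the Duhamel formula the nonlinearity is seen through integrals over
    space and time only, which ignore null sets. So it may be computed from a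
    path [V] that represents [u] almost everywhere; the formula then gives [u
    t] as the function represented by [picard V], at every time and point, and
    [picard V] exerts the same force as [V]. *)
Lemma fixpoint_of_solution u : solution T a u0 u ->
  exists M P, [/\ L1path M P, Phi P = P &
    forall t, t \in `[- T, T] -> u t = inv_fourier (P t)].
Proof.
move=> [/wiener_path[M [V [pV uV]]] uD].
have [L fL] := force_forcing ai aA pV.
have FF : Filter (almost_everywhere lam) by exact: ae_filter_ringOfSetsType.
have Fu : {ae lam, forall s, s \in `[- T, T] -> fourier (nonlinearity a (u s)) = force a V s}.
  apply: (@filterS _ _ FF _ _ _ uV) => s us sT; apply/funext => y.
  apply: ae_eq_cintegral_nm => //.
    apply: cintegrable_cmeasurable; apply: cintegrable_fourier_kernel.
    exact: (cintegrable_nonlinearity ai aA s pV).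
  by apply: filterS (us sT) => x ux _; rewrite /nonlinearity ux.
have sub t s : t \in `[- T, T] -> s \in `[- T, t] -> s \in `[- T, T].
  by rewrite !in_itv /= => /andP[_ h] /andP[-> /le_trans]; apply.
have uE t : t \in `[- T, T] -> u t = inv_fourier (Phi V t).
  move=> tT; apply/funext => x.
  suff h : cintegral lam `[- T, t] (fun s => propagator (t - s) (nonlinearity a (u s)) x) =
      cintegral lam `[- T, t] (fun s =>
        propagator (t - s) (nonlinearity a (inv_fourier (V s))) x).
    apply: etrans (uD t x tT) (esym (etrans (inv_fourier_picard x pV tT) _)).
    exact: (congr1 (fun z : R[i] => propagator (t + T) u0 x - 'i%C * z) (esym h)).
  apply: ae_eq_cintegral_nm => //.
    have mN : cmeasurable setT (fun z : R * Rd =>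
        cis (- ((t - z.1) * enorm z.2 ^+ 2 / 2)) * force a V z.1 z.2).
      apply: cmeasurableM; last exact: fL.1.
      exact: measurable_phase.
    have mF := cmeasurable_inv_fourier_param (U := fun s y =>
        cis (- ((t - s) * enorm y ^+ 2 / 2)) * force a V s y) mN.
    apply: (cmeasurable_comp (f := fun z : R * Rd => inv_fourier (fun y =>
        cis (- ((t - z.1) * enorm y ^+ 2 / 2)) * force a V z.1 y) z.2)
      (p := fun s => (s, x))) mF.
    by apply: measurable_funTS; exact: measurable_fun_pair.
  apply: (@filterS _ _ FF _ _ _ Fu) => s Fs st; rewrite /propagator Fs//.
  exact: sub st.
have pP := path_picard ai aA T0 g0i g0M pV.
exists (M0 + 2 * T * (kappa ^+ 3 * A * M ^+ 3)), (Phi V); split; [exact: pP| |exact: uE].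
apply: eq_picard_force => t y tT.
apply: ae_eq_cintegral_nm => //.
  apply: (@cmeasurable_funS _ _ _ _ setT) => //.
  apply: cmeasurableM; first exact: measurable_phase.
  exact: forcing_slice_t fL.
apply: (@filterS _ _ FF _ _ _ Fu) => s Fs st; have sT := sub _ _ tT st.
by rewrite -(Fs sT) (uE s sT).
Qed.

End Solutions.

(** * The linear evolution of the datum, and the phase correction *)

Section LinearApproximation.
Context {R : realType} {d : nat}.
Local Notation Rd := 'rV[R]_d.
Local Notation leb := (@lebesgue_rV R d).
Local Notation lam := (@lebesgue_measure R).
Local Notation kappa := (@kappa R d).
Variables (a0 : Rd -> R[i]) (T p eps : R) (xi : Rd).
Hypothesis ha0 : cschwartz a0.
Hypothesis eps0 : 0 < eps.
Local Notation q := (eps `^ p).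
Local Notation u0 := (initial_datum T p eps a0 xi).

(** The rescaled frequency [(y - xi) / eps], in the form of an affine map to which
    the change of variables applies. *)
Definition zoom (y : Rd) : Rd := eps^-1 *: y + - (eps^-1 *: xi).

Lemma eps_zoom y : eps *: zoom y = y - xi.
Proof. by rewrite /zoom scalerDr scalerN !scalerA divff ?gt_eqF// !scale1r. Qed.

(** The spectrum of the datum is concentrated at distance [eps] from [xi]. *)
Lemma fourier_initial_datum y : fourier u0 y =
  (q * (eps^-1) ^+ d)%:C * (cis (T / 2 + T * dotrV xi (y - xi)) * fourier a0 (zoom y)).
Proof.
pose f z := cis (- dotrV z (zoom y)) * a0 z.
have fi : cintegrable leb setT f.
  exact: cintegrable_fourier_kernel (cschwartz_cintegrable ha0).
have [ri rE] := cintegral_affine ((eps * T) *: xi) (lt0r_neq0 eps0) fi.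
rewrite gtr0_norm// in rE.
have fE x : cis (- dotrV x y) * u0 x =
    (q%:C * cis (T / 2 + T * dotrV xi (y - xi))) * f (eps *: x + (eps * T) *: xi).
  have zE : eps *: x + (eps * T) *: xi = eps *: (x + T *: xi) by rewrite scalerDr scalerA.
  have dE : dotrV (eps *: (x + T *: xi)) (zoom y) = dotrV (x + T *: xi) (y - xi).
    by rewrite dotrVZl -dotrVZr eps_zoom.
  rewrite /initial_datum /f zE dE.
  have -> : cis (- dotrV x y) = cis (T / 2 + T * dotrV xi (y - xi)) *
      cis (- dotrV (x + T *: xi) (y - xi)) * cis (- (dotrV x xi + T / 2)).
    rewrite -!cisD; congr cis; rewrite dotrVDl dotrVZl !dotrVDr !dotrVNr; ring.
  have c1 : cis (- (dotrV x xi + T / 2)) * cis (dotrV x xi + T / 2) = 1.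
    by rewrite -cisD addNr cis0.
  move: c1; set c2 := cis (- (_ + _)); set c3 := cis (_ + T / 2).
  set c4 := a0 _; set c5 := cis _; set c6 := cis _ => c1.
  by transitivity (q%:C * c5 * (c6 * c4) * (c2 * c3)); [ring|rewrite c1 mulr1].
transitivity (cintegral leb setT (fun x =>
    (q%:C * cis (T / 2 + T * dotrV xi (y - xi))) * f (eps *: x + (eps * T) *: xi))).
  by apply: eq_cintegral => x _; exact: fE.
rewrite (cintegralZl (q%:C * cis (T / 2 + T * dotrV xi (y - xi))) measurableT ri) rE.
rewrite -[cintegral leb setT f]/(fourier a0 (zoom y)) rmorphM /=.
set c1 := fourier _ _; set c2 := cis _; set c3 := (_ ^+ d)%:C.
by ring.
Qed.

Lemma cintegrable_fourier_initial_datum : cintegrable leb setT (fourier u0).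
Proof.
have i0 : eps^-1 != 0 by rewrite invr_eq0 gt_eqF.
have [ri _] := cintegral_affine (- (eps^-1 *: xi)) i0 (fourier_schwartz_cintegrable ha0).
rewrite (_ : fourier u0 = fun y => (q * (eps^-1) ^+ d)%:C *
    (cis (T / 2 + T * dotrV xi (y - xi)) * fourier a0 (zoom y))); last first.
  by apply/funext => y; exact: fourier_initial_datum.
apply: cintegrableZl => //; apply: cintegrable_cisM => //.
apply: measurable_funD => //; apply: measurable_funM => //.
by apply: measurable_dotrV => //; exact: measurable_sub_rV.
Qed.

(** The factors [eps^-d] and [eps^d] of concentration and change of variables
    cancel: the datum has size [eps `^ p] in the Wiener algebra. *)
Lemma L1norm_fourier_initial_datum :
  L1norm leb (fourier u0) = (q%:E * L1norm leb (fourier a0))%E.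
Proof.
have i0 : eps^-1 != 0 by rewrite invr_eq0 gt_eqF.
have fi := fourier_schwartz_cintegrable ha0.
have [ri _] := cintegral_affine (- (eps^-1 *: xi)) i0 fi.
have mf := cintegrable_cmeasurable fi.
have q0 : 0 <= q by exact: powR_ge0.
have e0 : 0 <= q * (eps^-1) ^+ d by rewrite mulr_ge0// exprn_ge0// invr_ge0 ltW.
transitivity ((q * (eps^-1) ^+ d)%:E * L1norm leb (fun y => fourier a0 (zoom y)))%E.
  rewrite /L1norm -ge0_integralZl//; last 2 first.
  - by apply: measurable_cabs_EFin; exact: cintegrable_cmeasurable ri.
  - by move=> y _; rewrite lee_fin cabs_ge0.
  apply: eq_integral => y _; rewrite fourier_initial_datum -EFinM; congr EFin.
  by rewrite cabsM cabs_cisM cabs_real ger0_norm.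
rewrite (L1norm_affine _ i0 mf) muleA -EFinM ger0_norm ?invr_ge0 ?(ltW eps0)//.
by rewrite -mulrA -exprMn mulfV ?expr1n ?mulr1// invr_eq0 gt_eqF.
Qed.

Hypothesis xi1 : enorm xi = 1.

Lemma galilean_phase t (x y : Rd) :
  dotrV x y - (t + T) * enorm y ^+ 2 / 2 + (T / 2 + T * dotrV xi (y - xi)) =
  dotrV x xi - t / 2 + dotrV (eps *: (x - t *: xi)) (zoom y)
  - (t + T) * eps ^+ 2 * enorm (zoom y) ^+ 2 / 2.
Proof.
have yE : y = xi + eps *: zoom y by rewrite eps_zoom addrC subrK.
have xx : dotrV xi xi = 1 by rewrite -sqr_enorm xi1 expr1n.
rewrite {1 2 3}yE; move: (zoom y) => eta.
rewrite [xi + _ - xi]addrC addKr !sqr_enorm.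
rewrite !(dotrVDl, dotrVDr, dotrVZl, dotrVZr, dotrVNl, dotrVNr) xx (dotrVC eta xi).
by field.
Qed.

(** [y = xi + eps *: eta]: the Galilean phases recombine, and what is left of
    the quadratic phase is of size [eps ^+ 2]. *)
Lemma propagator_initial_datum t x : propagator (t + T) u0 x =
  q%:C * cis (dotrV x xi - t / 2) *
  inv_fourier (fun eta => cis (- ((t + T) * eps ^+ 2 * enorm eta ^+ 2 / 2)) * fourier a0 eta)
    (eps *: (x - t *: xi)).
Proof.
pose c : R[i] := (q * (eps^-1) ^+ d)%:C * cis (dotrV x xi - t / 2).
pose g eta := cis (- ((t + T) * eps ^+ 2 * enorm eta ^+ 2 / 2)) * fourier a0 eta.
pose h eta := cis (dotrV (eps *: (x - t *: xi)) eta) * g eta.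
have hi : cintegrable leb setT h.
  apply: cintegrable_inv_fourier_kernel; apply: cintegrable_phase.
  exact: fourier_schwartz_cintegrable.
have i0 : eps^-1 != 0 by rewrite invr_eq0 gt_eqF.
have [ri rE] := cintegral_affine (- (eps^-1 *: xi)) i0 hi.
have E y : cis (dotrV x y) * (cis (- ((t + T) * enorm y ^+ 2 / 2)) * fourier u0 y) =
    c * h (eps^-1 *: y + - (eps^-1 *: xi)).
  rewrite fourier_initial_datum -/(zoom y) /h /g /c.
  have P : cis (dotrV x y) * (cis (- ((t + T) * enorm y ^+ 2 / 2)) *
        cis (T / 2 + T * dotrV xi (y - xi))) =
      cis (dotrV x xi - t / 2) * (cis (dotrV (eps *: (x - t *: xi)) (zoom y)) *
        cis (- ((t + T) * eps ^+ 2 * enorm (zoom y) ^+ 2 / 2))) :> R[i].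
    by rewrite -!cisD; congr cis; have := galilean_phase t x y; lra.
  move: P; set c1 := cis (dotrV x y); set c2 := cis (- _); set c3 := cis (_ + T * _).
  set c4 := cis (_ - t / 2); set c5 := cis _; set c6 := cis (- _) => P.
  set c7 := _%:C; set c8 := fourier _ _.
  transitivity (c7 * (c1 * (c2 * c3)) * c8); first by ring.
  by rewrite P; ring.
transitivity (kappa%:C * cintegral leb setT (fun y => c * h (eps^-1 *: y + - (eps^-1 *: xi)))).
  congr (kappa%:C * _); apply: eq_cintegral => y _; exact: E.
rewrite (cintegralZl c measurableT ri) rE ger0_norm ?invr_ge0 ?(ltW eps0)// invrK /c rmorphM /=.
have ed : (((eps^-1) ^+ d)%:C * (eps ^+ d)%:C : R[i]) = 1.
  by rewrite -rmorphM /= -exprMn mulVf ?expr1n// gt_eqF.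
have -> : inv_fourier (fun eta => cis (- ((t + T) * eps ^+ 2 * enorm eta ^+ 2 / 2)) *
    fourier a0 eta) (eps *: (x - t *: xi)) = kappa%:C * cintegral leb setT h by [].
move: ed; set c1 := (_ ^+ d)%:C; set c2 := (_ ^+ d)%:C; set c3 := cis _.
set c4 := cintegral _ _ _ => ed.
transitivity (q%:C * c3 * (kappa%:C * c4) * (c1 * c2)); first by ring.
by rewrite ed mulr1.
Qed.

(** By [propagator_initial_datum] and Fourier inversion for [a0], the
    difference is an inverse transform of [fourier a0] times a phase minus 1,
    where the phase is at most [T * eps ^+ 2 * enorm eta ^+ 2]. *)
Lemma linear_error (W t : R) x :
  (\int[leb]_eta (enorm eta ^+ 2 * cabs (fourier a0 eta))%:E <= W%:E)%E ->
  t \in `[- T, T] ->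
  cabs (propagator (t + T) u0 x -
    q%:C * a0 (eps *: (x - t *: xi)) * cis (dotrV x xi - t / 2)) <=
  kappa * (2 * T * W) * (q * eps ^+ 2).
Proof.
move=> hW; rewrite in_itv /= => /andP[t1 t2].
have fi := fourier_schwartz_cintegrable ha0.
pose c := (t + T) * eps ^+ 2.
have c0 : 0 <= c by rewrite mulr_ge0 ?sqr_ge0//; lra.
have W0 : 0 <= W.
  rewrite -lee_fin; apply: le_trans hW; apply: integral_ge0 => eta _.
  by rewrite lee_fin mulr_ge0 ?sqr_ge0 ?cabs_ge0.
pose z := eps *: (x - t *: xi).
rewrite propagator_initial_datum -(schwartz_inversion _ ha0) -/z -/c.
set f := fun eta => cis _ * _.
have gi : cintegrable leb setT f by exact: cintegrable_phase.
have -> : q%:C * cis (dotrV x xi - t / 2) * inv_fourier f z -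
    q%:C * inv_fourier (fourier a0) z * cis (dotrV x xi - t / 2) =
    q%:C * (cis (dotrV x xi - t / 2) * inv_fourier (fun eta => f eta - fourier a0 eta) z).
  rewrite inv_fourierB//; set c1 := inv_fourier _ _; set c2 := inv_fourier _ _.
  by set c3 := cis _; ring.
rewrite cabsM cabs_cisM cabs_real ger0_norm ?powR_ge0//.
have -> : kappa * (2 * T * W) * (q * eps ^+ 2) = q * (kappa * (2 * T * eps ^+ 2 * W)) by ring.
apply: ler_wpM2l; first exact: powR_ge0.
apply: cabs_inv_fourier_le; first exact: cintegrableB.
apply: (@le_trans _ _ (c%:E * W%:E)%E); last first.
  rewrite -EFinM lee_fin ler_wpM2r// /c ler_wpM2r ?sqr_ge0//; lra.
apply: le_trans (lee_wpmul2l _ hW); last by rewrite lee_fin.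
rewrite -ge0_integralZl//; last 2 first.
- apply/measurable_EFinP; apply: measurable_funM.
    by apply: measurable_funX; exact: measurable_enorm.
  by apply: measurable_cabs; exact: cintegrable_cmeasurable fi.
- by move=> eta _; rewrite lee_fin mulr_ge0 ?sqr_ge0 ?cabs_ge0.
apply: ge0_le_integral_nm => eta; first by rewrite lee_fin cabs_ge0.
rewrite -EFinM lee_fin /f.
set th := - _; have -> : cis th * fourier a0 eta - fourier a0 eta = (cis th - 1) * fourier a0 eta.
  by rewrite mulrBl mul1r.
rewrite cabsM mulrA; apply: ler_wpM2r; first exact: cabs_ge0.
apply: le_trans (cabs_cisB1 _) _; rewrite /th normrN ger0_norm; last first.
  by rewrite divr_ge0// mulr_ge0// sqr_ge0.
by rewrite le_eqVlt; apply/orP; left; apply/eqP; field.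
Qed.

(** The nonlinear phase is cubic in the amplitude once multiplied by it, hence
    of the size of the Duhamel term that it is meant to describe. *)
Lemma nonlinear_phase_error (alpha : Rd -> R) (B C t : R) x :
  (forall y, cabs (a0 y) <= B) -> (forall y, 0 <= alpha y <= C) ->
  t \in `[- T, T] ->
  cabs (q%:C * a0 (eps *: (x - t *: xi)) * cis (dotrV x xi - t / 2) -
    approx_solution T p eps a0 alpha xi t x) <= 4 * T * C * B ^+ 3 * q ^+ 3.
Proof.
move=> hB hC tT; rewrite /approx_solution.
set A := q%:C * _; set X := (\int[_]_(_ in _) _)%R.
have C0 : 0 <= C by have /andP[] := hC 0; exact: le_trans.
have I0 : (0 <= \int[lam]_(s in `[(- T)%R, t]) (alpha (x - (t - s) *: xi))%:E)%E.
  apply: integral_ge0 => s _; rewrite lee_fin.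
  by have /andP[] := hC (x - (t - s) *: xi).
have X0 : 0 <= X by exact: fine_ge0.
have XC : X <= 2 * T * C.
  have h : (\int[lam]_(s in `[(- T)%R, t]) (alpha (x - (t - s) *: xi))%:E <= (2 * T * C)%:E)%E.
    apply: le_trans (integral_elapsed_le C0 tT).
    rewrite [leLHS]integral_mkcond [leRHS]integral_mkcond; apply: ge0_le_integral_nm => s.
      rewrite patchE; case: ifP => // _; rewrite lee_fin.
      by have /andP[] := hC (x - (t - s) *: xi).
    rewrite !patchE; case: ifP => // _; rewrite lee_fin.
    by have /andP[] := hC (x - (t - s) *: xi).
  rewrite -lee_fin; apply: le_trans (h); rewrite /X /Rintegral fineK//.
  by rewrite ge0_fin_numE// (le_lt_trans h)// ltry.
have AB : cabs A <= q * B.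
  rewrite /A cabsM cabs_real ger0_norm ?powR_ge0//.
  by apply: ler_wpM2l; [exact: powR_ge0|exact: hB].
have q0 : 0 <= q by exact: powR_ge0.
have B0 : 0 <= B by apply: le_trans (hB 0); exact: cabs_ge0.
set c := cis (dotrV x xi - t / 2); pose th := - (cabs A ^+ 2 * X).
rewrite -/th.
have -> : A * c - A * c * cis th = - (c * (A * (cis th - 1))) by ring.
rewrite cabsN cabs_cisM cabsM.
have th2 : cabs (cis th - 1) <= 2 * (cabs A ^+ 2 * X).
  apply: le_trans (cabs_cisB1 _) _.
  by rewrite /th normrN ger0_norm// mulr_ge0// sqr_ge0.
apply: le_trans (ler_wpM2l (cabs_ge0 A) th2) _.
have -> : cabs A * (2 * (cabs A ^+ 2 * X)) = cabs A ^+ 3 * (2 * X) by ring.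
have -> : 4 * T * C * B ^+ 3 * q ^+ 3 = (q * B) ^+ 3 * (2 * (2 * T * C)) by ring.
apply: ler_pM.
- by rewrite exprn_ge0// cabs_ge0.
- by rewrite mulr_ge0.
- by rewrite lerXn2r// nnegrE ?cabs_ge0// mulr_ge0.
- by rewrite ler_wpM2l.
Qed.

End LinearApproximation.

(** * Existence, uniqueness and the error estimate *)

Lemma L1norm_le_fine {R : realType} {d : nat} (f : 'rV[R]_d -> R[i]) :
  cintegrable (lebesgue_rV d) setT f ->
  (L1norm (lebesgue_rV d) f <= (fine (L1norm (lebesgue_rV d) f))%:E)%E.
Proof. by move=> fi; rewrite fineK// L1norm_fin. Qed.

(** The constant of the linear error estimate. *)
Lemma second_moment_fourier {R : realType} {d : nat} (a0 : 'rV[R]_d -> R[i]) :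
  cschwartz a0 -> exists W : R,
    (\int[lebesgue_rV d]_eta (enorm eta ^+ 2 * cabs (fourier a0 eta))%:E <= W%:E)%E.
Proof.
move=> ha0; have [C C0 hC] := fourier_schwartz_decay 1 ha0.
have wi := @integrable_weight R d.
have Ifin : (\int[lebesgue_rV d]_eta (weight (eta : 'rV[R]_d))%:E)%E \is a fin_num.
  by apply: integrable_fin_num.
exists (C * fine (\int[lebesgue_rV d]_eta (weight (eta : 'rV[R]_d))%:E)%E).
have mw : measurable_fun setT (fun eta : 'rV[R]_d => (weight eta)%:E).
  by apply/measurable_EFinP; exact: measurable_weight.
have w0 (eta : 'rV[R]_d) : [set: 'rV[R]_d] eta -> (0 <= (weight eta)%:E)%E.
  by move=> _; rewrite lee_fin weight_ge0.
rewrite EFinM fineK// -(ge0_integralZl _ measurableT mw w0) ?lee_fin//.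
apply: ge0_le_integral_nm => eta; first by rewrite lee_fin mulr_ge0 ?sqr_ge0 ?cabs_ge0.
rewrite -EFinM lee_fin; apply: le_trans (hC eta).
by rewrite expr1 sqr_enorm ler_wpM2r ?cabs_ge0// lerDr.
Qed.

(** As [1 < p], the amplitude [eps `^ p] is at most [eps], which turns the
    smallness of the amplitude into a condition on [eps]. The factor 48 makes
    the Lipschitz constant of [picard] on the ball of radius [2 * M] at most
    [2^-1], and this also keeps the ball stable. *)
Lemma small_data {R : realType} (k T A B p eps : R) :
  0 <= k -> 0 < T -> 0 <= A -> 0 <= B -> 1 < p ->
  0 < eps < (1 + 48 * k * T * A * B ^+ 2)^-1 ->
  let M := eps `^ p * B in
  [/\ eps <= 1, 2 * T * (k * A * (2 * M) ^+ 3) <= M &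
      2 * T * (3 * k * A * (2 * M) ^+ 2) <= 2^-1].
Proof.
move=> k0 T0 A0 B0 p1 /andP[e0 e1] M.
pose Q := k * T * A * B ^+ 2.
have Q0 : 0 <= Q by rewrite !mulr_ge0 ?sqr_ge0// ltW.
have QE : 48 * k * T * A * B ^+ 2 = 48 * Q by rewrite /Q; ring.
have D0 : 0 < 1 + 48 * k * T * A * B ^+ 2 by rewrite QE; lra.
have {}e1 : eps * (1 + 48 * Q) < 1 by rewrite -QE -ltr_pdivlMr// div1r.
have e1' : eps <= 1 by have := mulr_ge0 (ltW e0) Q0; lra.
set q := eps `^ p in M *.
have q0 : 0 <= q by exact: powR_ge0.
have qe : q <= eps.
  rewrite -[leRHS](powRr1 (ltW e0)); apply: ger_powR; last exact: ltW.
  by rewrite e0.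
have q2 : q ^+ 2 <= eps by rewrite expr2; nra.
have qQ : 48 * (q ^+ 2 * Q) <= 1.
  have h1 := ler_wpM2r Q0 q2; lra.
have M0 : 0 <= M by rewrite mulr_ge0.
split => //.
- have -> : 2 * T * (k * A * (2 * M) ^+ 3) = (16 * (q ^+ 2 * Q)) * M by rewrite /M /Q; ring.
  rewrite ler_piMl//; have := mulr_ge0 (sqr_ge0 q) Q0; lra.
- have -> : 2 * T * (3 * k * A * (2 * M) ^+ 2) = 24 * (q ^+ 2 * Q) by rewrite /M /Q; ring.
  lra.
Qed.

(** [3 p] exceeds [3 p - 2 - sigma], and [eps] is at most 1. *)
Lemma le_max_powR {R : realType} (p sigma eps : R) : 0 < eps <= 1 -> 0 < sigma ->
  let m := Num.max (eps `^ (p + 2)) (eps `^ (3 * p - 2 - sigma)) in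
  eps `^ p * eps ^+ 2 <= m /\ (eps `^ p) ^+ 3 <= m.
Proof.
move=> /andP[e0 e1] s0 m; split.
  rewrite /m le_max; apply/orP; left.
  by rewrite powRD ?powR_mulrn ?(ltW e0)//; apply/implyP => _; rewrite gt_eqF.
rewrite /m le_max; apply/orP; right.
rewrite -powR_mulrn ?powR_ge0// -powRrM mulrC.
by apply: ger_powR; [rewrite e0|lra].
Qed.

(** Three errors: dispersion of the linear evolution, the phase of the
    approximation, and the Duhamel term, bounded by its [L^1] norm in
    frequency. *)
Lemma pointwise_error {R : realType} {d : nat} (a0 : 'rV[R]_d -> R[i]) (alpha : 'rV[R]_d -> R)
    (A W B Ca T p eps M : R) (xi : 'rV[R]_d) (P : R -> 'rV[R]_d -> R[i]) t x :
  cschwartz a0 -> 0 < eps -> enorm xi = 1 ->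
  cintegrable (lebesgue_rV d) setT (fun x => (alpha x)%:C) ->
  (L1norm (lebesgue_rV d) (fourier (fun x => (alpha x)%:C)) <= A%:E)%E ->
  (\int[lebesgue_rV d]_eta (enorm eta ^+ 2 * cabs (fourier a0 eta))%:E <= W%:E)%E ->
  (forall y, cabs (a0 y) <= B) -> (forall y, 0 <= alpha y <= Ca) ->
  L1path M P -> picard alpha T (fourier (initial_datum T p eps a0 xi)) P = P ->
  t \in `[- T, T] ->
  cabs (inv_fourier (P t) x - approx_solution T p eps a0 alpha xi t x) <=
  @kappa R d * (2 * T * W) * (eps `^ p * eps ^+ 2) +
  4 * T * Ca * B ^+ 3 * (eps `^ p) ^+ 3 +
  @kappa R d * (2 * T * (@kappa R d ^+ 3 * A * M ^+ 3)).
Proof.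
move=> ha0 e0 xi1 ai aA hW hB hC pP fP tT.
have i0 : cintegrable (lebesgue_rV d) setT (fourier (initial_datum T p eps a0 xi)).
  exact: cintegrable_fourier_initial_datum.
rewrite -[in inv_fourier _]fP (inv_fourier_picard_sub ai aA i0 x pP tT).
have h1 := linear_error p ha0 e0 xi1 x hW tT.
have h2 := nonlinear_phase_error p eps xi x hB hC tT.
have h3 := cabs_inv_fourier_le x (cintegrable_duhamel_force ai aA pP tT)
  (L1norm_duhamel_force ai aA pP tT).
move: h1 h2 h3.
set u := propagator _ _ _; set w := _ * cis _; set v := approx_solution _ _ _ _ _ _ _ _.
set D := inv_fourier _ _ => h1 h2 h3.
have -> : u - 'i%C * D - v = (u - w) + (w - v) - 'i%C * D by ring.
apply: le_trans (le_cabsB _ _) _; rewrite (cabsM 'i%C) cabs_i mul1r; apply: lerD => //.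
by apply: le_trans (le_cabsD _ _) _; exact: lerD.
Qed.

Theorem theorem1p1 (R : realType) (d : nat) (hd : d = 2%N \/ d = 3%N)
    (a0 : 'rV[R]_d -> R[i]) (ha0 : cschwartz a0) :
  exists eps0 : R -> R -> R -> R,
    (forall T p A, 0 < eps0 T p A) /\
    forall (T p : R) (alpha : 'rV[R]_d -> R),
      0 < T -> 1 < p ->
      schwartz alpha -> (forall x, 0 <= alpha x) ->
      compact (closed_support alpha) ->
      closed_support alpha `<=` [set x | enorm x < T] ->
      let eps_max :=
        eps0 T p (fine (L1norm (@lebesgue_rV R d)
                          (fourier (fun x => (alpha x)%:C)))) in
      (forall (eps : R) (xi : 'rV[R]_d),
         0 < eps < eps_max -> enorm xi = 1 ->
         exists u : R -> 'rV[R]_d -> R[i],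
           solution T alpha (initial_datum T p eps a0 xi) u /\
           forall u' : R -> 'rV[R]_d -> R[i],
             solution T alpha (initial_datum T p eps a0 xi) u' ->
             forall t x, t \in `[- T, T] -> u' t x = u t x) /\
      (exists2 sigma0 : R, 0 < sigma0 &
         forall sigma : R, 0 < sigma < sigma0 ->
         exists C : R,
           forall (eps : R) (xi : 'rV[R]_d) (u : R -> 'rV[R]_d -> R[i]),
             0 < eps < eps_max -> enorm xi = 1 ->
             solution T alpha (initial_datum T p eps a0 xi) u ->
             (Linfty_tx_norm T
                (fun t x => u t x - approx_solution T p eps a0 alpha xi t x)%R
              <= (C * Num.max (eps `^ (p + 2)%R)
                              (eps `^ (3 * p - 2 - sigma)%R))%:E)%E).
Proof.
pose leb := @lebesgue_rV R d; pose k := @kappa R d.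
have k0 : 0 <= k by exact: kappa_ge0.
have f0i := fourier_schwartz_cintegrable ha0.
have [B B0 BE] : exists2 B, 0 <= B & L1norm leb (fourier a0) = B%:E.
  exists (fine (L1norm leb (fourier a0))); first by rewrite fine_ge0// L1norm_ge0.
  by rewrite fineK// L1norm_fin.
have k30 : 0 <= k ^+ 3 by rewrite exprn_ge0.
(* The absolute values make the threshold positive for all arguments. *)
exists (fun T p A => (1 + 48 * k ^+ 3 * `|T| * `|A| * B ^+ 2)^-1); split.
  by move=> T p A; rewrite invr_gt0 ltr_pwDl// !mulr_ge0// sqr_ge0.
move=> T p alpha T0 p1 halpha alpha0 _ _.
have ai := cschwartz_cintegrable (cschwartz_real halpha).
pose A := fine (L1norm leb (fourier (fun x => (alpha x)%:C))).
have aA : (L1norm leb (fourier (fun x => (alpha x)%:C)) <= A%:E)%E.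
  apply: L1norm_le_fine; apply: fourier_schwartz_cintegrable; exact: cschwartz_real.
have A0 : 0 <= A by exact: amplitude_ge0 aA.
rewrite -/leb -/A /= (ger0_norm (ltW T0)) (ger0_norm A0); clearbody A.
have data eps xi : 0 < eps < (1 + 48 * k ^+ 3 * T * A * B ^+ 2)^-1 -> enorm xi = 1 ->
    let M := eps `^ p * B in let u0 := initial_datum T p eps a0 xi in
    [/\ cintegrable leb setT (fourier u0), (L1norm leb (fourier u0) <= M%:E)%E &
        exists2 P, L1path (2 * M) P & picard alpha T (fourier u0) P = P].
  move=> heps xi1 M u0; have [e1 s1 s2] := small_data k30 T0 A0 B0 p1 heps.
  have e0 : 0 < eps by case/andP: heps.
  have i0 : cintegrable leb setT (fourier u0) by exact: cintegrable_fourier_initial_datum.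
  have n0 : (L1norm leb (fourier u0) <= M%:E)%E.
    by rewrite /u0 /leb L1norm_fourier_initial_datum// -/leb BE -EFinM.
  by split => //; apply: (picard_fixpoint ai aA T0 i0 n0).
have unique eps xi u P : 0 < eps < (1 + 48 * k ^+ 3 * T * A * B ^+ 2)^-1 -> enorm xi = 1 ->
    solution T alpha (initial_datum T p eps a0 xi) u ->
    L1path (2 * (eps `^ p * B)) P -> picard alpha T (fourier (initial_datum T p eps a0 xi)) P = P ->
    forall t, t \in `[- T, T] -> u t = inv_fourier (P t).
  move=> heps xi1 uS pP fP t tT; have [i0 n0 _] := data _ _ heps xi1.
  have [M' [P' [pP' fP' ->//]]] := fixpoint_of_solution ai aA T0 i0 n0 uS.
  apply: (picard_unique ai aA (M := Num.max M' (2 * (eps `^ p * B))) _ _ fP' fP tT).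
    by apply: pathW pP'; rewrite le_max lexx.
  by apply: pathW pP; rewrite le_max lexx orbT.
split.
  move=> eps xi heps xi1; have [i0 n0 [P pP fP]] := data _ _ heps xi1.
  exists (fun t => inv_fourier (P t)); split.
    exact: (solution_of_fixpoint ai aA i0 pP fP).
  by move=> u' u'S t x tT; rewrite (unique _ _ _ _ heps xi1 u'S pP fP t tT).
exists 1 => // sigma /andP[sigma0 _].
have [W hW] := second_moment_fourier ha0.
have [Ba Ba0 hBa] := cschwartz_bounded ha0.
have [Ca Ca0 hCa] := cschwartz_bounded (cschwartz_real halpha).
have hCa' y : 0 <= alpha y <= Ca.
  by rewrite alpha0 /=; have := hCa y; rewrite cabs_real; apply: le_trans; exact: ler_norm.
have W0 : 0 <= W.
  rewrite -lee_fin; apply: le_trans hW; apply: integral_ge0 => eta _.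
  by rewrite lee_fin mulr_ge0 ?sqr_ge0 ?cabs_ge0.
pose C1 := k * (2 * T * W); pose C2 := 4 * T * Ca * Ba ^+ 3.
pose C3 := k * (2 * T * (k ^+ 3 * A * (2 * B) ^+ 3)).
have T0' := ltW T0.
have C10 : 0 <= C1 by rewrite !mulr_ge0.
have C20 : 0 <= C2 by rewrite !mulr_ge0// exprn_ge0.
have B30 : 0 <= (2 * B) ^+ 3 by apply: exprn_ge0; exact: mulr_ge0.
have C30 : 0 <= C3.
  apply: mulr_ge0 => //; apply: mulr_ge0; first exact: mulr_ge0.
  by apply: mulr_ge0 => //; exact: mulr_ge0.
exists (C1 + C2 + C3) => eps xi u heps xi1 uS.
have [i0 n0 [P pP fP]] := data _ _ heps xi1.
have e0 : 0 < eps by case/andP: heps.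
have [e1 _ _] := small_data k30 T0 A0 B0 p1 heps.
have e01 : 0 < eps <= 1 by rewrite e0.
have [] := le_max_powR p e01 sigma0.
set m := Num.max _ _; set q := eps `^ p => m1 m2.
have m0 : 0 <= m by rewrite (le_trans _ m2)// exprn_ge0// powR_ge0.
apply/ess_supP; apply: nearW => -[t x]; rewrite patchE; case: ifPn => [|_]; last first.
  by rewrite lee_fin mulr_ge0// !addr_ge0.
rewrite inE => -[/= tT _]; rewrite lee_fin (unique _ _ _ _ heps xi1 uS pP fP t tT).
apply: le_trans (pointwise_error x ha0 e0 xi1 ai aA hW hBa hCa' pP fP tT) _.
rewrite -/k -/C1 -/C2.
have -> : k * (2 * T * (k ^+ 3 * A * (2 * (q * B)) ^+ 3)) = C3 * q ^+ 3.
  by rewrite /C3; ring.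
rewrite !mulrDl; apply: lerD; last exact: ler_wpM2l.
by apply: lerD; exact: ler_wpM2l.
Qed.
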